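(* Let $p$ be an odd prime. If $p\equiv1\pmod4$ and $p=x^2+4y^2$ with $x,y\in\mathbb Z$, then $$\sum_{k=0}^{p-1}\frac{\binom{2k}k^3}{64^k(2k-1)^2}\equiv2x^2-p-\frac{p^2}{2x^2}\pmod{p^3}.$$ If $p\equiv3\pmod4$, then $$\sum_{k=0}^{p-1}\frac{\binom{2k}k^3}{64^k(2k-1)^2}\equiv\frac{3(p+1)^2}{2^p}\binom{(p-1)/2}{(p-3)/4}^2+\frac34p^2\binom{(p-1)/2}{(p-3)/4}^2E_{p-3}-\frac{p^2}2\binom{(p-1)/2}{(p-3)/4}^{-2}\pmod{p^3}.$$
   Context: Congruences modulo $p^3$ are between rational numbers whose denominators are not divisible by $p$. The Euler numbers $\{E_n\}$ are given by $E_{2n-1}=0$, $E_0=1$, $E_{2n}=-\sum_{k=1}^n\binom{2n}{2k}E_{2n-2k}$ for $n=1,2,3,\ldots$. *)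

(* Defs.v *)
From mathcomp Require Import all_boot all_order all_algebra.

Set Implicit Arguments.
Unset Strict Implicit.
Unset Printing Implicit Defensive.

Import Order.TTheory GRing.Theory Num.Theory.

Local Open Scope ring_scope.

(* Membership in the localization of the integers at the prime p. *)
Definition pintegral (p : nat) (r : rat) : bool := ~~ (p%:Z %| denq r)%Z.

(* Congruence modulo p ^ n in that localization; both sides are required to
   lie in it. *)
Definition eqmodq (p n : nat) (a b : rat) : Prop :=
  [/\ pintegral p a, pintegral p b & pintegral p ((a - b) / p%:R ^+ n)].

(* euler_evens n = [:: E_0; E_2; ...; E_(2 * n)] *)
Fixpoint euler_evens (n : nat) : seq int :=
  if n is m.+1 then
    let s := euler_evens m in
    rcons s (- \sum_(1 <= k < n.+1) 'C(2 * n, 2 * k)%:Z * s`_(n - k))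
  else [:: 1].

Definition euler (n : nat) : int :=
  if odd n then 0 else (euler_evens n./2)`_(n./2).

Lemma size_euler_evens n : size (euler_evens n) = n.+1.
Proof. by elim: n => //= n IHn; rewrite size_rcons IHn. Qed.

Lemma nth_euler_evens m n :
  (m <= n)%N -> (euler_evens n)`_m = (euler_evens m)`_m.
Proof.
elim: n => [|n IHn]; first by rewrite leqn0 => /eqP->.
rewrite leq_eqVlt => /orP[/eqP-> // | lt_mn].
by rewrite /= nth_rcons size_euler_evens lt_mn IHn.
Qed.

Lemma euler0 : euler 0 = 1. Proof. by []. Qed.

Lemma euler_odd n : (0 < n)%N -> euler (2 * n - 1) = 0.
Proof. by move=> n_gt0; rewrite /euler oddB ?muln_gt0 // oddM. Qed.

Lemma euler_even n : (0 < n)%N ->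
  euler (2 * n) =
    - \sum_(1 <= k < n.+1) 'C(2 * n, 2 * k)%:Z * euler (2 * n - 2 * k).
Proof.
case: n => // n _.
rewrite {1}/euler mul2n odd_double doubleK /= nth_rcons size_euler_evens.
rewrite ltnn eqxx -mul2n; congr (- _); rewrite !big_nat.
apply: eq_bigr => k /andP[k_gt0 _]; congr (_ * _).
rewrite -mulnBr /euler mul2n odd_double doubleK nth_euler_evens //.
by case: k k_gt0 => // k _; rewrite subSS leq_subr.
Qed.

(* Main.v *)
(** Put [s a = \sum_(k < p) (-a)_k (a+1)_k (1/2)_k / k!^3].  Telescoping gives
    [2 \sum_k C(2k,k)^3 / (64^k (2k-1)^2) = s(-1/2) + 3 s(1/2)] modulo [p^3].
    The sums [s] satisfy [a^2 s(a) - (a-1)^2 s(a-2) = boundary term], and the boundary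
    term vanishes modulo [p^3] at the points [a = j - p/2] with [1 < j < p].  The chain
    starts from [s(-p/2) = 2^(p-1)], which follows from the values of [s] at [0, p, -p]
    because [s] is quadratic on [pR]; multiplying consecutive steps of the two parity
    classes gives [s(-1/2) s(1/2) = -p^2].

    If [p = 3 mod 4], the chain reaches [1/2] from [-p/2] and writes [s(1/2)] as a
    quotient of products of factors [(i - p/2)^2 = i (i - p) (1 + p^2 / (4 i^2))].
    Morley's congruence turns it into a binomial coefficient, and the remaining
    alternating sum of inverse squares is an Euler number.

    If [p = 4 k0 + 1], the chain reaches [-1/2], and [s(-1/2)] is the square of the
    ratio of [C(3 k_r, k_r)] for [k_r = (p^r - 1) / 4] and two consecutive large [r].
    That ratio is, up to sign, a quartic Jacobi sum [J]: both are the unit eigenvalue of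
    the operator that multiplies by [((1 - X^p) / (1 - X))^(1/2)], then keeps the exponents in
    [k0 + p N].  Its trace, computed on the Teichmueller representatives, yields [J].
    Replacing the exponent [1/2] by [7/2] makes everything polynomial modulo [p^3].
    Finally [J J' = p] and [J + J' = 2 A] with [p = A^2 + B^2] and [A] odd, so
    [A^2 = x^2]. *)

Require Import Defs.
From mathcomp Require Import all_boot all_order all_algebra.
From mathcomp Require Import cyclic.
From mathcomp Require Import ring zify.

Set Implicit Arguments.
Unset Strict Implicit.
Unset Printing Implicit Defensive.

Import Order.TTheory GRing.Theory Num.Theory.

Local Open Scope ring_scope.

(** By Clausen's formula [s(n)] is [P_n(0)^2] for the Legendre polynomial [P_n], up to truncation.
    Its recurrence is the square of [n P_n(0) = - (n-1) P_(n-2)(0)], which explains the step 2 and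
    the vanishing at odd [n].

    The obstacle is [p = 1 mod 4]: the chain only gives a quotient of products, and its link with
    [x] must hold modulo [p^3]. At [k_r] with [r > 2] one has [4 k_r = -1] exactly in the ring, so
    all ratios of neighbouring binomials become constants independent of [r]. This turns the passage
    from [r] to [r + 1] into an eigenvalue problem.

    The exponent 7/2 has two causes. A power [(1 - X^p) / (1 - X)] to the [a] is a polynomial modulo
    [p^3] once its degree [a (p - 1)] is at least [2 p], since the binomial expansion stops after
    the square of a multiple of [p]. Differentiation ties exponent [a] to [a - 1], so both must
    qualify, and 5/2 is the smallest half-integer that does. The relations then have leading factors
    9, 5, 1, whence the constant 45. *)

Section BigSplit.
Variables (T : Type) (idx : T) (op : Monoid.com_law idx).

Lemma big_parity n (F : nat -> T) :
  \big[op/idx]_(i < 2 * n) F i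
  = op (\big[op/idx]_(i < n) F (2 * i)%N) (\big[op/idx]_(i < n) F (2 * i).+1).
Proof.
elim: n => [|n IHn]; first by rewrite muln0 !big_ord0 Monoid.mul1m.
by rewrite mulnS add2n !big_ord_recr /= IHn -Monoid.mulmA Monoid.mulmACA.
Qed.

Lemma big_fold_half n (F : nat -> T) :
  \big[op/idx]_(i < 2 * n) F i
  = op (\big[op/idx]_(i < n) F i) (\big[op/idx]_(i < n) F (2 * n - i.+1)%N).
Proof.
rewrite mul2n -addnn big_split_ord /=; congr (op _ _).
rewrite (reindex_inj rev_ord_inj) /=; apply: eq_bigr => i _.
by rewrite addnBA.
Qed.

End BigSplit.

(** * Clausen-type sums *)

Section ClausenSum.

Variable A : comUnitRingType.
Implicit Types (a n : A) (k : nat).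

(* As C(2k, k) / 4^k = (1/2)_k / k!, [clausen_sum K n] is the truncation to K terms
   of 3F2(-n, n + 1, 1/2; 1, 1; 1). *)
Definition shifted_prod n k := \prod_(i < k) ((i%:R - n) * (i%:R + 1 + n)).
Definition clausen_weight k : A := 'C(2 * k, k)%:R / (4 ^+ k * k`!%:R ^+ 2).
Definition clausen_sum K n := \sum_(k < K) clausen_weight k * shifted_prod n k.

Lemma shifted_prod0 n : shifted_prod n 0 = 1.
Proof. exact: big_ord0. Qed.

Lemma shifted_prodS n k :
  shifted_prod n k.+1 = shifted_prod n k * ((k%:R - n) * (k%:R + 1 + n)).
Proof. exact: big_ord_recr. Qed.

(** Together with the reflected form below, this puts the terms of [s(a)] and [s(a-2)] over the
    common base [(1-a)_k (a)_k], with no division by [a]. *)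
Lemma shifted_prod_shift a k :
  shifted_prod a k.+1 = - (a + k%:R + 1) * (a + k%:R) * shifted_prod (a - 1) k.
Proof.
elim: k => [|k IHk]; first by rewrite shifted_prodS !shifted_prod0; ring.
by rewrite shifted_prodS IHk shifted_prodS -natr1; ring.
Qed.

Lemma shifted_prod_sym a k : shifted_prod (- 1 - a) k = shifted_prod a k.
Proof. by apply: eq_bigr => i _; ring. Qed.

Lemma clausen_sum_sym K a : clausen_sum K (- 1 - a) = clausen_sum K a.
Proof. by apply: eq_bigr => i _; rewrite shifted_prod_sym. Qed.

Lemma shifted_prod_shift2 a k :
  shifted_prod (a - 2) k.+1
  = - (k%:R + 2 - a) * (k%:R + 1 - a) * shifted_prod (a - 1) k.
Proof.
rewrite -shifted_prod_sym shifted_prod_shift -(shifted_prod_sym _ k).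
rewrite (_ : -1 - (-1 - (a - 2) - 1) = a - 1); first by ring.
by ring.
Qed.

Lemma central_bin_rec k :
  (k.+1 * 'C(2 * k.+1, k.+1) = 2 * (2 * k + 1) * 'C(2 * k, k))%N.
Proof.
have h1 := mul_bin_diag (2 * k).+1 k; have h2 := mul_bin_left (2 * k).+1 k.
have h3 := mul_bin_diag (2 * k) k; have h4 := mul_bin_left (2 * k) k.
have h5 := binS (2 * k).+1 k; have h6 := binS (2*k) k.
rewrite (_ : 2 * k.+1 = (2 * k).+2)%N; last by lia.
nia.
Qed.

Lemma clausen_weight_rec k : (4 : A) \is a GRing.unit ->
  k.+1`!%:R \is a @GRing.unit A ->
  2 * (k.+1%:R) ^+ 3 * clausen_weight k.+1 = (2 * k%:R + 1) * clausen_weight k.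
Proof.
move=> u4 uf.
have [u1 uk] : (k.+1%:R : A) \is a GRing.unit /\ (k`!%:R : A) \is a GRing.unit.
  by apply/andP; rewrite -unitrM -natrM -factS.
have u2 : (2 : A) \is a GRing.unit.
  by move: u4; rewrite (_ : 4 = 2 * 2) ?unitrM -?natrM // => /andP[].
have e := congr1 (fun i : nat => i%:R : A) (central_bin_rec k).
rewrite /= !natrM natrD natrM in e.
rewrite /clausen_weight factS natrM.
have -> : 4 ^+ k.+1 * (k.+1%:R * k`!%:R) ^+ 2
   = (4 * (k.+1%:R) ^+ 2) * (4 ^+ k * (k`!%:R) ^+ 2) :> A by rewrite exprS; ring.
rewrite [in LHS]invrM ?unitrM ?unitrX ?uk ?u4 ?u1 //.
have -> : 2 * k.+1%:R ^+ 3
    * ('C(2 * k.+1, k.+1)%:R * ((4 ^+ k * k`!%:R ^+ 2)^-1 / (4 * k.+1%:R ^+ 2)))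
  = 2 * (k.+1%:R * 'C(2 * k.+1, k.+1)%:R) * (4 ^+ k * k`!%:R ^+ 2)^-1
     * (k.+1%:R ^+ 2 / (4 * k.+1%:R ^+ 2)) :> A by ring.
rewrite e (_ : k.+1%:R ^+ 2 / (4 * k.+1%:R ^+ 2) = 4^-1); last first.
  by rewrite invrM ?unitrX // mulrA divrr ?mul1r ?unitrX.
rewrite (_ : _ * 4^-1 = (4 / 4) * ((2 * k%:R + 1) * 'C(2 * k, k)%:R
                          * (4 ^+ k * k`!%:R ^+ 2)^-1)); last by ring.
by rewrite divrr // mul1r -!mulrA.
Qed.

(** The right-hand side is the telescoping certificate: its increment in [K] is the new term of the
    left-hand side, once both shifts are taken to the base at [a - 1]. For an integer [a] and a
    complete sum it vanishes and the squared Legendre recurrence remains. *)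
Lemma clausen_sum_rec K a :
  (4 : A) \is a GRing.unit -> K`!%:R \is a @GRing.unit A ->
  a ^+ 2 * clausen_sum K.+1 a - (a - 1) ^+ 2 * clausen_sum K.+1 (a - 2)
  = (2 * a - 1) * (2 * K%:R + 1) * clausen_weight K * shifted_prod (a - 1) K.
Proof.
move=> u4; elim: K => [|K IHK] uf.
  rewrite /clausen_sum !big_ord1 !shifted_prod0 /clausen_weight bin0 fact0.
  by rewrite expr0 expr1n mulr1 divr1; ring.
have uK : K`!%:R \is a @GRing.unit A.
  by move: uf; rewrite factS natrM unitrM => /andP[].
have e := clausen_weight_rec u4 uf.
have {IHK}IHK := IHK uK.
rewrite /clausen_sum !(big_ord_recr K.+1) /= -/(clausen_sum _ _) -/(clausen_sum _ _).
rewrite !mulrDr opprD addrACA IHK -(mulrA _ _ (clausen_weight K)) -e.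
rewrite shifted_prod_shift shifted_prod_shift2 shifted_prodS -!natr1.
ring.
Qed.

End ClausenSum.

Lemma prod_add_bin (A : comNzRingType) n k :
  \prod_(i < k) (i%:R + 1 + n%:R : A) = 'C(n + k, k)%:R * k`!%:R.
Proof.
rewrite -natrM bin_ffact; elim: k => [|k IHk]; first by rewrite big_ord0 ffactn0.
by rewrite big_ord_recr /= IHk addnS ffactnS /= natrM -natr1 natrD; ring.
Qed.

Lemma clausen_term_nat (A : comUnitRingType) n k :
  (4 : A) \is a GRing.unit -> (k`!%:R : A) \is a GRing.unit ->
  clausen_weight A k * shifted_prod n%:R k
  = (-1) ^+ k * ('C(2 * k, k) * 'C(n, k) * 'C(n + k, k))%:R / 4 ^+ k.
Proof.
move=> u4 uk.
have e : shifted_prod (n%:R : A) k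
    = (-1) ^+ k * ('C(n, k) * 'C(n + k, k))%:R * (k`!%:R) ^+ 2.
  rewrite /shifted_prod big_split /=.
  have -> : \prod_(i < k) (i%:R - n%:R : A) = (-1) ^+ k * 'C(n, k)%:R * k`!%:R.
    rewrite -mulrA -natrM bin_ffact; elim: k {uk} => [|k IHk].
      by rewrite big_ord0 ffactn0 mulr1.
    rewrite big_ord_recr /= IHk ffactnSr exprS natrM.
    have [le_kn | lt_nk] := leqP k n; first by rewrite natrB //; ring.
    by rewrite ffact_small // ?mulr0 ?mul0r ?mulr0.
  by rewrite prod_add_bin natrM; ring.
rewrite /clausen_weight e.
have uf : (k`!%:R ^+ 2 : A) \is a GRing.unit by rewrite unitrX.
rewrite invrM ?unitrX // !natrM.
transitivity ((-1) ^+ k * ('C(2 * k, k)%:R * 'C(n, k)%:R * 'C(n + k, k)%:R)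
  / 4 ^+ k * (k`!%:R ^+ 2 / k`!%:R ^+ 2) : A); first by ring.
by rewrite divrr // mulr1.
Qed.

Lemma shifted_prod_eq0 (A : comUnitRingType) (n : A) k i :
  (i < k)%N -> (i%:R - n) * (i%:R + 1 + n) = 0 -> shifted_prod n k = 0.
Proof.
by move=> lt_ik n0; rewrite /shifted_prod (bigD1 (Ordinal lt_ik)) //= n0 mul0r.
Qed.

Lemma clausen_sum0 (A : comUnitRingType) K : clausen_sum K.+1 (0 : A) = 1.
Proof.
rewrite /clausen_sum big_ord_recl shifted_prod0 /clausen_weight.
rewrite bin0 fact0 expr0 expr1n !mulr1 divr1.
rewrite big1 ?addr0 // => i _.
by rewrite (@shifted_prod_eq0 _ _ _ 0) ?mulr0 // subr0 mul0r.
Qed.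

(** The value is [P_n(0)^2] with [P_n] odd. At [n = 1] the recurrence has [(a-1)^2 = 0], which
    starts the induction. The field is [rat] because [n = p] is wanted, and [p!] has no inverse
    modulo [p^3]. *)
Lemma clausen_sum_odd K n : odd n -> (n <= K)%N ->
  clausen_sum K.+1 (n%:R : rat) = 0.
Proof.
move=> odd_n; rewrite -[n]odd_double_half odd_n /= add1n -mul2n.
elim: (n./2) => {odd_n} [|h IHh] lt_hK.
  have := @clausen_sum_rec rat K 1 isT; rewrite unitfE pnatr_eq0 -lt0n fact_gt0.
  move=> /(_ isT); rewrite subrr expr0n /= mul0r subr0 expr1n mul1r => ->.
  rewrite (@shifted_prod_eq0 _ _ _ 0) ?mulr0 // ?sub0r ?oppr0 ?mul0r //; lia.
have IH : clausen_sum K.+1 ((2 * h).+1%:R : rat) = 0 by apply: IHh; lia.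
have := @clausen_sum_rec rat K (2 * h.+1).+1%:R isT.
rewrite unitfE pnatr_eq0 -lt0n fact_gt0 => /(_ isT).
rewrite (_ : (2 * h.+1).+1%:R - 2 = (2 * h).+1%:R :> rat); last first.
  by rewrite mulnS add2n -!natr1; ring.
rewrite IH mulr0 subr0 (@shifted_prod_eq0 _ _ _ (2 * h.+1)) //; last first.
  by rewrite -natr1 addrK subrr mul0r.
by rewrite mulr0 => /eqP; rewrite mulf_eq0 expf_eq0 pnatr_eq0 /= => /eqP.
Qed.

(** At the centre [-1/2] of the reflection both Pochhammer factors equal [(1/2)_k]. *)
Lemma shifted_prod_half (A : comUnitRingType) k : (4 : A) \is a GRing.unit ->
  shifted_prod (- 2^-1 : A) k = ('C(2 * k, k)%:R * k`!%:R / 4 ^+ k) ^+ 2.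
Proof.
move=> u4; have u2 : (2 : A) \is a GRing.unit.
  by move: u4; rewrite (_ : 4 = 2 * 2) ?unitrM -?natrM // => /andP[].
have e2 : 2 / 2 = 1 :> A by rewrite divrr.
elim: k => [|k IHk]; first by rewrite shifted_prod0 bin0 expr0 divr1 mulr1 expr1n.
have e := congr1 (fun i : nat => i%:R : A) (central_bin_rec k).
rewrite /= natrM [RHS]natrM natrM natrD natrM in e.
rewrite shifted_prodS IHk factS natrM.
have -> : 'C(2 * k.+1, k.+1)%:R * (k.+1%:R * k`!%:R)
    = 2 * (2 * k%:R + 1) * 'C(2 * k, k)%:R * k`!%:R :> A by rewrite -e; ring.
rewrite (exprS 4 k) invrM ?unitrX //.
have e4 : 4^-1 = 2^-1 * 2^-1 :> A by rewrite -invrM // -natrM.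
rewrite e4; set C := 'C(_, _)%:R; set f := k`!%:R; set w := (4 ^+ k)^-1.
transitivity ((C * f * w) ^+ 2 * ((k%:R + 2^-1) * (k%:R + (2 / 2 - 2^-1)))).
  by rewrite e2; ring.
transitivity ((C * f * w) ^+ 2 * (k%:R + 2^-1) ^+ 2); first by ring.
transitivity ((C * f * w) ^+ 2 * (2 / 2 * k%:R + 2^-1) ^+ 2); first by rewrite e2; ring.
transitivity ((C * f * w) ^+ 2 * ((2 / 2) * 2^-1 * (2 * k%:R + 1)) ^+ 2); last by ring.
transitivity ((C * f * w) ^+ 2 * (2^-1 * (2 * k%:R + 1)) ^+ 2); first by ring.
by rewrite e2; ring.
Qed.

Lemma clausen_term_half (A : comUnitRingType) k :
  (4 : A) \is a GRing.unit -> (k`!%:R : A) \is a GRing.unit ->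
  clausen_weight A k * shifted_prod (- 2^-1) k = 'C(2 * k, k)%:R ^+ 3 / 64 ^+ k.
Proof.
move=> u4 uf; rewrite shifted_prod_half // /clausen_weight.
have -> : 64 ^+ k = (4 ^+ k) ^+ 3 :> A by rewrite exprAC; congr (_ ^+ _); ring.
have uf2 : (k`!%:R ^+ 2 : A) \is a GRing.unit by rewrite unitrX.
rewrite invrM ?unitrX // -exprVn.
set C := 'C(_, _)%:R; set f := k`!%:R in uf uf2 *; set w := (4 ^+ k)^-1.
transitivity (C ^+ 3 * w ^+ 3 * (f / f) ^+ 2); first by ring.
by rewrite divrr // expr1n mulr1 exprVn.
Qed.

(** The natural form of this term has [2k+1] in the denominator, which is [p] at [k = (p-1)/2].
    Replacing [C(2k+2,k+1) / (2k+1)] by [2 C(2k,k) / (k+1)] keeps all denominators invertible. *)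
Lemma clausen_term_half1 (A : comUnitRingType) k :
  (4 : A) \is a GRing.unit -> (k.+1`!%:R : A) \is a GRing.unit ->
  clausen_weight A k.+1 * shifted_prod 2^-1 k.+1
  = - (2 * 'C(2 * k.+1, k.+1)%:R ^+ 2 * 'C(2 * k, k)%:R * (2 * k%:R + 3)
       / (64 ^+ k.+1 * k.+1%:R)).
Proof.
move=> u4; rewrite factS natrM unitrM => /andP[uk uf].
have u2 : (2 : A) \is a GRing.unit.
  by move: u4; rewrite (_ : 4 = 2 * 2) ?unitrM -?natrM // => /andP[].
have e2 : 2 / 2 = 1 :> A by rewrite divrr.
have ek : k.+1%:R / k.+1%:R = 1 :> A by rewrite divrr.
have ef : k`!%:R / k`!%:R = 1 :> A by rewrite divrr.
have e4 : 4^-1 = 2^-1 * 2^-1 :> A by rewrite -invrM // -natrM.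
have e := congr1 (fun i : nat => i%:R : A) (central_bin_rec k).
rewrite /= natrM [RHS]natrM natrM natrD natrM in e.
rewrite shifted_prod_shift (_ : 2^-1 - 1 = - 2^-1); last first.
  by transitivity (2^-1 - 2 / 2 : A); [rewrite e2 | ring].
rewrite shifted_prod_half // /clausen_weight factS natrM.
have -> : 64 ^+ k.+1 = (4 ^+ k.+1) ^+ 3 :> A by rewrite exprAC; congr (_ ^+ _); ring.
have ew : (4 ^+ k.+1)^-1 = (4 ^+ k)^-1 * (2^-1 / 2) :> A.
  by rewrite exprS invrM ?unitrX // e4.
have -> : (4 ^+ k.+1 * (k.+1%:R * k`!%:R) ^+ 2)^-1
    = (4 ^+ k.+1)^-1 * (k`!%:R^-1 * k.+1%:R^-1) ^+ 2 :> A.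
  rewrite [LHS]invrM ?unitrX ?unitrM ?uk // [LHS]mulrC; congr (_ * _).
  by rewrite -exprVn invrM.
have -> : ((4 ^+ k.+1) ^+ 3 * k.+1%:R)^-1 = ((4 ^+ k.+1)^-1) ^+ 3 * k.+1%:R^-1 :> A.
  by rewrite [LHS]invrM ?unitrX // [LHS]mulrC exprVn.
rewrite ew.
set C := 'C(2 * k, k)%:R in e *; set C1 := 'C(_, _)%:R in e *.
set f := k`!%:R in ef *; set w := (4 ^+ k)^-1; set v := k.+1%:R^-1 in ek *.
set h := 2^-1 in e2 *.
transitivity (- ((f / f) ^+ 2 * (C1 * v ^+ 2 * (w * (h * h)) * w ^+ 2 * C ^+ 2
   * ((h + (2 * h) * k%:R + 2 * h) * (h + (2 * h) * k%:R))))).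
  by rewrite e2; ring.
rewrite ef; transitivity (- ((2 * h) ^+ 2 * (C1 * v ^+ 2 * w ^+ 3 * C ^+ 2 * h ^+ 4
   * (2 * k%:R + 3) * (2 * k%:R + 1)))); first by rewrite [in RHS]e2; ring.
transitivity (- (2 * C1 * (2 * (2 * k%:R + 1) * C) * C * (2 * k%:R + 3) * v ^+ 2
   * (w * (h * h)) ^+ 3)); first by ring.
rewrite -e; transitivity (- (2 * C1 ^+ 2 * (k.+1%:R * v) * C * (2 * k%:R + 3) * v
   * (w * (h * h)) ^+ 3)); first by ring.
by rewrite ek; ring.
Qed.

(** With [v = (w-1)/(w-u)] the product [(1-v)(1-uv)] is [w] times a square, so a quadratic character
    sum over a quadratic polynomial becomes one over [w]. *)
Lemma moebius_sub (F : fieldType) (u w : F) : w != u ->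
  (1 - (w - 1) / (w - u) = (1 - u) / (w - u))
  * (1 - u * ((w - 1) / (w - u)) = w * ((1 - u) / (w - u))).
Proof. by rewrite -subr_eq0 => h; split; field. Qed.

Lemma moebiusK (F : fieldType) (u v : F) : u != 1 -> v != 1 ->
  ((1 - u * v) / (1 - v) - 1) / ((1 - u * v) / (1 - v) - u) = v.
Proof.
rewrite [u == 1]eq_sym [v == 1]eq_sym -!(subr_eq0 1) => u1 v1.
have -> : (1 - u * v) / (1 - v) - 1 = v * ((1 - u) / (1 - v)) by field.
have -> : (1 - u * v) / (1 - v) - u = (1 - u) / (1 - v) by field.
by rewrite mulfK // mulf_neq0 // invr_neq0.
Qed.

(** * Telescoping the sum to the two Clausen values *)

Section RationalSums.

Definition binom_cube k : rat := 'C(2 * k, k)%:R ^+ 3 / 64 ^+ k.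

Lemma natr_double_sub1_neq0 n : 2 * n%:R - 1 != 0 :> rat.
Proof.
rewrite subr_eq0 -natrM; apply/eqP => /(congr1 (fun x : rat => x * 1)).
rewrite !mulr1 => /eqP; rewrite (eqr_nat _ _ 1) => /eqP; lia.
Qed.

Lemma binom_cubeS n :
  8 * n.+1%:R ^+ 3 * binom_cube n.+1 = (2 * n%:R + 1) ^+ 3 * binom_cube n.
Proof.
have e := congr1 (fun i : nat => i%:R : rat) (central_bin_rec n).
rewrite /= natrM [RHS]natrM natrM natrD natrM in e.
rewrite /binom_cube (exprS 64).
transitivity ((n.+1%:R * 'C(2 * n.+1, n.+1)%:R) ^+ 3 / (8 * 64 ^+ n) : rat).
  by field; rewrite expf_neq0.
by rewrite e; field; rewrite expf_neq0.
Qed.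

(** The last term is a telescoping certificate, checked with the ratio of consecutive cubes. At
    [n = p] it carries the factor [p^3] over the unit [(2p-1)^2]. The middle sum is [s(1/2)], whose
    terms are those of [s(-1/2)] times [- (2k+1)/(2k-1)]. *)
Lemma sum_binom_cube n :
  2 * \sum_(k < n) ('C(2 * k, k)%:R ^+ 3 / (64 ^+ k * (2 * k%:R - 1) ^+ 2))
  = \sum_(k < n) binom_cube k
    + 3 * - \sum_(k < n) binom_cube k * ((2 * k%:R + 1) / (2 * k%:R - 1))
    - 16 * n%:R ^+ 3 * binom_cube n / (2 * n%:R - 1) ^+ 2.
Proof.
elim: n => [|n IHn]; first by rewrite !big_ord0; field.
rewrite !big_ord_recr /= mulrDr IHn.
have n1 := natr_double_sub1_neq0 n; have n2 := natr_double_sub1_neq0 n.+1.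
have e64 : 64 ^+ n != 0 :> rat by rewrite expf_neq0.
have -> : 16 * n.+1%:R ^+ 3 * binom_cube n.+1 = 2 * ((2 * n%:R + 1) ^+ 3 * binom_cube n).
  by rewrite -binom_cubeS; ring.
have -> : 'C(2 * n, n)%:R ^+ 3 / (64 ^+ n * (2 * n%:R - 1) ^+ 2)
    = binom_cube n / (2 * n%:R - 1) ^+ 2 :> rat.
  by rewrite /binom_cube; field; rewrite n1 e64.
move: n2; rewrite -[n.+1%:R]natr1 => n2.
by field; rewrite n1 n2.
Qed.

Lemma binom_cube_catalan k :
  binom_cube k.+1 * ((2 * k.+1%:R + 1) / (2 * k.+1%:R - 1))
  = 2 * 'C(2 * k.+1, k.+1)%:R ^+ 2 * 'C(2 * k, k)%:R * (2 * k%:R + 3)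
       / (64 ^+ k.+1 * k.+1%:R).
Proof.
have e := congr1 (fun i : nat => i%:R : rat) (central_bin_rec k).
rewrite /= natrM [RHS]natrM natrM natrD natrM in e.
have n2 := natr_double_sub1_neq0 k.+1.
have k1 : k.+1%:R != 0 :> rat by rewrite pnatr_eq0.
have e64 : 64 ^+ k.+1 != 0 :> rat by rewrite expf_neq0.
rewrite /binom_cube; set C1 := 'C(2 * k.+1, k.+1)%:R in e *.
transitivity (C1 ^+ 2 * (k.+1%:R * C1) * (2 * k.+1%:R + 1)
   / (64 ^+ k.+1 * k.+1%:R * (2 * k.+1%:R - 1)) : rat).
  by field; rewrite [1 + _]addrC natr1 n2 k1 e64.
rewrite e; move: n2 k1; rewrite -[k.+1%:R]natr1 => n2 k1.
by field; rewrite ?[1 + _]addrC e64 k1 n2.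
Qed.

End RationalSums.

(** * Uniqueness of the representation of a prime by two squares *)

(** Here [p] divides [(ay - xb)(ay + xb)], and the sign of [b] is free, so [ay - xb = c p]. The
    two-square identity bounds [c^2] by 1. The case [c = 0] gives [a^2 = x^2]; the case [c^2 = 1]
    gives [a^2 = y^2], against parity. *)
Lemma sum_two_squares_uniq (p : nat) (a b x y : int) : prime p ->
  a ^+ 2 + b ^+ 2 = p%:Z -> x ^+ 2 + y ^+ 2 = p%:Z ->
  (a%:~R : 'F_2) = 1 -> (y%:~R : 'F_2) = 0 -> a ^+ 2 = x ^+ 2.
Proof.
move=> p_pr eab exy a1 y0.
wlog dvd : b eab / (p %| a * y - x * b)%Z.
  have : (p %| (a * y - x * b) * (a * y + x * b))%Z.
    rewrite (_ : _ * _ = p%:Z * (a ^+ 2 - x ^+ 2)) ?dvdz_mulr //.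
    transitivity ((x ^+ 2 + y ^+ 2) * a ^+ 2 - x ^+ 2 * (a ^+ 2 + b ^+ 2)); first by ring.
    by rewrite eab exy; ring.
  rewrite dvdzE abszM Euclid_dvdM // => /orP[d | d] H; first exact: (H b eab d).
  by apply: (H (- b)); [rewrite sqrrN | rewrite mulrN opprK].
have p0 : 0 < p%:Z by rewrite ltz_nat prime_gt0.
case/dvdzP: dvd => c ec.
have norm : (a * x + b * y) ^+ 2 + c ^+ 2 * p%:Z ^+ 2 = p%:Z ^+ 2.
  rewrite -exprMn -ec; transitivity ((a ^+ 2 + b ^+ 2) * (x ^+ 2 + y ^+ 2)); first by ring.
  by rewrite eab exy expr2.
have c1 : c ^+ 2 <= 1.
  by rewrite -(ler_pM2r (exprn_gt0 2 p0)) mul1r -[leRHS]norm lerDr sqr_ge0.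
have [c0 | c0] := eqVneq c 0.
  move: ec; rewrite c0 mul0r => /eqP; rewrite subr_eq0 => /eqP e.
  have : p%:Z * (a ^+ 2 - x ^+ 2) = 0.
    transitivity ((x ^+ 2 + y ^+ 2) * a ^+ 2 - x ^+ 2 * (a ^+ 2 + b ^+ 2)).
      by rewrite eab exy; ring.
    transitivity ((a * y) ^+ 2 - (x * b) ^+ 2); first by ring.
    by rewrite e subrr.
  by move/eqP; rewrite mulf_eq0 gt_eqF //= subr_eq0 => /eqP.
have c21 : c ^+ 2 = 1.
  by apply/eqP; rewrite eq_le c1 /= -gtz0_ge1 exprn_even_gt0.
have e0 : a * x = - (b * y).
  move: norm; rewrite c21 mul1r => /eqP; rewrite -subr_eq0 addrK sqrf_eq0 addr_eq0.
  by move/eqP.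
have : p%:Z * (a ^+ 2 - y ^+ 2) = 0.
  transitivity ((a * x) ^+ 2 - (b * y) ^+ 2).
    transitivity (a ^+ 2 * (x ^+ 2 + y ^+ 2) - y ^+ 2 * (a ^+ 2 + b ^+ 2)).
      by rewrite eab exy; ring.
    by ring.
  by rewrite e0 sqrrN subrr.
move/eqP; rewrite mulf_eq0 gt_eqF //= subr_eq0 => /eqP /(congr1 (fun i : int => i%:~R : 'F_2)).
by rewrite !rmorphXn /= a1 y0 expr1n expr0n.
Qed.

(** * Reduction of rationals modulo p^3 *)

Section Reduction.

(* [R] plays the role of Z/p^3; working with an abstract ring keeps unification from
   unfolding the arithmetic of ['Z_(p ^ 3)]. *)
Variables (p : nat) (R : comUnitRingType).
Hypothesis p_pr : prime p.
Hypothesis P3 : (p%:R : R) ^+ 3 = 0.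
Hypothesis unitN : forall n, ~~ (p %| n)%N -> (n%:R : R) \is a GRing.unit.

(** [ratr] divides in [R], where the inverse of a non-unit is a default value; the integrality
    clause makes the quotient genuine. *)
Definition reduces (r : rat) (x : R) := pintegral p r /\ ratr r = x.

Lemma unitZ (d : int) : ~~ (p %| d)%Z = (d%:~R \is a @GRing.unit R).
Proof.
rewrite dvdzE /=; apply/idP/idP => [nd | u].
  have := unitN nd; case: (d) => n //= u; rewrite NegzE rmorphN unitrN.
  exact: u.
apply/negP => /dvdnP[c ec]; move: u.
have -> : d%:~R = (-1) ^+ (d < 0)%R * c%:R * p%:R :> R.
  by rewrite {1}(intEsign d) rmorphM rmorphXn rmorphN1 -mulrA -natrM -ec.
move/(unitrX 3); rewrite exprMn P3 mulr0 unitr0 //.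
Qed.

Lemma pintegralP r : pintegral p r = ((denq r)%:~R \is a @GRing.unit R).
Proof. exact: unitZ. Qed.

(** The fraction need not be in lowest terms: the reduced denominator divides [d], so it is a unit
    too. The ring operations below rest on this freedom. *)
Lemma reduces_frac (a d : int) : (d%:~R : R) \is a GRing.unit ->
  reduces (a%:~R / d%:~R) (a%:~R / d%:~R).
Proof.
move=> ud; set r := a%:~R / d%:~R.
have d0 : d != 0 by apply: contraTneq ud => ->; rewrite unitr0.
have e : numq r * d = a * denq r.
  apply: (@intr_inj rat); rewrite !rmorphM /=.
  by rewrite numqE /r mulrAC divfK ?intr_eq0.
have uden : (denq r)%:~R \is a @GRing.unit R.
  have : (denq r %| d)%Z.
    rewrite -(@Gauss_dvdzr _ (numq r)) ?e ?dvdz_mull //.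
    by rewrite coprimezE coprime_sym coprime_num_den.
  by case/dvdzP => c ec; move: ud; rewrite ec rmorphM unitrM => /andP[].
split; first by rewrite pintegralP.
apply: (mulIr uden); rewrite divrK // mulrAC; apply: (mulIr ud).
by rewrite divrK // -!rmorphM e.
Qed.

Lemma reduces_fracP r x : reduces r x -> exists a d : int,
  [/\ (d%:~R : R) \is a GRing.unit, r = a%:~R / d%:~R & x = a%:~R / d%:~R].
Proof.
by case; rewrite pintegralP => u <-; exists (numq r), (denq r); rewrite divq_num_den.
Qed.

Lemma reduces_int (n : int) : reduces n%:~R n%:~R.
Proof. by have := @reduces_frac n 1; rewrite !divr1 unitr1; apply. Qed.

Lemma reduces_nat n : reduces n%:R n%:R.
Proof. exact: (reduces_int n). Qed.

Lemma reducesD r x r' x' : reduces r x -> reduces r' x' -> reduces (r + r') (x + x').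
Proof.
move=> /reduces_fracP[a [d [u -> ->]]] /reduces_fracP[a' [d' [u' -> ->]]].
have d0 : d%:~R != 0 :> rat.
  by rewrite intr_eq0; apply: contraTneq u => ->; rewrite unitr0.
have d0' : d'%:~R != 0 :> rat.
  by rewrite intr_eq0; apply: contraTneq u' => ->; rewrite unitr0.
have := @reduces_frac (a * d' + a' * d) (d * d').
rewrite !rmorphD !rmorphM /= unitrM u u' => /(_ isT).
rewrite (_ : (_ + _) / _ = a%:~R / d%:~R + a'%:~R / d'%:~R); last by field; rewrite d0 d0'.
by rewrite mulrDl invrM // !mulrA mulrK // (mulrAC _ _ d'%:~R^-1) mulrK // mulrAC.
Qed.

Lemma reducesM r x r' x' : reduces r x -> reduces r' x' -> reduces (r * r') (x * x').
Proof.
move=> /reduces_fracP[a [d [u -> ->]]] /reduces_fracP[a' [d' [u' -> ->]]].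
have := @reduces_frac (a * a') (d * d'); rewrite !rmorphM /= unitrM u u' => /(_ isT).
by rewrite invfM invrM // mulrACA [X in reduces _ X -> _](_ : _
  = a%:~R / d%:~R * (a'%:~R / d'%:~R)) //; ring.
Qed.

Lemma reducesN r x : reduces r x -> reduces (- r) (- x).
Proof.
move=> rx; rewrite -mulN1r -[- x]mulN1r; apply: reducesM rx.
by have := reduces_int (-1); rewrite !rmorphN1.
Qed.

Lemma reducesB r x r' x' : reduces r x -> reduces r' x' -> reduces (r - r') (x - x').
Proof. by move=> h h'; apply/reducesD/reducesN. Qed.

Lemma reducesX r x n : reduces r x -> reduces (r ^+ n) (x ^+ n).
Proof.
move=> h; elim: n => [|n IHn]; first exact: (reduces_nat 1).
by rewrite !exprS; apply: reducesM.
Qed.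

Lemma reducesV r x : reduces r x -> x \is a GRing.unit -> reduces r^-1 x^-1.
Proof.
move=> /reduces_fracP[a [d [u -> ->]]]; rewrite unitrM unitrV u andbT => ua.
have := @reduces_frac d a ua.
by rewrite invf_div invrM ?unitrV // invrK.
Qed.

Lemma reduces_div r x r' x' : reduces r x -> reduces r' x' -> x' \is a GRing.unit ->
  reduces (r / r') (x / x').
Proof. by move=> h h' u; apply/reducesM/reducesV. Qed.

Lemma reduces_sum (I : Type) (l : seq I) (Q : pred I) (F : I -> rat) (G : I -> R) :
  (forall i, Q i -> reduces (F i) (G i)) ->
  reduces (\sum_(i <- l | Q i) F i) (\sum_(i <- l | Q i) G i).
Proof.
move=> h; apply: (big_ind2 reduces) => //; first exact: (reduces_nat 0).
by move=> *; apply: reducesD.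
Qed.

Hypothesis R_char : forall n : int, n%:~R = 0 :> R -> ((p ^ 3)%N %| n)%Z.

Lemma reduces_eqmodq r r' x : reduces r x -> reduces r' x -> eqmodq p 3 r r'.
Proof.
move=> h h'; split; [by case: h | by case: h' | ].
have := reducesB h h'; rewrite subrr => /reduces_fracP[a [d [u -> e]]].
have {}e : a%:~R = 0 :> R.
  by rewrite -[LHS](divrK u) -e mul0r.
have [c ->] := dvdzP (R_char e).
rewrite (_ : _ / p%:R ^+ 3 = c%:~R / d%:~R); first by case: (reduces_frac c u).
have p0 : p%:R != 0 :> rat by rewrite pnatr_eq0 -lt0n prime_gt0.
have d0 : d%:~R != 0 :> rat.
  by rewrite intr_eq0; apply: contraTneq u => ->; rewrite unitr0.
by rewrite rmorphM /= -[(p ^ 3)%N%:~R]/((p ^ 3)%N%:R) natrX; field; rewrite d0 p0.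
Qed.

End Reduction.

(** * Euler numbers *)

Section EulerNumbers.

Lemma bin_mul_bin n i j : ('C(n, i) * 'C(n - i, j) = 'C(n, j) * 'C(n - j, i))%N.
Proof.
have [le_ijn | lt_nij] := leqP (i + j) n; last first.
  have [lt_ni | le_in] := ltnP n i.
    by rewrite (bin_small lt_ni) mul0n [X in (_ * X)%N]bin_small ?muln0 //; lia.
  rewrite (@bin_small (n - i)) ?muln0; last by lia.
  have [lt_nj | le_jn] := ltnP n j; first by rewrite bin_small.
  by rewrite [X in (_ * X)%N]bin_small ?muln0 //; lia.
have f0 : (0 < i`! * j`! * (n - i - j)`!)%N by rewrite !muln_gt0 !fact_gt0.
apply/eqP; rewrite -(eqn_pmul2r f0); apply/eqP.
transitivity n`!.
  rewrite -(@bin_fact n i); last by lia.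
  by rewrite -(@bin_fact (n - i) j); [ring | lia].
rewrite -(@bin_fact n j); last by lia.
rewrite -(@bin_fact (n - j) i); last by lia.
by rewrite (_ : n - j - i = n - i - j)%N; [ring | lia].
Qed.

Lemma euler_odd0 n : odd n -> euler n = 0.
Proof. by rewrite /euler => ->. Qed.

(** Coefficient form of [cosh t] times the exponential generating function of the [E_n] being 1. The
    parity indicator holds the coefficients of [cosh]. *)
Lemma euler_conv n :
  \sum_(i < n.+1) 'C(n, i)%:R * (~~ odd (n - i))%:R * euler i = (n == 0%N)%:R.
Proof.
have [odd_n | even_n] := boolP (odd n).
  rewrite big1; first by case: n odd_n.
  move=> i _; have [odd_i | even_i] := boolP (odd i).
    by rewrite euler_odd0 // mulr0.
  by rewrite oddB -1?ltnS // odd_n (negbTE even_i) mulr0 mul0r.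
rewrite -[n]odd_double_half (negbTE even_n) add0n -mul2n.
case: (n./2) => [|h]; first by rewrite muln0 big_ord1.
rewrite big_ord_recr /= subnn binn /= mulr1 mul1r euler_even // big_add1 /= big_mkord.
rewrite (big_parity _ h.+1 (fun i =>
  'C(2 * h.+1, i)%:R * (~~ odd (2 * h.+1 - i))%:R * euler i)) /= [X in _ + X + _]big1 ?addr0;
    last first.
  by move=> i _; rewrite euler_odd0 ?mulr0 //= mul2n odd_double.
rewrite (reindex_inj rev_ord_inj) /= -sumrB big1 // => i _.
have hi := ltn_ord i.
rewrite (_ : 2 * (h.+1 - i.+1) = 2 * h.+1 - 2 * i.+1)%N; last by lia.
by rewrite natz bin_sub ?subKn ?mul2n ?odd_double ?mulr1 ?subrr //; lia.
Qed.

(* [euler_poly n x] is 2^n E_n((x + 1) / 2), for the Euler polynomial E_n. *)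
Definition euler_poly n (x : int) := \sum_(i < n.+1) 'C(n, i)%:R * euler i * x ^+ (n - i).

Lemma expr_shift_wide k n (x y : int) : (k <= n)%N ->
  (y + x) ^+ k = \sum_(j < n.+1) 'C(k, j)%:R * y ^+ (k - j) * x ^+ j.
Proof.
move=> le_kn; rewrite exprDn (big_ord_widen n.+1 (fun j => (y ^+ (k - j) * x ^+ j) *+ 'C(k, j))) //.
rewrite big_mkcond; apply: eq_bigr => j _; rewrite -mulr_natl mulrA.
by case: ltnP => // lt_kj; rewrite bin_small // !mul0r.
Qed.

(** The generating function of [euler_poly] is [e^(xt) / cosh t], and [e^t + e^(-t) = 2 cosh t]. *)
Lemma euler_poly_add n x : euler_poly n (1 + x) + euler_poly n (-1 + x) = 2 * x ^+ n.
Proof.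
rewrite /euler_poly -big_split /=.
transitivity (\sum_(i < n.+1) \sum_(j < n.+1) 2 * x ^+ j * 'C(n, j)%:R
  * ('C(n - j, i)%:R * (~~ odd (n - j - i) && (i <= n - j))%N%:R * euler i)).
  apply: eq_bigr => i _; rewrite -mulrDr !(@expr_shift_wide _ n) ?leq_subr //.
  rewrite -big_split mulr_sumr /=; apply: eq_bigr => j _.
  have := congr1 (fun k : nat => k%:R : int) (bin_mul_bin n i j); rewrite !natrM => e.
  transitivity (('C(n, i)%:R * 'C(n - i, j)%:R) * euler i * x ^+ j
      * (1 ^+ (n - i - j) + (-1) ^+ (n - i - j))); first by ring.
  rewrite e expr1n -signr_odd.
  have [le_inj | lt_nji] := leqP i (n - j); last by rewrite (bin_small lt_nji); ring.
  rewrite andbT (_ : n - i - j = n - j - i)%N; last by lia.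
  by case: (odd _) => /=; ring.
rewrite exchange_big (bigD1 ord_max) //= [X in _ + X]big1 ?addr0; last first.
  move=> j nj; rewrite -mulr_sumr.
  rewrite [X in _ * X](_ : _ = (n - j == 0)%N%:R); last first.
    rewrite -euler_conv (big_ord_widen n.+1 (fun i => 'C(n - j, i)%:R
      * (~~ odd (n - j - i))%:R * euler i)) ?ltnS ?leq_subr // [RHS]big_mkcond /=.
    apply: eq_bigr => i _; rewrite ltnS; case: (i <= n - j)%N.
      by rewrite andbT.
    by rewrite andbF mulr0 mul0r.
  rewrite (_ : (n - j == 0)%N = false) ?mulr0 //.
  apply: contra_neqF nj => h; apply/val_inj => /=; have := ltn_ord j; lia.
rewrite -mulr_sumr binn mulr1 subnn -[RHS]mulr1; congr (_ * _).
rewrite (bigD1 ord0) //= [X in _ + X]big1 ?addr0; first by rewrite bin0 euler0.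
by move=> i; rewrite -val_eqE /= -lt0n => h; rewrite leqNgt h mulr0 mul0r.
Qed.

Lemma euler_poly1 n : (0 < n)%N -> ~~ odd n -> euler_poly n 1 = 0.
Proof.
move=> n_gt0 even_n; have := euler_poly_add n 0.
have -> : euler_poly n (-1 + 0) = euler_poly n (1 + 0).
  apply: eq_bigr => i _; rewrite !addr0 expr1n.
  have [odd_i | even_i] := boolP (odd i); first by rewrite euler_odd0 // mulr0 !mul0r.
  by rewrite -signr_odd oddB -1?ltnS // (negbTE even_n) (negbTE even_i).
by rewrite addr0 expr0n eqn0Ngt n_gt0 mulr0; lia.
Qed.

(** The alternating sum telescopes by the functional equation at [x = 2 (i+1)]; the lower end is the
    value at 1, which is 0. For [2m + 1 = p] the upper end is [E_n] modulo [p]. *)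
Lemma euler_poly_alt_sum n m : (0 < n)%N -> ~~ odd n ->
  2 * \sum_(i < m) (-1) ^+ i * (2 * i.+1)%:Z ^+ n = - (-1) ^+ m * euler_poly n (2 * m).+1%:Z.
Proof.
move=> n_gt0 even_n; elim: m => [|m IHm].
  by rewrite big_ord0 muln0 euler_poly1 // !mulr0.
rewrite big_ord_recr mulrDr IHm mulrCA -euler_poly_add exprS /=.
have -> : -1 + (2 * m.+1)%:Z = (2 * m).+1%:Z by lia.
have -> : 1 + (2 * m.+1)%:Z = (2 * m.+1).+1%:Z by lia.
by ring.
Qed.

Lemma euler_poly_mod n x : exists c, euler_poly n x = euler n + x * c.
Proof.
exists (\sum_(i < n) 'C(n, i)%:R * euler i * x ^+ (n - i).-1).
rewrite /euler_poly big_ord_recr /= subnn binn mulr1 mul1r addrC; congr (_ + _).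
rewrite mulr_sumr; apply: eq_bigr => i _; rewrite mulrCA -exprS prednK //.
by rewrite subn_gt0.
Qed.

End EulerNumbers.

(** * Congruences of Wolstenholme and Morley *)

Section ModCube.

Variables (p : nat) (R : comUnitRingType).
Hypotheses (p_pr : prime p) (p_gt3 : (3 < p)%N).
Hypothesis P3 : (p%:R : R) ^+ 3 = 0.
Hypothesis unitN : forall n, ~~ (p %| n)%N -> (n%:R : R) \is a GRing.unit.

Local Notation P := (p%:R : R).
Local Notation m := (p./2).
Implicit Types (x y c : R) (i j n : nat).

Lemma p_odd : odd p.
Proof. by case: (even_prime p_pr) p_gt3 => [->|]. Qed.

Lemma p_eq : p = (2 * m).+1.
Proof. by rewrite -[LHS]odd_double_half p_odd mul2n. Qed.

Lemma P_eq : P = 2 * m%:R + 1.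
Proof. by rewrite [in LHS]p_eq -natr1 natrM. Qed.

Lemma unit_lt i : (0 < i < p)%N -> (i%:R : R) \is a GRing.unit.
Proof. by move=> hi; apply: unitN; rewrite gtnNdvd; lia. Qed.

Lemma unit2 : (2 : R) \is a GRing.unit.
Proof. by apply: unit_lt; lia. Qed.

Lemma unit3 : (3 : R) \is a GRing.unit.
Proof. by apply: unit_lt; lia. Qed.

Lemma unit4 : (4 : R) \is a GRing.unit.
Proof. by rewrite (_ : 4 = 2 * 2) ?unitrM ?unit2 // -natrM. Qed.

Lemma unit_fact k : (k < p)%N -> (k`!%:R : R) \is a GRing.unit.
Proof.
elim: k => [|k IHk] hk; first by rewrite unitr1.
by rewrite factS natrM unitrM IHk ?unit_lt //; lia.
Qed.

(** [P] is nilpotent; the witness is the geometric series cut after the square. *)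
Lemma unitDP x c : x \is a GRing.unit -> x + P * c \is a GRing.unit.
Proof.
move=> ux; apply/unitrPr.
exists (x^-1 - P * c * x^-1 ^+ 2 + P ^+ 2 * c ^+ 2 * x^-1 ^+ 3).
have e : x * x^-1 = 1 by rewrite divrr.
transitivity (x * x^-1 - P * c * x^-1 * (x * x^-1) + P * c * x^-1
  + P ^+ 2 * c ^+ 2 * x^-1 ^+ 2 * (x * x^-1 - 1) + P ^+ 3 * c ^+ 3 * x^-1 ^+ 3).
  by ring.
by rewrite e P3; ring.
Qed.

Lemma inv_sqr_P2 x y : x \is a GRing.unit -> y \is a GRing.unit ->
  P ^+ 2 * x ^+ 2 = P ^+ 2 * y ^+ 2 -> P ^+ 2 / x ^+ 2 = P ^+ 2 / y ^+ 2.
Proof.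
move=> ux uy e; have ux2 : x ^+ 2 \is a GRing.unit by rewrite unitrX.
have uy2 : y ^+ 2 \is a GRing.unit by rewrite unitrX.
by rewrite -[LHS](mulrK uy2) (mulrAC _ _ (y ^+ 2)) -e mulrK.
Qed.

Lemma prod1D_P2 (I : Type) (r : seq I) (F : I -> R) :
  \prod_(i <- r) (1 + P ^+ 2 * F i) = 1 + P ^+ 2 * \sum_(i <- r) F i.
Proof.
elim: r => [|i r IHr]; first by rewrite !big_nil mulr0 addr0.
rewrite !big_cons IHr.
transitivity (1 + P ^+ 2 * (F i + \sum_(j <- r) F j)
  + P ^+ 3 * P * (\sum_(j <- r) F j) * F i); first by ring.
by rewrite P3 !mul0r addr0.
Qed.

Lemma P3mul c : P ^+ 3 * c = 0. Proof. by rewrite P3 mul0r. Qed.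

Definition half_sqsum := \sum_(i < m) (i.+1%:R ^- 2 : R).
Definition odd_sqsum := \sum_(i < m) ((2 * i).+1%:R ^- 2 : R).

Lemma subP_sqr i : (0 < i < p)%N -> P ^+ 2 / (p - i)%:R ^+ 2 = P ^+ 2 / i%:R ^+ 2.
Proof.
move=> hi; apply: inv_sqr_P2; try by apply: unit_lt; lia.
rewrite natrB; last by lia.
transitivity (P ^+ 2 * i%:R ^+ 2 + P ^+ 3 * (P - 2 * i%:R)); first by ring.
by rewrite P3mul addr0.
Qed.

Lemma odd_sqsum_even : P ^+ 2 * odd_sqsum = P ^+ 2 * \sum_(i < m) ((2 * i).+2%:R ^- 2 : R).
Proof.
rewrite /odd_sqsum !mulr_sumr (reindex_inj rev_ord_inj) /=.
apply: eq_bigr => i _; rewrite -subP_sqr; last by have := p_eq; lia.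
by congr (_ / _%:R ^+ 2); have := p_eq; have := ltn_ord i; lia.
Qed.

Lemma odd_sqsum_half : 4 * (P ^+ 2 * odd_sqsum) = P ^+ 2 * half_sqsum.
Proof.
rewrite odd_sqsum_even mulrCA; congr (_ * _); rewrite mulr_sumr.
apply: eq_bigr => i _.
have u : (i.+1%:R : R) \is a GRing.unit.
  by apply: unit_lt; have := p_eq; have := ltn_ord i; lia.
rewrite -[(2 * i).+2](mulnS 2 i) natrM exprMn invrM ?unitrX ?unit2 //.
have -> : 4 = 2 ^+ 2 :> R by ring.
by rewrite mulrCA divrr ?unitrX ?unit2 ?mulr1.
Qed.

(** Let [H] be this quantity and [T] the same sum over all [0 < i < p]. Folding [i] with [p - i]
    gives [T = 2H]; splitting by parity gives [4T = 2H]. Hence [6H = 0], where [p > 3] enters. *)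
Lemma P2_half_sqsum : P ^+ 2 * half_sqsum = 0.
Proof.
pose T := P ^+ 2 * \sum_(i < 2 * m) (i.+1%:R ^- 2 : R).
have T1 : T = 2 * (P ^+ 2 * half_sqsum).
  rewrite /T (big_fold_half _ m (fun i => i.+1%:R ^- 2 : R)) mulrDr [2 * _]mulr_natl mulr2n;
    congr (_ + _).
  rewrite /half_sqsum !mulr_sumr; apply: eq_bigr => i _; rewrite -subP_sqr.
    by congr (_ / _%:R ^+ 2); have := p_eq; have := ltn_ord i; lia.
  by have := p_eq; have := ltn_ord i; lia.
have T2 : 4 * T = 2 * (P ^+ 2 * half_sqsum).
  rewrite /T (big_parity _ m (fun i => i.+1%:R ^- 2 : R)) mulrDr.
  rewrite -odd_sqsum_half -/odd_sqsum odd_sqsum_even; ring.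
have : 2 * (3 * (P ^+ 2 * half_sqsum)) = 0.
  have -> : 2 * (3 * (P ^+ 2 * half_sqsum))
    = 4 * (2 * (P ^+ 2 * half_sqsum)) - 2 * (P ^+ 2 * half_sqsum) by ring.
  by rewrite -[in 4 * _]T1 T2 subrr.
by move/(canRL (mulKr unit2)); rewrite mulr0 => /(canRL (mulKr unit3)); rewrite mulr0.
Qed.

Lemma P2_odd_sqsum : P ^+ 2 * odd_sqsum = 0.
Proof.
by apply: (mulrI unit4); rewrite odd_sqsum_half mulr0 P2_half_sqsum.
Qed.

(** Pairing [i] with [p - i] gives [i (p-i) + P^2 (c + c^2)], so the total correction is a multiple
    of [P^2] times a sum of inverse squares, which vanishes. The freedom in [c] is essential:
    integers, [-1/2], [1/2] and [-3/4] all occur. *)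
Lemma wolstenholme c : \prod_(i < p.-1) (i.+1%:R + P * c) = (p.-1)`!%:R.
Proof.
have ep : p.-1 = (2 * m)%N by have := p_eq; lia.
have -> : ((p.-1)`!%:R : R) = \prod_(i < p.-1) i.+1%:R.
  by rewrite fact_prod natr_prod big_add1 /= big_mkord.
rewrite ep (big_fold_half _ m (fun i => i.+1%:R + P * c)).
rewrite (big_fold_half _ m (fun i => i.+1%:R : R)) /= -!big_split /=.
transitivity (\prod_(i < m) (i.+1%:R * (2 * m - i.+1).+1%:R)
  * \prod_(i < m) (1 + P ^+ 2 * (- (c + c ^+ 2) * (i.+1%:R ^- 2 : R)))).
  rewrite -big_split /=; apply: eq_bigr => i _.
  have hi := ltn_ord i; have h := p_eq.
  have u : (i.+1%:R : R) \is a GRing.unit by apply: unit_lt; lia.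
  rewrite (_ : (2 * m - i.+1).+1 = p - i.+1)%N; last by lia.
  rewrite natrB; last by lia.
  set a := i.+1%:R in u *.
  have ea : a / a = 1 by rewrite divrr.
  have -> : a * (P - a) * (1 + P ^+ 2 * (- (c + c ^+ 2) * a ^- 2))
    = a * (P - a) + P ^+ 2 * (c + c ^+ 2) * (a / a) ^+ 2
      - P ^+ 3 * (c + c ^+ 2) * a / a ^+ 2.
    by rewrite -exprVn; ring.
  by rewrite ea P3; ring.
rewrite prod1D_P2 -mulr_sumr -/half_sqsum mulrCA P2_half_sqsum mulr0 addr0 mulr1.
by [].
Qed.

Definition odds := \prod_(i < m) ((2 * i).+1%:R : R).
Definition evens := \prod_(i < m) ((2 * i).+2%:R : R).

Lemma unit_odds : odds \is a GRing.unit.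
Proof. by apply/rpred_prod => i _; apply: unit_lt; have := p_eq; have := ltn_ord i; lia. Qed.

Lemma unit_evens : evens \is a GRing.unit.
Proof. by apply/rpred_prod => i _; apply: unit_lt; have := p_eq; have := ltn_ord i; lia. Qed.

Lemma evens_rev : evens = \prod_(i < m) (P - (2 * i).+1%:R).
Proof.
rewrite /evens (reindex_inj rev_ord_inj) /=; apply: eq_bigr => i _.
rewrite -natrB; last by have := p_eq; have := ltn_ord i; lia.
by congr _%:R; have := p_eq; have := ltn_ord i; lia.
Qed.

(** As [C(p-1, m) = 2^(p-1) odds / evens], this is Morley's congruence [(-1)^m C(p-1, m) = 4^(p-1)].
    Doubling every factor of [(p-1)!] shows that [2^(p-1) odds] is the product of the [p + (2i+1)],
    while [evens] is that of the [p - (2i+1)]; their product is a product of [P^2 - (2i+1)^2]. *)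
Lemma morley : 2 ^+ p.-1 * evens = (-1) ^+ m * odds.
Proof.
have ep : p.-1 = (2 * m)%N by have := p_eq; lia.
have e1 : 2 ^+ p.-1 * odds = \prod_(i < m) (P + (2 * i).+1%:R).
  apply: (mulrI unit_evens).
  transitivity (\prod_(i < 2 * m) (2 * i.+1%:R : R)).
    rewrite big_split /= prodr_const card_ord -ep mulrCA; congr (_ * _).
    by rewrite ep (big_parity _ m (fun i => i.+1%:R : R)) mulrC.
  rewrite mul2n -addnn big_split_ord /=; congr (_ * _); apply: eq_bigr => i _.
    by rewrite -natrM mulnS mul2n add2n -mul2n.
  by rewrite P_eq -addnS natrD; ring.
apply: (mulrI unit_odds); rewrite mulrCA mulrA [_ * odds]mulrC -mulrA mulrCA.
rewrite (mulrA _ odds) e1 evens_rev -big_split /=.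
transitivity (\prod_(i < m) (-1 * (2 * i).+1%:R ^+ 2 : R)
  * \prod_(i < m) (1 + P ^+ 2 * (- (2 * i).+1%:R ^- 2 : R))).
  rewrite -big_split /=; apply: eq_bigr => i _.
  have u : ((2 * i).+1%:R : R) \is a GRing.unit.
    by apply: unit_lt; have := p_eq; have := ltn_ord i; lia.
  set a := _.+1%:R in u *.
  have ea : a / a = 1 by rewrite divrr.
  transitivity (- a ^+ 2 + P ^+ 2 * (a / a) ^+ 2); first by rewrite ea; ring.
  by rewrite -exprVn; ring.
rewrite prod1D_P2 sumrN mulrN -/odd_sqsum P2_odd_sqsum oppr0 addr0 mulr1.
by rewrite big_split /= prodr_const card_ord prodrXl -/odds; ring.
Qed.

(** * The sums s(a) near -p/2 *)

Local Notation s := (@clausen_sum R p).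
Local Notation z := (- (P / 2)).

Lemma P_gt0 : p = p.-1.+1. Proof. by rewrite prednK ?prime_gt0. Qed.

Lemma s_rec a :
  a ^+ 2 * s a - (a - 1) ^+ 2 * s (a - 2)
  = (2 * a - 1) * ((2 * p.-1%:R + 1) * clausen_weight R p.-1)
    * shifted_prod (a - 1) p.-1.
Proof.
have h : (p.-1 < p)%N by rewrite -P_gt0.
by have := clausen_sum_rec a unit4 (unit_fact h); rewrite -P_gt0 !mulrA.
Qed.

(** The boundary term has a zero factor at these integers, so [s(2i)] is the full value
    [P_(2i)(0)^2]. *)
Lemma s_even i : (i <= m)%N ->
  \prod_(j < i) ((2 * j).+2%:R : R) ^+ 2 * s (2 * i)%:R
  = \prod_(j < i) ((2 * j).+1%:R : R) ^+ 2.
Proof.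
elim: i => [|i IHi] lt_im.
  by rewrite !big_ord0 mul1r muln0 [in LHS]P_gt0 clausen_sum0.
rewrite !big_ord_recr /= -IHi; last by lia.
have := s_rec (2 * i.+1)%:R.
rewrite (_ : (2 * i.+1)%:R - 2 = (2 * i)%:R :> R); last by rewrite mulnS natrD; ring.
rewrite (_ : (2 * i.+1)%:R - 1 = (2 * i).+1%:R :> R); last first.
  by rewrite mulnS natrD -natr1; ring.
rewrite (@shifted_prod_eq0 _ _ _ (2 * i).+1); last first.
- by rewrite subrr mul0r.
- by have := p_eq; lia.
rewrite mulr0 => /eqP; rewrite subr_eq0 => /eqP e.
by rewrite (mulnS 2 i) add2n in e; rewrite (mulnS 2 i) add2n -mulrA e; ring.
Qed.

(** The reflection sends [-P] to [P - 1], the image of the even integer [2m], where the value is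
    [(odds / evens)^2]. *)
Lemma s_oppP : s (- P) = (2 ^+ p.-1) ^+ 2.
Proof.
have -> : s (- P) = s (2 * m)%:R.
  by rewrite -clausen_sum_sym P_eq -natr1 natrM; congr (clausen_sum _ _); ring.
apply: (mulrI (_ : evens ^+ 2 \is a GRing.unit)); first by rewrite unitrX ?unit_evens.
have := s_even (leqnn m); rewrite !prodrXl -/evens -/odds => ->.
by rewrite -exprMn mulrC morley exprMn -exprM mulnC exprM sqrrN !expr1n mul1r.
Qed.

Lemma central_bin_P : ('C(2 * p, p)%:R : R) = 2.
Proof.
have h : (p.-1 < p)%N by rewrite -P_gt0.
have e1 : ('C(p + p.-1, p.-1)%:R : R) = 1.
  apply: (mulIr (unit_fact h)); rewrite -prod_add_bin mul1r -[RHS](wolstenholme 1).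
  by apply: eq_bigr => i _; rewrite mulr1 natr1.
have -> : (2 * p = (p + p.-1).+1)%N by rewrite -addnS -P_gt0 mul2n addnn.
rewrite [in X in 'C(_, X)]P_gt0 binS natrD e1.
rewrite -P_gt0 -bin_sub ?leq_addr // addKn e1; ring.
Qed.

(** The vanishing at the odd integer [p] with denominators cleared, so that it can be carried from
    [rat] to [R]. *)
Lemma bin_sum_P :
  (\sum_(k < p.+1) (-1) ^+ k * ('C(2 * k, k) * 'C(p, k) * 'C(p + k, k))%:R
    * 4 ^+ (p - k) = 0 :> int).
Proof.
apply: (@intr_inj rat); rewrite rmorph_sum /=.
transitivity (clausen_sum p.+1 p%:R * 4 ^+ p : rat); last first.
  by rewrite (clausen_sum_odd p_odd (leqnn p)) mul0r.
rewrite /clausen_sum mulr_suml; apply: eq_bigr => k _.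
rewrite clausen_term_nat // ?unitfE ?pnatr_eq0 -?lt0n ?fact_gt0 //.
have -> : 4 ^+ p = 4 ^+ k * 4 ^+ (p - k) :> rat.
  by rewrite -exprD subnKC // -ltnS.
rewrite mulrA divfK ?expf_neq0 //.
by rewrite !rmorphM !rmorphXn rmorphN1 /= !rmorph_nat ?natrM.
Qed.

(** The truncation [s] omits only the term [k = p] of the vanishing sum, namely
    [- C(2p,p)^2 / 4^p = -4 / 4^p]. *)
Lemma s_P : s P * (2 ^+ p.-1) ^+ 2 = 1.
Proof.
have u4n n : (4 ^+ n : R) \is a GRing.unit by rewrite unitrX ?unit4.
have := congr1 (fun x : int => x%:~R : R) bin_sum_P.
rewrite rmorph_sum /= big_ord_recr /= subnn expr0 mulr1 binn muln1 addnn -mul2n.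
rewrite (_ : \sum_(i < p) _ = 4 ^+ p * s P); last first.
  rewrite /clausen_sum mulr_sumr; apply: eq_bigr => k _.
  rewrite clausen_term_nat ?unit4 ?unit_fact //.
  have -> : 4 ^+ p = 4 ^+ k * 4 ^+ (p - k) :> R.
    by rewrite -exprD subnKC // ltnW.
  rewrite [RHS]mulrC mulrA divrK // !rmorphM !rmorphXn rmorphN1 /=.
  by rewrite !rmorph_nat ?natrM.
rewrite !rmorphM !rmorphXn rmorphN1 /= !rmorph_nat ?natrM !central_bin_P.
rewrite -signr_odd p_odd expr1 [in 4 ^+ p]P_gt0 exprS => e.
have e4 : (2 ^+ p.-1) ^+ 2 = 4 ^+ p.-1 :> R.
  by rewrite -exprM mulnC exprM; congr (_ ^+ _); ring.
apply: (mulrI unit4); rewrite e4 mulr1.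
transitivity (4 * 4 ^+ p.-1 * s P + -1 * (2 * 2) + 4); first by ring.
by rewrite e add0r.
Qed.

Definition polynomial_fun (f : R -> R) := exists q : {poly R}, forall x, f x = q.[x].

Lemma polynomial_fun_P f : polynomial_fun f -> exists a b, forall c,
  f (P * c) = f 0 + a * (P * c) + b * (P * c) ^+ 2.
Proof.
case=> q fq; exists q`_1, q`_2 => c; rewrite !fq horner_coef0.
have qs : (size q <= 3 + size q)%N by rewrite leq_addl.
rewrite (horner_coef_wide _ qs) big_split_ord /= [X in _ + X]big1 => [|i _].
  by rewrite addr0 !big_ord_recr big_ord0 /= add0r mulr1.
rewrite exprD exprMn P3; ring.
Qed.

Lemma polynomial_fun_clausen K : polynomial_fun (@clausen_sum R K).
Proof.
pose q k : {poly R} := \prod_(i < k) ((i%:R%:P - 'X) * (i%:R%:P + 1 + 'X)).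
exists (\sum_(k < K) (clausen_weight R k)%:P * q k) => x.
rewrite horner_sum; apply: eq_bigr => k _; rewrite hornerCM horner_prod.
by congr (_ * _); apply: eq_bigr => i _; rewrite !hornerE.
Qed.

Lemma expr_P1 a : ~~ (p %| a)%N -> exists c, (a%:R : R) ^+ p.-1 = 1 + P * c.
Proof.
move=> pa; have a_gt0 : (0 < a)%N by case: a pa; rewrite ?dvdn0.
have e := fermat_little a p_pr.
have : (p %| a ^ p.-1 - 1)%N.
  rewrite -(@Gauss_dvdr p a); last by rewrite prime_coprime.
  rewrite mulnBr -expnS -P_gt0 muln1 -eqn_mod_dvd; first exact/eqP.
  by rewrite [p in (a ^ p)%N]P_gt0 expnS leq_pmulr // expn_gt0 a_gt0.
case/dvdnP => c ec; exists c%:R; rewrite mulrC -natrM -ec natrB ?expn_gt0 ?a_gt0 //.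
by rewrite natrX; ring.
Qed.

Lemma expr2_P1 : exists c, 2 ^+ p.-1 = 1 + P * c.
Proof. by apply: (@expr_P1 2); rewrite gtnNdvd // ltnW. Qed.

(** Interpolation of a quadratic [f]: [8 f(-1/2) = 6 f(0) + 3 f(-1) - f(1)], in the variable [c] of
    [s(P c)]. *)
Lemma s_z : s z = 2 ^+ p.-1.
Proof.
have [a [b sE]] := polynomial_fun_P (polynomial_fun_clausen p).
have s0 : s 0 = 1 by rewrite [in LHS]P_gt0 clausen_sum0.
have ez : z = P * (- 2^-1) by rewrite mulrN.
have u2 := unit2; have e2 : 2 / 2 = 1 :> R by rewrite divrr.
have u : ((2 ^+ p.-1) ^+ 2 : R) \is a GRing.unit by rewrite !unitrX.
have [c er] := expr2_P1.
have u8 : (8 : R) \is a GRing.unit.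
  by rewrite (_ : 8 = 2 ^+ 3) ?unitrX //; ring.
have e8 : 8 * s z = 6 + 3 * s (- P) - s P.
  rewrite ez -[- P]mulrN1 -[in s P]( mulr1 P) !sE s0.
  have -> : 8 * (1 + a * (P * - 2^-1) + b * (P * - 2^-1) ^+ 2)
    = 8 - 4 * a * P * (2 / 2) + 2 * b * P ^+ 2 * (2 / 2) ^+ 2 by ring.
  by rewrite e2; ring.
apply: (mulrI u8); apply: (mulrI u); rewrite e8.
rewrite mulrDr mulrN [_ * s P]mulrC s_P s_oppP.
have h : (2 ^+ p.-1 - 1) ^+ 3 = 0 :> R.
  by rewrite er (addrC 1) addrK exprMn P3mul.
set r := 2 ^+ p.-1 in h *.
(* After multiplication by [r^2], the interpolated value [6 + 3 r^2 - r^(-2)] differs from [8 r] by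
   [(r-1)^3 (3r+1)], and [r - 1] is a multiple of [P]. *)
transitivity (8 * r ^+ 3 + (r - 1) ^+ 3 * (3 * r + 1)); first by ring.
by rewrite h; ring.
Qed.

Lemma boundary_weight :
  (2 * p.-1%:R + 1) * clausen_weight R p.-1 = P / (4 ^+ p.-1 * (p.-1)`!%:R ^+ 2).
Proof.
rewrite /clausen_weight mulrA; congr (_ / _); apply: (mulrI unit2).
have := congr1 (fun i : nat => i%:R : R) (central_bin_rec p.-1).
by rewrite -P_gt0 !natrM natrD natrM central_bin_P => e; rewrite mulrA -e mulrC.
Qed.

Lemma shifted_prod_split (n : R) k :
  shifted_prod n k = \prod_(i < k) (i%:R - n) * \prod_(i < k) (i%:R + 1 + n).
Proof. exact: big_split. Qed.

Lemma prod_factor k (F : nat -> R) i : (i < k)%N ->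
  exists X, \prod_(j < k) F j = F i * X.
Proof. by move=> hi; rewrite (bigD1 (Ordinal hi)) //=; eexists. Qed.

(** The boundary term collects three factors [P]: one from the weight, and one from each half of the
    shifted product, at the indices [j - 1] and [p - j]. For [j = 1] the index [p - j] is out of
    range, hence the separate treatment below. *)
Lemma s_rec_z j : (1 < j < p)%N ->
  (z + j%:R) ^+ 2 * s (z + j%:R) = (z + j%:R - 1) ^+ 2 * s (z + j%:R - 2).
Proof.
move=> hj; apply/eqP; rewrite -subr_eq0 s_rec boundary_weight shifted_prod_split.
have h1 : (j.-1 < p.-1)%N by lia.
have h2 : (p - j < p.-1)%N by lia.
have [X /= ->] := prod_factor (fun i => i%:R - (z + j%:R - 1)) h1.
have [Y /= ->] := prod_factor (fun i => i%:R + 1 + (z + j%:R - 1)) h2.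
have -> : j.-1%:R - (z + j%:R - 1) = P * 2^-1.
  by rewrite -[in j%:R](prednK (_ : 0 < j)%N) -?natr1; [ring|lia].
have -> : (p - j)%:R + 1 + (z + j%:R - 1) = P * (1 - 2^-1).
  by rewrite natrB; [ring|lia].
set F := (4 ^+ _ * _)^-1.
by apply/eqP; rewrite -[RHS](P3mul ((2 * (z + j%:R) - 1) * F * 2^-1 * X * (1 - 2^-1) * Y)); ring.
Qed.

(** Here the boundary term is [P z = - P^2 / 2], and [z^2 s(z-1)] is [P^2 / 4] because
    [s(z-1) = s(P/2)] is 1 modulo [P]. *)
Lemma s_1z : 4 * ((1 + z) ^+ 2 * s (1 + z)) = - P ^+ 2.
Proof.
have e2 : 2 / 2 = 1 :> R by rewrite divrr ?unit2.
have e := s_rec (1 + z); rewrite boundary_weight in e.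
have [X eX] : exists X, shifted_prod z p.-1 = P * X.
  rewrite (_ : p.-1 = p.-2.+1); last by lia.
  rewrite /shifted_prod big_ord_recl sub0r opprK -!mulrA; eexists; reflexivity.
have u := unit_fact (_ : p.-1 < p)%N; rewrite -P_gt0 leqnn in u; have {}u := u isT.
have u4 : (4 ^+ p.-1 : R) \is a GRing.unit by rewrite unitrX ?unit4.
have e4 : 4 ^+ p.-1 / 4 ^+ p.-1 = 1 :> R by rewrite divrr.
have ef : (p.-1)`!%:R / (p.-1)`!%:R = 1 :> R by rewrite divrr.
have eQ : shifted_prod z p.-1 * (p.-1%:R - z) = - z * (p.-1)`!%:R ^+ 2.
  rewrite shifted_prod_split.
  have -> : \prod_(i < p.-1) (i%:R + 1 + z) = (p.-1)`!%:R.
    rewrite -(wolstenholme (- 2^-1)); apply: eq_bigr => i _.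
    by rewrite natr1 mulrN.
  rewrite mulrAC (_ : \prod_(i < p.-1) (i%:R - z) * _ = - z * (p.-1)`!%:R).
    by rewrite mulrAC expr2 mulrA.
  transitivity (\prod_(i < p.-1.+1) (i%:R - z)); first by rewrite big_ord_recr.
  rewrite big_ord_recl sub0r; congr (_ * _); rewrite -(wolstenholme 2^-1).
  by apply: eq_bigr => i _; rewrite opprK.
(* In front of [P] the missing factor [p - 1 - z] may be replaced by -1, since the product already
   contains a factor [P]. *)
have {}eX : P * shifted_prod z p.-1 = P * z * (p.-1)`!%:R ^+ 2.
  have -> : P * shifted_prod z p.-1 = P * (P * shifted_prod z p.-1 - P / 2 * - shifted_prod z p.-1)
     - P * (shifted_prod z p.-1 * (p.-1%:R - z)) + P * (1 + p.-1%:R - P) * shifted_prod z p.-1.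
    by ring.
  rewrite eQ (_ : 1 + p.-1%:R - P = 0); last by rewrite [1 + _]addrC natr1 -P_gt0 subrr.
  rewrite eX; transitivity (P * z * (p.-1)`!%:R ^+ 2 + P ^+ 3 * (X + X / 2)); first by ring.
  by rewrite P3mul addr0.
have [c er] := expr2_P1.
have e4' : P ^+ 2 / 4 ^+ p.-1 = P ^+ 2.
  apply: (mulIr u4); rewrite divrK //.
  have -> : 4 ^+ p.-1 = (2 ^+ p.-1) ^+ 2 :> R.
    by rewrite -exprM mulnC exprM; congr (_ ^+ _); ring.
  by rewrite er -[LHS]addr0 -(P3mul (2 * c + P * c ^+ 2)); ring.
have sz1 : P ^+ 2 * s (1 + z - 2) = P ^+ 2.
  rewrite (_ : 1 + z - 2 = - 1 - P * 2^-1); last by ring.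
  rewrite clausen_sum_sym.
  have [a [b ->]] := polynomial_fun_P (polynomial_fun_clausen p).
  rewrite [in clausen_sum p]P_gt0 clausen_sum0.
  by rewrite -[RHS]addr0 -(P3mul (a / 2 + b * P * 2^-1 ^+ 2)); ring.
have bd : (2 * (1 + z) - 1) * (P / (4 ^+ p.-1 * (p.-1)`!%:R ^+ 2))
    * shifted_prod (1 + z - 1) p.-1 = P * z.
  have -> : 1 + z - 1 = z by ring.
  rewrite invrM ?unitrX ?unit4 // -[in _ ^- 2]exprVn.
  transitivity ((1 - P * (2 / 2)) * (P * shifted_prod z p.-1)
    * ((p.-1)`!%:R^-1 ^+ 2 / 4 ^+ p.-1)); first by ring.
  rewrite eX e2.
  transitivity (((p.-1)`!%:R / (p.-1)`!%:R) ^+ 2 * (P * z / 4 ^+ p.-1)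
      + P ^+ 3 * ((p.-1)`!%:R / (p.-1)`!%:R) ^+ 2 * (2^-1 / 4 ^+ p.-1)); first by ring.
  rewrite P3 ef !mul0r addr0 expr1n mul1r.
  by transitivity (- (P ^+ 2 / 4 ^+ p.-1) / 2); [ring | rewrite e4'; ring].
move/eqP: e; rewrite bd subr_eq => /eqP ->.
have -> : (1 + z - 1) ^+ 2 * s (1 + z - 2) = (P ^+ 2 * s (1 + z - 2)) / 2 ^+ 2.
  by rewrite -exprVn; ring.
rewrite sz1.
transitivity (P ^+ 2 * (2 / 2) ^+ 2 - 2 * P ^+ 2 * (2 / 2)); first by rewrite -!exprVn; ring.
by rewrite e2; ring.
Qed.

(** The recurrence makes this quantity independent of [j]: it exchanges [s(z+j)] for [s(z+j+2)] at
    the cost of the square in front. *)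
Lemma s_prod j : (j <= m)%N ->
  4 * ((z + j%:R + 1) ^+ 2 * (s (z + j%:R) * s (z + j%:R + 1))) = - P ^+ 2.
Proof.
elim: j => [|j IHj] hj.
  have [c er] := expr2_P1.
  rewrite addr0 [z + 1]addrC s_z.
  transitivity (4 * ((1 + z) ^+ 2 * s (1 + z)) * 2 ^+ p.-1); first by ring.
  by rewrite s_1z er -[RHS]addr0 -(P3mul (- c)); ring.
have hj2 : (1 < j.+2 < p)%N by have := p_eq; lia.
have e := s_rec_z hj2.
have e1 : z + j.+1%:R + 1 = z + j.+2%:R by rewrite -!natr1; ring.
have e2 : z + j.+2%:R - 1 = z + j.+1%:R by rewrite -!natr1; ring.
have e3 : z + j.+2%:R - 2 = z + j%:R by rewrite -!natr1; ring.
have e4 : z + j%:R + 1 = z + j.+1%:R by rewrite -!natr1; ring.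
rewrite e1.
transitivity (4 * (s (z + j.+1%:R) * ((z + j.+2%:R) ^+ 2 * s (z + j.+2%:R)))).
  by ring.
by rewrite e e2 e3 -IHj ?e4; [ring | lia].
Qed.

Lemma s_half_prod : s (- 2^-1) * s (2^-1) = - P ^+ 2.
Proof.
have e2 : 2 / 2 = 1 :> R by rewrite divrr ?unit2.
have := s_prod (leqnn m).
have e : z + m%:R = - 2^-1.
  transitivity (m%:R * (1 - 2 / 2) - 2^-1 : R); first by rewrite P_eq; ring.
  by rewrite e2; ring.
have -> : z + m%:R + 1 = 2^-1.
  by transitivity (2 / 2 - 2^-1 : R); [rewrite e e2; ring | ring].
rewrite e => <-; set x := s _ * s _.
by transitivity ((2 / 2) ^+ 2 * x); [rewrite e2; ring | ring].
Qed.

Lemma s_chain i : (2 * i < p)%N ->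
  \prod_(j < i) (z + (2 * j).+2%:R) ^+ 2 * s (z + (2 * i)%:R)
  = \prod_(j < i) (z + (2 * j).+1%:R) ^+ 2 * 2 ^+ p.-1.
Proof.
elim: i => [|i IHi] hi; first by rewrite !big_ord0 muln0 addr0 s_z.
rewrite !big_ord_recr /= [RHS]mulrAC -IHi; last by lia.
have := @s_rec_z (2 * i).+2; rewrite (_ : (2 * i.+1)%N = (2 * i).+2); last by lia.
have -> : z + (2 * i).+2%:R - 1 = z + (2 * i).+1%:R by rewrite -!natr1; ring.
have -> : z + (2 * i).+2%:R - 2 = z + (2 * i)%:R by rewrite -!natr1; ring.
by move=> e; rewrite -mulrA e; [ring | lia].
Qed.

Lemma expr_P2 a : ~~ (p %| a)%N ->
  P ^+ 2 * (a%:R : R) ^+ (p - 3) = P ^+ 2 / a%:R ^+ 2.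
Proof.
move=> pa; have ua := unitN pa; have [c ec] := expr_P1 pa.
have ua2 : ((a%:R : R) ^+ 2) \is a GRing.unit by rewrite unitrX.
apply: (mulIr ua2); rewrite divrK // -mulrA -exprD.
rewrite (_ : p - 3 + 2 = p.-1)%N; last by lia.
by rewrite ec mulrDr mulr1 mulrA -exprSr P3mul addr0.
Qed.

Definition alt_sqsum n := \sum_(i < n) ((-1) ^+ i / i.+1%:R ^+ 2 : R).

(** In front of [P^2] Fermat turns inverse squares into powers [p - 3], and the alternating sum of
    even powers up to [2m = p - 1] is an Euler number modulo [p]. *)
Lemma alt_sqsum_euler : odd m ->
  P ^+ 2 * alt_sqsum m = 2 * (P ^+ 2 * (euler (p - 3))%:~R).
Proof.
move=> odd_m; apply: (mulrI unit2).
have n_gt0 : (0 < p - 3)%N by lia.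
have even_n : ~~ odd (p - 3) by rewrite oddB ?p_odd // ltnW.
have := euler_poly_alt_sum m n_gt0 even_n.
have [c ->] := euler_poly_mod (p - 3) (2 * m).+1%:Z.
rewrite -p_eq -signr_odd odd_m expr1 opprK mul1r.
move/(congr1 (fun x : int => P ^+ 2 * x%:~R)).
rewrite rmorphM rmorph_nat rmorph_sum [in RHS]rmorphD rmorphM /= -[p%:~R]/P.
rewrite mulrDr (mulrA _ P) -exprSr P3mul addr0.
move=> e; transitivity (4 * (P ^+ 2 * (euler (p - 3))%:~R) : R); last by ring.
rewrite -e; set S := \sum_(i < m) _.
suff -> : P ^+ 2 * alt_sqsum m = 4 * (P ^+ 2 * S) by ring.
rewrite /alt_sqsum !mulr_sumr; apply: eq_bigr => i _.
rewrite rmorphM !rmorphXn rmorphN1 /=.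
rewrite -[_%:~R]/((2 * i.+1)%:R : R).
have pi : ~~ (p %| 2 * i.+1)%N.
  by rewrite gtnNdvd //; have := p_eq; have := ltn_ord i; lia.
have u : (i.+1%:R : R) \is a GRing.unit.
  by apply: unit_lt; have := p_eq; have := ltn_ord i; lia.
rewrite [in RHS](mulrCA (P ^+ 2)) expr_P2 // natrM exprMn [in RHS]invrM ?unitrX ?unit2 //.
have e4 : 2 ^+ 2 = 4 :> R by ring.
transitivity ((4 / 2 ^+ 2) * ((-1) ^+ i * (P ^+ 2 / i.+1%:R ^+ 2)) : R); last by ring.
by rewrite e4 divrr ?unit4 // mul1r; ring.
Qed.

Lemma sqr_shift_half a : a \is a GRing.unit ->
  (z + a) ^+ 2 = a * (a - P) * (1 + P ^+ 2 * (4^-1 / a ^+ 2)).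
Proof.
move=> ua; have e : a / a = 1 by rewrite divrr.
have e2 : 2 / 2 = 1 :> R by rewrite divrr ?unit2.
have e4 : 4^-1 = 2^-1 ^+ 2 :> R.
  by rewrite (_ : 4 = 2 ^+ 2) ?exprVn //; ring.
rewrite e4 -exprVn.
transitivity (a ^+ 2 - (2 / 2) * P * a + P ^+ 2 * 2^-1 ^+ 2); first by ring.
transitivity (a ^+ 2 - P * a + P ^+ 2 * 2^-1 ^+ 2 * (a / a) ^+ 2
   - P ^+ 3 * (a * 2^-1 ^+ 2 * a^-1 ^+ 2)); last by ring.
by rewrite e e2 P3mul; ring.
Qed.

Lemma odd_prod_bin e :
  ('C((2 * e).+1, e) * \prod_(i < e.+1) (2 * i).+2
   = 2 ^ (2 * e).+1 * \prod_(i < e.+1) (2 * i).+1)%N.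
Proof.
elim: e => [|e IHe]; first by rewrite !big_ord1.
rewrite !(big_ord_recr e.+1) /=.
have h := central_bin_rec e.+1; have h0 := central_bin_rec e.
have b e' : ('C(2 * e'.+1, e'.+1) = 2 * 'C((2 * e').+1, e'))%N.
  rewrite (_ : 2 * e'.+1 = (2 * e').+2)%N; last by lia.
  rewrite binS -(@bin_sub _ e'.+1); last by lia.
  by rewrite (_ : (2 * e').+1 - e'.+1 = e')%N; lia.
rewrite !b in h.
set B' := 'C((2 * e.+1).+1, e.+1) in h *; set B := 'C((2 * e).+1, e) in h IHe.
have {h}h : (e.+2 * B' = 2 * (2 * e.+1 + 1) * B)%N by lia.
have -> : (2 ^ (2 * e.+1).+1 = 2 ^ (2 * e).+1 * 4)%N.
  by rewrite -[4%N]/(2 ^ 2)%N -expnD; congr (_ ^ _)%N; lia.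
set X := (\prod_(i < e.+1) (2 * i).+2)%N in IHe *.
set Y := (\prod_(i < e.+1) (2 * i).+1)%N in IHe *.
transitivity (2 * X * (e.+2 * B'))%N; first by rewrite (_ : (2 * e.+1).+2 = 2 * e.+2)%N;
  [ring | lia].
rewrite h; transitivity (4 * (2 * e.+1 + 1) * (B * X))%N; first by ring.
by rewrite IHe -[(2 * e.+1).+1]addn1; ring.
Qed.

Lemma s_half_3mod4 : odd m ->
  s 2^-1 * 2 ^+ p.-1 = ('C(m, m./2)%:R : R) ^+ 2
    * ((1 + P) ^+ 2 + P ^+ 2 * (euler (p - 3))%:~R / 2).
Proof.
move=> odd_m; pose e := m./2.+1.
have em' : m = (2 * m./2).+1 by lia.
have em : (2 * e = m.+1)%N by rewrite /e; lia.
have hp := p_eq.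
have e22 : 2 / 2 = 1 :> R by rewrite divrr ?unit2.
have ze : z + (2 * e)%:R = 2^-1.
  rewrite em -natr1; transitivity (m%:R * (1 - 2 / 2) + (2 / 2) - 2^-1 + (1 - 2 / 2) : R).
    by rewrite P_eq; ring.
  by rewrite e22; transitivity (2 / 2 - 2^-1 : R); [rewrite e22; ring | ring].
have := @s_chain e; rewrite ze => /(_ ltac:(lia)).
pose A := \prod_(i < e) ((2 * i).+1%:R : R).
pose B := \prod_(i < e) ((2 * i).+2%:R : R).
pose A' := \prod_(i < e) ((p - (2 * i).+1)%:R : R).
pose B' := \prod_(i < e) ((p - (2 * i).+2)%:R : R).
pose so := \sum_(i < e) (4^-1 / (2 * i).+1%:R ^+ 2 : R).
pose se := \sum_(i < e) (4^-1 / (2 * i).+2%:R ^+ 2 : R).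
have lt_e (i : 'I_e) : (2 * i < m)%N by have := ltn_ord i; lia.
have -> : \prod_(j < e) (z + (2 * j).+2%:R) ^+ 2 = B * ((-1) ^+ e * B') * (1 + P ^+ 2 * se).
  rewrite -prod1D_P2 /B /B' -[e in _ ^+ e]card_ord -prodr_const -!big_split /=.
  apply: eq_bigr => i _; have hi := lt_e i.
  rewrite sqr_shift_half; last by apply: unit_lt; lia.
  by rewrite natrB; [ring | lia].
have -> : \prod_(j < e) (z + (2 * j).+1%:R) ^+ 2 = A * ((-1) ^+ e * A') * (1 + P ^+ 2 * so).
  rewrite -prod1D_P2 /A /A' -[e in _ ^+ e]card_ord -prodr_const -!big_split /=.
  apply: eq_bigr => i _; have hi := lt_e i.
  rewrite sqr_shift_half; last by apply: unit_lt; lia.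
  by rewrite natrB; [ring | lia].
move=> eS.
have uA : A \is a GRing.unit.
  by apply/rpred_prod => i _; apply: unit_lt; have := lt_e i; lia.
have uB : B \is a GRing.unit.
  by apply/rpred_prod => i _; apply: unit_lt; have := lt_e i; lia.
have splitE (F : nat -> R) :
    \prod_(i < m) F i = \prod_(i < m./2) F i * \prod_(i < e) F (m./2 + i)%N.
  by rewrite [in LHS](_ : m = m./2 + e)%N ?big_split_ord //; rewrite /e; lia.
(* [A'] runs over the even numbers from [m+1] to [p-1] and [B] over those up to [m+1], so [m+1 = 2e]
   occurs twice. Likewise below, [B'] and [A] share the odd number [m]. *)
have A'B : A' * B = evens * (2 * e)%:R.
  have -> : A' = \prod_(i < e) ((2 * (m./2 + i)).+2%:R : R).
    rewrite /A' (reindex_inj rev_ord_inj) /=; apply: eq_bigr => i _.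
    by congr _%:R; have := ltn_ord i; rewrite /e; lia.
  rewrite /evens (splitE (fun i => (2 * i).+2%:R)).
  have -> : B = \prod_(i < m./2) (2 * i).+2%:R * (2 * e)%:R.
    by rewrite /B big_ord_recr /=; congr (_ * _%:R); rewrite /e; lia.
  by ring.
have B'A : B' * A = odds * m%:R.
  have -> : B' = \prod_(i < e) ((2 * (m./2 + i)).+1%:R : R).
    rewrite /B' (reindex_inj rev_ord_inj) /=; apply: eq_bigr => i _.
    by congr _%:R; have := ltn_ord i; rewrite /e; lia.
  rewrite /odds (splitE (fun i => (2 * i).+1%:R)).
  have -> : A = \prod_(i < m./2) (2 * i).+1%:R * m%:R.
    by rewrite /A big_ord_recr /= -em'.
  by ring.
(* This is a quarter of the alternating sum up to [m + 1]. Its last term has [m + 1 = 1/2] modulo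
   [p] and contributes [- P^2]. *)
have sum_alt : P ^+ 2 * so - P ^+ 2 * se = P ^+ 2 * (euler (p - 3))%:~R / 2 - P ^+ 2.
  have e4 : 4 / 4 = 1 :> R by rewrite divrr ?unit4.
  apply: (mulrI unit4).
  transitivity (P ^+ 2 * alt_sqsum (2 * e)).
    rewrite /alt_sqsum (big_parity _ e (fun i => (-1) ^+ i / i.+1%:R ^+ 2 : R)).
    rewrite /so /se -!mulr_sumr.
    transitivity ((4 / 4) * (P ^+ 2 * (\sum_(i < e) (2 * i).+1%:R ^- 2
       - \sum_(i < e) (2 * i).+2%:R ^- 2)) : R); first by ring.
    rewrite e4 mul1r -sumrN; congr (_ * (_ + _)); apply: eq_bigr => i _.
      by rewrite exprM sqrrN !expr1n mul1r.
    by rewrite (exprS (-1)) exprM sqrrN !expr1n mulr1 mulN1r.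
  rewrite em /alt_sqsum big_ord_recr /= -/(alt_sqsum m) mulrDr alt_sqsum_euler //.
  rewrite -signr_odd odd_m expr1 -em.
  have u2e : ((2 * e)%:R : R) \is a GRing.unit by apply: unit_lt; lia.
  have -> : P ^+ 2 * (-1 / (2 * e)%:R ^+ 2) = - (P ^+ 2 / (2 * e)%:R ^+ 2) by ring.
  rewrite (_ : P ^+ 2 / (2 * e)%:R ^+ 2 = P ^+ 2 / 2^-1 ^+ 2); last first.
    apply: inv_sqr_P2; rewrite ?unitrV ?unit2 // -ze.
    rewrite -[LHS]addr0 -(P3mul (P * 2^-1 ^+ 2 - (2 * e)%:R * (2 / 2))).
    transitivity (P ^+ 2 * (2 * e)%:R ^+ 2 + P ^+ 3 * (P * 2^-1 ^+ 2 - (2 * e)%:R * (2 / 2))) => //.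
    by ring.
  rewrite exprVn invrK.
  transitivity ((2 / 2) * 2 * (P ^+ 2 * (euler (p - 3))%:~R) - 4 * P ^+ 2 : R); last by ring.
  by rewrite e22; ring.
have BC : 'C(m, m./2)%:R ^+ 2 * B ^+ 2 = 2 ^+ p.-1 * A ^+ 2.
  have := congr1 (fun k : nat => k%:R : R) (odd_prod_bin m./2).
  rewrite -em' !natrM !natr_prod natrX -/A -/B => h.
  rewrite -exprMn h exprMn -exprM; congr (_ ^+ _ * _); lia.
have uS : (-1) ^+ e \is a @GRing.unit R by rewrite unitrX ?unitrN1.
have mor : 2 ^+ p.-1 * evens = - odds.
  by rewrite morley -signr_odd odd_m expr1 mulN1r.
(* The repeated factors [m] and [m+1] are [(P-1)/2] and [(P+1)/2]. Their quotient expands as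
   [1 + 2P + 2P^2], up to sign, and the [- P^2] of [sum_alt] reduces this to [(1+P)^2]. *)
have e1 : s 2^-1 * B ^+ 2 * ((1 - P) * (1 + P ^+ 2 * se))
    = A ^+ 2 * ((1 + P) * (1 + P ^+ 2 * so)).
  apply: (mulrI unit_odds); apply: (mulrI uS).
  have -> : 1 - P = - (2 * m%:R) by rewrite P_eq; ring.
  have -> : 1 + P = 2 * (2 * e)%:R by rewrite P_eq em -natr1; ring.
  transitivity (- (2 * A * B * (B * ((-1) ^+ e * B') * (1 + P ^+ 2 * se) * s 2^-1))).
    transitivity (- (2 * (odds * m%:R) * B ^+ 2 * (-1) ^+ e * (1 + P ^+ 2 * se) * s 2^-1)).
      by ring.
    by rewrite -B'A; ring.
  rewrite eS.
  transitivity (- (2 * (A' * B) * A ^+ 2 * (-1) ^+ e * (1 + P ^+ 2 * so) * 2 ^+ p.-1)).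
    by ring.
  rewrite A'B.
  transitivity (- (2 ^+ p.-1 * evens) * 2 * (2 * e)%:R * A ^+ 2 * (-1) ^+ e * (1 + P ^+ 2 * so)).
    by ring.
  by rewrite mor; ring.
apply: (mulIr (_ : B ^+ 2 \is a GRing.unit)); first by rewrite unitrX.
set T := (1 + P) ^+ 2 + _.
suff h : s 2^-1 * B ^+ 2 = A ^+ 2 * T.
  transitivity (2 ^+ p.-1 * (s 2^-1 * B ^+ 2)); first by ring.
  rewrite h; transitivity ((2 ^+ p.-1 * A ^+ 2) * T); first by ring.
  by rewrite -BC; ring.
pose G := (euler (p - 3))%:~R / 2 - 1 : R.
have eG : P ^+ 2 * so - P ^+ 2 * se = P ^+ 2 * G by rewrite sum_alt /G; ring.
transitivity (s 2^-1 * B ^+ 2 * ((1 - P) * (1 + P ^+ 2 * se))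
    * ((1 + P + P ^+ 2) * (1 - P ^+ 2 * se))).
  rewrite -[LHS]addr0 -(P3mul (- s 2^-1 * B ^+ 2
     * (1 + P * se ^+ 2 - P ^+ 4 * se ^+ 2))); ring.
rewrite e1; transitivity (A ^+ 2 * ((1 + 2 * P + 2 * P ^+ 2 + P ^+ 3)
   * (1 + (P ^+ 2 * so - P ^+ 2 * se) - P ^+ 3 * (P * so * se)))); first by ring.
rewrite eG P3 mul0r subr0 addr0.
by rewrite -[RHS]addr0 -(P3mul (A ^+ 2 * (2 * G + 2 * P * G))) /G /T; ring.
Qed.

(** * Binomial coefficients C(3k, k) with k = (p^r - 1) / 4 *)

(** The multiples of [p] are set apart from the complete blocks of [p - 1] other factors and a last
    partial block. *)
Lemma fact_block A a : (a < p)%N ->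
  ((p * A + a)`! = p ^ A * A`! * (\prod_(B < A) \prod_(i < p.-1) (p * B + i.+1)
     * \prod_(i < a) (p * A + i.+1)))%N.
Proof.
have stepa n b : ((n + b)`! = n`! * \prod_(i < b) (n + i.+1))%N.
  elim: b => [|b IHb]; first by rewrite addn0 big_ord0 muln1.
  by rewrite addnS factS IHb big_ord_recr /= -addnS; ring.
move=> _; rewrite stepa mulnA; congr (_ * _)%N.
elim: A => [|A IHA]; first by rewrite muln0 big_ord0 !muln1.
rewrite (_ : p * A.+1 = (p * A + p.-1).+1)%N; last by have := P_gt0; lia.
rewrite factS stepa IHA big_ord_recr /= expnS factS.
rewrite (_ : (p * A + p.-1).+1 = p * A.+1)%N; last by have := P_gt0; lia.
ring.
Qed.

(** The partial block of the factorial of [j (p k + k0)]. *)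
Definition quarter_prod j k k0 := \prod_(i < j * k0) (i.+1%:R + P * (j * k)%:R : R).

Lemma unit_quarter_prod j k k0 : (j * k0 < p)%N -> quarter_prod j k k0 \is a GRing.unit.
Proof.
move=> h; apply/rpred_prod => i _; apply: unitDP; apply: unit_lt.
by have := ltn_ord i; lia.
Qed.

(** Every complete block is [(p-1)!] by Wolstenholme, and the numbers of blocks match as
    [3k = k + 2k]. Only the partial blocks survive in the ratio of the two binomials. *)
Lemma bin3_quarter k k0 : (4 * k0 < p)%N ->
  'C(3 * (p * k + k0), p * k + k0)%:R * (quarter_prod 1 k k0 * quarter_prod 2 k k0)
  = 'C(3 * k, k)%:R * quarter_prod 3 k k0.
Proof.
move=> hk0; move: {-2}(p * k + k0)%N (erefl (p * k + k0)%N) => k' ek'.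
pose X j := (\prod_(B < j * k) \prod_(i < p.-1) (p * B + i.+1)
     * \prod_(i < j * k0) (p * (j * k) + i.+1))%N.
have fE j : (j < 4)%N -> ((j * k')`! = p ^ (j * k) * (j * k)`! * X j)%N.
  move=> hj; rewrite -fact_block; first by congr (_`!); rewrite ek'; ring.
  have : (j * k0 <= 3 * k0)%N by rewrite leq_mul2r; lia.
  by lia.
have XE j : (X j)%:R = (p.-1)`!%:R ^+ (j * k) * quarter_prod j k k0.
  rewrite /X natrM !natr_prod; congr (_ * _).
    rewrite -[(j * k)%N in RHS]card_ord -prodr_const; apply: eq_bigr => B _.
    rewrite natr_prod -(wolstenholme B%:R); apply: eq_bigr => i _.
    by rewrite natrD natrM addrC.
  by apply: eq_bigr => i _; rewrite natrD natrM addrC.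
clearbody X.
have e : ('C(3 * k', k') * (X 1 * X 2) = 'C(3 * k, k) * X 3)%N.
  have bE n : ('C(3 * n, n) * (n`! * (2 * n)`!) = (3 * n)`!)%N.
    have h : (3 * n - n = 2 * n)%N by lia.
    by rewrite -(@bin_fact (3 * n) n) ?h //; lia.
  have := bE k'; rewrite -[in k'`!](mul1n k') !fE // -bE mul1n => b'.
  have c0 : (0 < p ^ (3 * k) * (k`! * (2 * k)`!))%N.
    by rewrite !muln_gt0 expn_gt0 !fact_gt0 prime_gt0.
  apply/eqP; rewrite -(eqn_pmul2l c0); apply/eqP.
  have e3 : (p ^ (3 * k) = p ^ k * p ^ (2 * k))%N.
    by rewrite -expnD; congr (_ ^ _)%N; lia.
  move: b'; rewrite e3; set C := 'C(_, k'); set C' := 'C(_, k).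
  move=> b'; transitivity (C * (p ^ k * k`! * X 1 * (p ^ (2 * k) * (2 * k)`! * X 2)))%N.
    by ring.
  by rewrite b'; ring.
have := congr1 (fun k : nat => k%:R : R) e; rewrite !natrM !XE mul1n.
have u : ((p.-1)`!%:R ^+ (3 * k) : R) \is a GRing.unit.
  by rewrite unitrX ?unit_fact // -P_gt0.
move=> e'; apply: (mulrI u).
have e3 : (p.-1)`!%:R ^+ (3 * k) = (p.-1)`!%:R ^+ k * (p.-1)`!%:R ^+ (2 * k) :> R.
  by rewrite -exprD; congr (_ ^+ _); lia.
rewrite e3 in e' *.
transitivity ('C(3 * k', k')%:R * ((p.-1)`!%:R ^+ k * quarter_prod 1 k k0 *
       ((p.-1)`!%:R ^+ (2 * k) * quarter_prod 2 k k0))); first by ring.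
by rewrite e'; ring.
Qed.

(* [quarter k0 r] is (p^r - 1) / 4, hence -1/4 in [R] once r > 2. *)
Fixpoint quarter k0 r := if r is r'.+1 then (p * quarter k0 r' + k0)%N else 0.

Lemma quarterE k0 r : p = (4 * k0).+1 -> (4 * quarter k0 r).+1 = (p ^ r)%N.
Proof.
by move=> hp; elim: r => //= r IHr; rewrite expnS -IHr mulnS mulnDr (mulnCA p 4); lia.
Qed.

Arguments quarter : simpl never.

Lemma quarter_R k0 r : p = (4 * k0).+1 -> (2 < r)%N -> 4 * (quarter k0 r)%:R = -1 :> R.
Proof.
move=> hp hr; have := congr1 (fun i : nat => i%:R : R) (quarterE r hp).
rewrite -natr1 natrM natrX -[r](subnK hr) exprD P3 mulr0 => h.
by rewrite -[LHS](addrK 1) h add0r.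
Qed.

Lemma unit_bin_quarter k0 r : (4 * k0 < p)%N ->
  ('C(3 * quarter k0 r, quarter k0 r)%:R : R) \is a GRing.unit.
Proof.
move=> hk; elim: r => [|r IHr]; first by rewrite muln0 bin0 unitr1.
have e := bin3_quarter (quarter k0 r) hk.
have : 'C(3 * quarter k0 r, quarter k0 r)%:R * quarter_prod 3 (quarter k0 r) k0
  \is a GRing.unit by rewrite unitrM IHr unit_quarter_prod //; lia.
by rewrite -e unitrM => /andP[].
Qed.

(** With [k = -1/4] the ratio of binomials is [N3 / (N1 N2)]. Wolstenholme's product at [c = -3/4]
    folds into [N3] times [N1] up to sign, and at [c = -1/2] into [N2^2], so the ratio is
    [N2 / N1^2] up to sign. Splitting [N2] by parity makes it [4^k0 Od / Ev], whose square the chain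
    from [z] to [z + 2 k0 = -1/2] identifies. *)
Lemma s_half_quarter k0 r : p = (4 * k0).+1 -> (2 < r)%N ->
  'C(3 * quarter k0 r.+1, quarter k0 r.+1)%:R ^+ 2
  = 'C(3 * quarter k0 r, quarter k0 r)%:R ^+ 2 * s (- 2^-1).
Proof.
move=> hp hr; have hk : (4 * k0 < p)%N by lia.
have cstE x n : x ^+ n = \prod_(i < n) x by rewrite prodr_const card_ord.
have := bin3_quarter (quarter k0 r) hk; rewrite -[(p * _ + k0)%N]/(quarter k0 r.+1).
set C4 := 'C(_, quarter k0 r.+1)%:R; set C3 := 'C(_, quarter k0 r)%:R.
set k := quarter k0 r.
have k4 : 4 * k%:R = -1 :> R by apply: quarter_R.
have e4 : 4 / 4 = 1 :> R by rewrite divrr ?unit4.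
have e2 : 2 / 2 = 1 :> R by rewrite divrr ?unit2.
have kE : k%:R = - 4^-1 :> R.
  by transitivity (4^-1 * (4 * k%:R) : R); [rewrite mulKr ?unit4 | rewrite k4 mulrN1].
have e42 : 2 * 4^-1 = 2^-1 :> R.
  by apply: (mulrI unit2); rewrite mulrA (_ : 2 * 2 = 4) ?e4 ?e2 //; ring.
pose N1 := \prod_(i < k0) (i.+1%:R - P / 4).
pose N2 := \prod_(i < 2 * k0) (i.+1%:R + z).
have -> : quarter_prod 1 k k0 = N1.
  rewrite /quarter_prod mul1n; apply: eq_bigr => i _.
  by rewrite mul1n kE; ring.
have -> : quarter_prod 2 k k0 = N2.
  apply: eq_bigr => i _; rewrite natrM kE -e42; ring.
set N3 := quarter_prod 3 k k0.
have W13 : N3 * ((-1) ^+ k0 * N1) = (p.-1)`!%:R.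
  rewrite -(wolstenholme (- (3 / 4))) (_ : p.-1 = 3 * k0 + k0)%N; last by lia.
  rewrite big_split_ord /=; congr (_ * _).
    by apply: eq_bigr => i _; rewrite natrM kE; ring.
  rewrite (reindex_inj rev_ord_inj) /= /N1 cstE.
  rewrite -big_split /=; apply: eq_bigr => i _.
  rewrite (_ : (3 * k0 + (k0 - i.+1)).+1 = p - i.+1)%N; last by have := ltn_ord i; lia.
  rewrite natrB; last by have := ltn_ord i; lia.
  transitivity (P * (4 / 4) - i.+1%:R - 3 * (P / 4)); last by rewrite e4; ring.
  by ring.
have W2 : N2 ^+ 2 = (p.-1)`!%:R.
  rewrite -(wolstenholme (- 2^-1)) (_ : p.-1 = 2 * k0 + 2 * k0)%N; last by lia.
  rewrite big_split_ord /= expr2; congr (_ * _).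
    by apply: eq_bigr => i _; rewrite mulrN.
  have -> : N2 = \prod_(i < 2 * k0) (-1) * N2.
    by rewrite -cstE exprM sqrrN !expr1n mul1r.
  rewrite [RHS](reindex_inj rev_ord_inj) /= /N2.
  rewrite -big_split /=; apply: eq_bigr => i _.
  rewrite (_ : (2 * k0 + (2 * k0 - i.+1)).+1 = p - i.+1)%N; last by have := ltn_ord i; lia.
  rewrite natrB; last by have := ltn_ord i; lia.
  transitivity (P * (2 / 2) - i.+1%:R - P / 2); last by rewrite e2; ring.
  by ring.
have u2 : N2 \is a GRing.unit.
  have : N2 ^+ 2 \is a GRing.unit by rewrite W2 unit_fact // -P_gt0.
  by rewrite unitrX_pos.
pose Od := \prod_(i < k0) (z + (2 * i).+1%:R).
pose Ev := \prod_(i < k0) (z + (2 * i).+2%:R).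
have N2E : N2 = Od * Ev.
  rewrite /N2 (big_parity _ k0 (fun i => i.+1%:R + z)) /Od /Ev.
  by congr (_ * _); apply: eq_bigr => i _; rewrite addrC.
have N1E : 2 ^+ k0 * N1 = Ev.
  rewrite cstE -big_split /=; apply: eq_bigr => i _.
  by rewrite (_ : (2 * i).+2 = 2 * i.+1)%N ?natrM -?e42; [ring | lia].
have uE : Ev \is a GRing.unit by move: u2; rewrite N2E unitrM => /andP[].
move=> e.
have {}e : C4 * Ev * (-1) ^+ k0 = C3 * 4 ^+ k0 * Od.
  have -> : 4 ^+ k0 = (2 ^+ k0) ^+ 2 :> R by rewrite -exprM mulnC exprM; congr (_ ^+ _); ring.
  apply: (mulIr uE); apply: (mulIr u2).
  transitivity ((2 ^+ k0) ^+ 2 * (-1) ^+ k0 * N1 * (C4 * (N1 * N2))); first by rewrite -N1E; ring.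
  rewrite e; transitivity (C3 * (2 ^+ k0) ^+ 2 * (N3 * ((-1) ^+ k0 * N1))); first by ring.
  by rewrite W13 -W2 N2E; ring.
have := congr1 (fun x => x ^+ 2) e.
rewrite exprMn -exprM mulnC exprM sqrrN !expr1n mulr1 !exprMn => {}e.
have sc : Ev ^+ 2 * s (- 2^-1) = Od ^+ 2 * 2 ^+ p.-1.
  rewrite -!prodrXl -s_chain; last by lia.
  congr (_ * s _).
  have hp' : P = 2 * (2 * k0)%:R + 1 by rewrite {1}hp -natr1 !natrM; ring.
  transitivity ((2 * k0)%:R * (1 - 2 / 2) - 2^-1 : R); first by rewrite e2; ring.
  by rewrite hp'; ring.
have e16 : (4 ^+ k0) ^+ 2 = 2 ^+ p.-1 :> R.
  have -> : 4 = 2 ^+ 2 :> R by ring.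
  by rewrite -!exprM; congr (_ ^+ _); lia.
apply: (mulIr (_ : Ev ^+ 2 \is a GRing.unit)); first by rewrite unitrX.
by rewrite e e16; transitivity (C3 ^+ 2 * (Ev ^+ 2 * s (- 2^-1))); [rewrite sc; ring | ring].
Qed.

(** * Fractional powers of (1 - X^p) / (1 - X) *)

Definition frob_defect : {poly R} := (1 - 'X^p) - (1 - 'X) ^+ p.

Lemma frob_defect_cube : frob_defect ^+ 3 = 0.
Proof.
suff [q ->] : exists q, frob_defect = P *: q by rewrite exprZn P3 scale0r.
have sumE (V : nmodType) n (F : nat -> V) : (0 < n)%N ->
    \sum_(i < n.+1) F i = F 0%N + \sum_(i < n.-1) F i.+1 + F n.
  by case: n => // n _; rewrite big_ord_recl big_ord_recr /= addrA.
exists (- \sum_(i < p.-1) ('C(p, i.+1) %/ p)%:R *: (- 'X) ^+ i.+1).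
rewrite /frob_defect exprDn.
rewrite (sumE _ _ (fun i => (1 ^+ (p - i) * (- 'X) ^+ i) *+ 'C(p, i))) ?prime_gt0 //.
rewrite expr0 mulr1 expr1n bin0 subnn binn mul1r exprNn -signr_odd p_odd expr1 mulN1r.
rewrite [X in _ + X - 'X^p](_ : _
  = - P *: (- \sum_(i < p.-1) ('C(p, i.+1) %/ p)%:R *: (- 'X) ^+ i.+1)).
  by rewrite scaleNr; ring.
rewrite scalerN scaleNr opprK scaler_sumr; apply: eq_bigr => i _.
rewrite expr1n mul1r scalerA -natrM mulnC divnK ?scaler_nat //.
by apply: prime_dvd_bin => //; have := ltn_ord i; lia.
Qed.

(* Truncated binomial expansion of (1 - X^p)^G / (1 - X)^(p G - N), exact because the
   cube of [frob_defect] vanishes. *)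
Definition frob_poly G N : {poly R} :=
  \sum_(k < 3) 'C(G, k)%:R *: (frob_defect ^+ k * (1 - 'X) ^+ (N - p * k)).

Lemma frob_polyE G N : (2 * p <= N <= p * G)%N ->
  (1 - 'X^p) ^+ G = (1 - 'X) ^+ (p * G - N) * frob_poly G N.
Proof.
move=> /andP[le_2pN le_NpG].
have G2 : (2 < G.+1)%N.
  by rewrite ltnS -(leq_pmul2l (prime_gt0 p_pr)) (leq_trans _ le_NpG) // mulnC.
have -> : 1 - 'X^p = (1 - 'X) ^+ p + frob_defect by rewrite /frob_defect [RHS]addrC subrK.
rewrite exprDn -[G.+1](subnKC G2) big_split_ord /= [X in _ + X]big1 ?addr0; last first.
  by move=> i _; rewrite exprD frob_defect_cube mul0r mulr0 mul0rn.
rewrite mulr_sumr; apply: eq_bigr => k _; rewrite -scalerAr scaler_nat mulrCA mulrA.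
rewrite -exprM -mulrA -exprD [in RHS]mulrC; congr (_ ^+ _ * _ *+ _).
have hk : (p * k <= 2 * p)%N by rewrite mulnC leq_mul2r; have := ltn_ord k; lia.
rewrite mulnBr; lia.
Qed.

Lemma size_frob_poly G N : (2 * p <= N)%N -> (size (frob_poly G N) <= N.+1)%N.
Proof.
move=> le_2pN; apply: (leq_trans (size_sum _ _ _)); apply/bigmax_leqP => k _.
have s1 : (size (1 - 'X : {poly R})%R <= 2)%N.
  by rewrite -size_polyN opprB size_XsubC.
have sd : (size frob_defect <= p.+1)%N.
  rewrite /frob_defect (leq_trans (size_polyD _ _)) // geq_max size_polyN.
  rewrite (_ : size (1 - 'X^p : {poly R})%R = p.+1) ?leqnn /=; last first.
    by rewrite -size_polyN opprB size_XnsubC ?prime_gt0.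
  by rewrite (leq_trans (size_poly_exp_leq _ _)) // ltnS -[leqRHS]mul1n leq_mul2r; lia.
apply: (leq_trans (size_scale_leq _ _)); apply: (leq_trans (size_polyMleq _ _)).
have hk : (p * k <= 2 * p)%N by rewrite mulnC leq_mul2r; have := ltn_ord k; lia.
have b1 : (size (frob_defect ^+ k) <= (p * k).+1)%N.
  by apply: (leq_trans (size_poly_exp_leq _ _)); rewrite ltnS leq_mul2r; lia.
have b2 : (size ((1 - 'X : {poly R}) ^+ (N - p * k))%R <= (N - p * k).+1)%N.
  apply: (leq_trans (size_poly_exp_leq _ _)).
  by rewrite ltnS -[leqRHS]mul1n leq_mul2r; lia.
move: b1 b2; set x := size _; set y := size _; lia.
Qed.

(** [R] has zero divisors, so cancelling powers of [1 - X] rests on the leading coefficient being a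
    unit. *)
Lemma lreg_sub1X n : GRing.lreg ((1 - 'X : {poly R}) ^+ n).
Proof. by apply/lregX; rewrite -opprB; apply/lregN/monic_lreg/monicXsubC. Qed.

Lemma frob_poly_recl G N : (2 * p <= N <= p * G)%N ->
  (1 - 'X) * frob_poly G.+1 (N + p.-1) = (1 - 'X^p) * frob_poly G N.
Proof.
move=> hN; apply: (@lreg_sub1X (p * G - N)); have := P_gt0 => hp.
rewrite [RHS]mulrCA -frob_polyE // -exprS.
have : (2 * p <= N + p.-1 <= p * G.+1)%N by rewrite mulnS; lia.
move=> /frob_polyE ->; rewrite mulrA -exprSr; congr (_ ^+ _ * _); rewrite mulnS; lia.
Qed.

(** The logarithmic derivative of [(1 - X^p)^G (1 - X)^(N - p G)], with the denominator [1 - X]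
    absorbed by the polynomial of the next exponent. *)
Lemma frob_poly_deriv G N : (2 * p <= N < p * G)%N ->
  (1 - 'X^p) * ('X * (frob_poly G N)^`())
  = (p * G - N)%:R *: ('X * frob_poly G.+1 (N + p.-1))
    - (P * G%:R) *: ('X^p * frob_poly G N).
Proof.
move=> hN; have hN' : (2 * p <= N <= p * G)%N by lia.
have := congr1 (@deriv _) (frob_polyE hN').
have [E eE] : exists E, (p * G - N)%N = E.+1 by exists (p * G - N).-1; lia.
have [g eg] : exists g, G = g.+1 by exists G.-1; case: (G) hN => //; rewrite muln0; lia.
have r := frob_poly_recl hN'; move: r.
set h := frob_poly G.+1 _; set h' := frob_poly G N => r.
rewrite eE derivM !deriv_exp !derivB derivC derivXn derivX => e.
apply: (@lreg_sub1X E.+1).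
have eX : 'X^p = 'X * 'X^(p.-1) :> {poly R} by rewrite -exprS -P_gt0.
have vG : (1 - 'X) ^+ E.+1 * h' = (1 - 'X^p) * (1 - 'X^p) ^+ g.
  by rewrite /h' -eE -frob_polyE // eg exprS.
rewrite -natrM !scaler_nat.
move: e; rewrite eg /= !sub0r => e.
set F := h'^`() in e *.
transitivity ((1 - 'X^p) * 'X * (E.+1%:R * (1 - 'X) ^+ E * h'
   + ((-1 * (1 - 'X) ^+ E *+ E.+1) * h' + (1 - 'X) ^+ E.+1 * F))); first by ring.
rewrite -e; transitivity ('X * (1 - 'X) ^+ E * E.+1%:R * ((1 - 'X^p) * h')
   - p%:R * g.+1%:R * ('X * 'X^(p.-1)) * ((1 - 'X^p) * (1 - 'X^p) ^+ g)).
  by ring.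
by rewrite -eX -vG -r exprS; ring.
Qed.

Lemma frob_poly1 G N : (2 * p < N)%N -> (frob_poly G N).[1] = 0.
Proof.
move=> hN; rewrite horner_sum big1 // => k _.
have hk : (p * k <= 2 * p)%N by rewrite mulnC leq_mul2r; have := ltn_ord k; lia.
rewrite hornerZ hornerM (_ : N - p * k = (N - p * k).-1.+1)%N; last by lia.
have e0 : (1 - 'X : {poly R}).[1] = 0 by rewrite !hornerE subrr.
by rewrite [(_ ^+ (_).+1).[_]]horner_exp e0 exprS mul0r !mulr0.
Qed.

Lemma negbin_series (A : comNzRingType) (y : A) g L : exists q,
  (1 - y) ^+ g.+1 * \sum_(n < L.+1) 'C(g + n, n)%:R * y ^+ n = 1 + y ^+ L.+1 * q.
Proof.
elim: g => [|g [q IHg]].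
  exists (-1); rewrite expr1.
  under eq_bigr => i _ do rewrite add0n binn mul1r.
  by rewrite -(opprB y 1) mulNr -subrX1; ring.
have step : (1 - y) * \sum_(n < L.+1) 'C(g.+1 + n, n)%:R * y ^+ n
    = \sum_(n < L.+1) 'C(g + n, n)%:R * y ^+ n - 'C(g.+1 + L, L)%:R * y ^+ L.+1.
  elim: L {q IHg} => [|L IHL]; first by rewrite !big_ord1 !bin0; ring.
  rewrite big_ord_recr mulrDr IHL [in RHS]big_ord_recr /=.
  rewrite (_ : g.+1 + L.+1 = (g + L.+1).+1)%N; last by lia.
  rewrite binS natrD (_ : g + L.+1 = g.+1 + L)%N; last by lia.
  by rewrite !(exprS y); ring.
exists (q - (1 - y) ^+ g.+1 * 'C(g.+1 + L, L)%:R).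
by rewrite exprSr -mulrA step mulrBr IHg; ring.
Qed.

Lemma coef_add_Xn_mul (q r : {poly R}) L n : (n < L)%N -> (q + 'X^L * r)`_n = q`_n.
Proof. by move=> lt_nL; rewrite coefD coefXnM lt_nL addr0. Qed.

(** The coefficient of [X^n] in [(1-X)^(-g-1) = h (1-X^p)^(-G-1)], where [h] is the polynomial; both
    negative powers are cut at order [n]. *)
Lemma frob_poly_conv g G N n : (2 * p <= N < p * G.+1)%N -> (p * G.+1 - N)%N = g.+1 ->
  'C(g + n, n)%:R = \sum_(i < n.+1) 'C(G + i, i)%:R
     * (if (n < p * i)%N then 0 else (frob_poly G.+1 N)`_(n - p * i)).
Proof.
move=> hN eg; have hN' : (2 * p <= N <= p * G.+1)%N by lia.
have [q qE] := negbin_series ('X : {poly R}) g n.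
have [r rE] := negbin_series ('X^p : {poly R}) G n.
have := frob_polyE hN'; rewrite eg; set h := frob_poly _ _ => hE.
set a := \sum_(i < n.+1) _ in qE; set b := \sum_(i < n.+1) _ in rE.
have e : a + 'X^(n.+1) * ('X^(p.-1 * n.+1) * (a * r)) = h * b + 'X^(n.+1) * (q * h * b).
  transitivity (a * (1 + 'X^(n.+1) * 'X^(p.-1 * n.+1) * r)); first by ring.
  rewrite -exprD (_ : n.+1 + p.-1 * n.+1 = p * n.+1)%N; last by rewrite -mulSn -P_gt0.
  rewrite exprM -rE hE; transitivity (((1 - 'X) ^+ g.+1 * a) * h * b); first by ring.
  by rewrite qE; ring.
have := congr1 (fun q : {poly R} => q`_n) e; rewrite !coef_add_Xn_mul //.
rewrite (_ : a`_n = 'C(g + n, n)%:R) => [->|]; last first.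
  rewrite coef_sum (bigD1 ord_max) //= big1 ?addr0 => [|i].
    by rewrite mulr_natl coefMn coefXn eqxx.
  rewrite -val_eqE /= => ni; rewrite mulr_natl coefMn coefXn eq_sym (negbTE ni).
  by rewrite mul0rn.
rewrite mulr_sumr coef_sum; apply: eq_bigr => i _.
by rewrite mulrCA [in LHS]mulr_natl coefMn -exprM coefMXn [RHS]mulr_natl.
Qed.

(** * The operator on four coefficients and its unit eigenvalue *)

Section QuarterOperator.

Variable k0 : nat.
Hypotheses (p_k0 : p = (4 * k0).+1) (k0_gt2 : (2 < k0)%N).

(* As 2 * k3 = -1/2 in [R], the polynomials [h7] and [h5] are the powers 7/2 and 5/2 of
   (1 - X^p) / (1 - X). *)
Local Notation k3 := (quarter k0 3).
Local Notation h7 := (frob_poly (2 * k3 + 4) (14 * k0)).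
Local Notation h5 := (frob_poly (2 * k3 + 3) (10 * k0)).
Local Notation c i j := (h7`_(k0 + p * i - j)).
Local Notation c' i j := (h5`_(k0 + p * i - j)).

(** Let [T] and [T'] be the matrices of the [c i j] and [c' i j], and [D] the map from dimension 3
    to 4 sending [e_j] to [(4j+1) e_j + (9-4j) e_(j+1)]. This is [T D = P D T']: differentiation
    intertwines the operators up to the factor [P]. Thus [T] acts as [P T'] on the image of [D] and
    by a scalar on the one-dimensional quotient, which is the trace of [T] minus [P] times that of
    [T']. The coefficients come from [4n = P (4i+5) - (4j+1)] at [n = k0 + p (i+1) - j]. *)
Lemma quarter_coef_rel i j : (j <= 2)%N ->
  (4 * j%:R + 1) * c i.+1 j + (9 - 4 * j%:R) * c i.+1 j.+1
  = P * ((4 * i%:R + 5) * c' i.+1 j + (9 - 4 * i%:R) * c' i j).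
Proof.
move=> hj; have qE := quarterE 3 p_k0.
have k3_ge : (p * p <= 4 * k3)%N
  by rewrite -ltnS qE !expnS expn0 muln1 ltn_Pmull ?muln_gt0 ?prime_gt0 ?prime_gt1.
have le_p : (p * 3 <= p * (2 * k3 + 3))%N by rewrite leq_mul2l; lia.
have hN : (2 * p <= 10 * k0 < p * (2 * k3 + 3))%N by lia.
have hN' : (2 * p <= 10 * k0 <= p * (2 * k3 + 3))%N by lia.
have eN : (10 * k0 + p.-1 = 14 * k0)%N by lia.
have r1 := frob_poly_recl hN'; have r2 := frob_poly_deriv hN.
rewrite eN -addnS in r1 r2.
have k3R : 4 * k3%:R = -1 :> R by apply: quarter_R.
have PR : P = 4 * k0%:R + 1 by rewrite [in LHS]p_k0 -natr1 natrM.
have GR : 2 * (2 * k3 + 3)%:R = 5 :> R.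
  rewrite natrD natrM; transitivity (4 * k3%:R + 6 : R); first by ring.
  by rewrite k3R; ring.
have ER : 2 * (p * (2 * k3 + 3) - 10 * k0)%:R = 5 :> R.
  rewrite natrB; last by lia.
  rewrite !natrM; transitivity (P * (2 * (2 * k3 + 3)%:R) - 5 * (4 * k0%:R)).
    by rewrite natrD natrM; ring.
  by rewrite GR PR; ring.
move: r1 r2 ER GR; set h := h7; set h' := h5; set E := (p * _ - _)%N.
set G := (2 * k3 + 3)%N => r1 r2 ER GR.
pose n := (k0 + p * i.+1 - j)%N.
have np : (p <= n)%N by rewrite /n mulnS; lia.
have n0 : (0 < n)%N by lia.
have enp : (n - p = k0 + p * i - j)%N by rewrite /n mulnS; lia.
have en1 : (n.-1 = k0 + p * i.+1 - j.+1)%N by rewrite /n; lia.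
have {}r1 := congr1 (fun q : {poly R} => q`_n) r1.
have {}r2 := congr1 (fun q : {poly R} => q`_n) r2.
have n00 : (n == 0)%N = false by lia.
have np0 : (n - p == 0)%N = false by lia.
rewrite !mulrBl !mul1r !coefB !coefXM !coefXnM ltnNge np n00 /= in r1.
rewrite !mulrBl !mul1r !coefB !coefZ !coefXnM !coefXM ltnNge np n00 np0 /= in r2.
rewrite !coef_deriv !prednK // ?subn_gt0 in r2; last by lia.
rewrite -enp -en1 -/n.
have nR : 4 * n%:R = P * (4 * i%:R + 5) - (4 * j%:R + 1) :> R.
  have : (n + j = k0 + p * i.+1)%N by rewrite /n; lia.
  move/(congr1 (fun l : nat => l%:R : R)); rewrite !natrD natrM -natr1 => e.
  rewrite -[n%:R](addrK j%:R) e.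
  by transitivity ((4 * k0%:R + 1) + 4 * P * (i%:R + 1) - (4 * j%:R + 1) : R);
    [ring | rewrite -PR; ring].
have npR : 4 * (n - p)%:R = 4 * n%:R - 4 * P :> R by rewrite natrB //; ring.
have {}r2 := congr1 (fun x : R => 4 * x) r2.
have h'E : h'`_(n - p) = h'`_n - h`_n + h`_n.-1.
  by transitivity (h'`_n - (h`_n - h`_n.-1)); [rewrite r1; ring | ring].
have {}r2 : (P * (4 * i%:R + 5) - (4 * j%:R + 1)) * h'`_n
   - (P * (4 * i%:R + 5) - (4 * j%:R + 1) - 4 * P) * h'`_(n - p)
   = 10 * h`_n.-1 - 10 * P * h'`_(n - p).
  rewrite -nR -npR.
  transitivity (4 * (h'`_n *+ n - h'`_(n - p) *+ (n - p))); first by ring.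
  rewrite [LHS]r2.
  transitivity (2 * (2 * E%:R) * h`_n.-1 - 2 * P * (2 * G%:R) * h'`_(n - p)); first by ring.
  by rewrite ER GR; ring.
have -> : P * ((4 * i%:R + 5) * h'`_n + (9 - 4 * i%:R) * h'`_(n - p))
  = ((P * (4 * i%:R + 5) - (4 * j%:R + 1)) * h'`_n
   - (P * (4 * i%:R + 5) - (4 * j%:R + 1) - 4 * P) * h'`_(n - p))
   + 10 * P * h'`_(n - p) + (4 * j%:R + 1) * (h'`_n - h'`_(n - p)) by ring.
by rewrite r2 h'E; ring.
Qed.

(* By [sum_teich_horner] both sums of coefficients are J / (p - 1), so the left-hand side
   is - 45 J; the right-hand side is 45 times the eigenvalue in [quarter_eigen]. *)
Lemma quarter_trace :
  45 * (c 0 0 + c 1 1 + c 2 2 + c 3 3) - 45 * P * (c' 0 0 + c' 1 1 + c' 2 2)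
  = 45 * c 0 0 - 5 * c 1 0 + 5 * c 2 0 - 45 * c 3 0.
Proof.
have c'3 j : (j <= 2)%N -> c' 3 j = 0.
  move=> hj; apply: nth_default.
  by apply: (leq_trans (size_frob_poly _ _)); lia.
have e10 := quarter_coef_rel 0 (isT : 0 <= 2)%N.
have e20 := quarter_coef_rel 1 (isT : 0 <= 2)%N.
have e30 := quarter_coef_rel 2 (isT : 0 <= 2)%N.
have e21 := quarter_coef_rel 1 (isT : 1 <= 2)%N.
have e31 := quarter_coef_rel 2 (isT : 1 <= 2)%N.
have e32 := quarter_coef_rel 2 (isT : 2 <= 2)%N.
rewrite !c'3 // in e30 e31 e32.
move: e10 e20 e30 e21 e31 e32; set h := h7; set h' := h5 => e10 e20 e30 e21 e31 e32.
(* For each row [i] the multipliers eliminate the entries strictly between columns 0 and [i],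
   trading [c i i] for [c i 0]. On the [P] side the off-diagonal [c'] cancel and each diagonal one
   is left with coefficient 45. *)
transitivity (45 * h`_(k0 + p * 0 - 0) - 5 * h`_(k0 + p * 1 - 0) + 5 * h`_(k0 + p * 2 - 0)
   - 45 * h`_(k0 + p * 3 - 0)
  + 5 * ((4 * 0%:R + 1) * h`_(k0 + p * 1 - 0) + (9 - 4 * 0%:R) * h`_(k0 + p * 1 - 1))
  - 5 * ((4 * 0%:R + 1) * h`_(k0 + p * 2 - 0) + (9 - 4 * 0%:R) * h`_(k0 + p * 2 - 1))
  + 45 * ((4 * 0%:R + 1) * h`_(k0 + p * 3 - 0) + (9 - 4 * 0%:R) * h`_(k0 + p * 3 - 1))
  + 9 * ((4 * 1%:R + 1) * h`_(k0 + p * 2 - 1) + (9 - 4 * 1%:R) * h`_(k0 + p * 2 - 2))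
  - 81 * ((4 * 1%:R + 1) * h`_(k0 + p * 3 - 1) + (9 - 4 * 1%:R) * h`_(k0 + p * 3 - 2))
  + 45 * ((4 * 2%:R + 1) * h`_(k0 + p * 3 - 2) + (9 - 4 * 2%:R) * h`_(k0 + p * 3 - 3))
  - 45 * P * (h'`_(k0 + p * 0 - 0) + h'`_(k0 + p * 1 - 1) + h'`_(k0 + p * 2 - 2))).
  by ring.
by rewrite e10 e20 e30 e21 e31 e32; ring.
Qed.

(** In the convolution only the last four indices survive: [h7] has degree at most [14 k0 < 4 p],
    and larger indices would need negative exponents. *)
Lemma quarter_conv :
  'C(2 * quarter k0 4 + 3 + quarter k0 4, quarter k0 4)%:R
  = \sum_(l < 4) 'C(2 * k3 + 3 + (k3 - 3 + l), k3 - 3 + l)%:R * c (3 - l) 0.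
Proof.
have qE := quarterE 3 p_k0; have k4E : quarter k0 4 = (p * k3 + k0)%N by [].
have k3_ge : (p * p <= 4 * k3)%N.
  by rewrite -ltnS qE !expnS expn0 muln1 ltn_Pmull ?muln_gt0 ?prime_gt0 ?prime_gt1.
have k3_ge3 : (13 * 13 <= p * p)%N by apply: leq_mul; lia.
have le_p : (p * 4 <= p * (2 * k3 + 3).+1)%N by rewrite leq_mul2l; lia.
rewrite (@frob_poly_conv _ (2 * k3 + 3) (14 * k0)); first last.
- by rewrite k4E mulnS mulnDr (mulnCA p 2); lia.
- by lia.
rewrite -[(2 * k3 + 3).+1]addnS; move: k4E; move: (quarter k0 4) => k4 k4E.
set h := h7; pose F i : R := 'C(2 * k3 + 3 + i, i)%:R *
  (if (k4 < p * i)%N then 0 else h`_(k4 - p * i)).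
have le_k34 : (k3 <= p * k3)%N by rewrite leq_pmull ?prime_gt0.
rewrite -[LHS]/(\sum_(i < k4.+1) F i).
have -> : k4.+1 = ((k3 - 3) + (4 + (k4 - k3)))%N by lia.
rewrite !big_split_ord /= /F big1 => [|i _]; last first.
  have hi := ltn_ord i; have : (p * (i + 4) <= p * k3)%N by rewrite leq_mul2l; lia.
  rewrite mulnDr => hp4; rewrite ltnNge (_ : p * i <= k4)%N /=; last by lia.
  by rewrite nth_default ?mulr0 //; apply: (leq_trans (size_frob_poly _ _)); lia.
rewrite add0r [X in _ + X]big1 ?addr0 => [|i _]; last first.
  have : (p * k3.+1 <= p * (k3 - 3 + (4 + i)))%N by rewrite leq_mul2l; lia.
  by rewrite mulnS => hp1; rewrite ifT ?mulr0 //; lia.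
apply: eq_bigr => l _; have hl := ltn_ord l; congr (_ * _).
have : (p * (k3 - 3 + l) + p * (3 - l) = p * k3)%N by rewrite -mulnDr; congr (_ * _)%N; lia.
move=> e; rewrite ltnNge (_ : p * (k3 - 3 + l) <= k4)%N /=; last by lia.
by congr (h`_ _); lia.
Qed.

(** As [4 k3 = -1], the four binomials [a l] satisfy [(4l+1) a l + (9-4l) a (l+1) = 0]. They form a
    linear form killing the image of [D] in [quarter_coef_rel], hence an eigenform; its eigenvalue
    is read in column 0. *)
Lemma quarter_eigen :
  45 * 'C(2 * quarter k0 4 + 3 + quarter k0 4, quarter k0 4)%:R
  = 'C(2 * k3 + 3 + k3, k3)%:R
    * (45 * c 0 0 - 5 * c 1 0 + 5 * c 2 0 - 45 * c 3 0).
Proof.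
rewrite quarter_conv !big_ord_recr big_ord0 /= add0r.
have k3R : 4 * k3%:R = -1 :> R by apply: quarter_R.
have k3_ge3 : (3 < k3)%N.
  have qE := quarterE 3 p_k0.
  have : (13 <= p ^ 3)%N by rewrite (@leq_trans p) ?leq_pexp2l //; rewrite ?prime_gt0 //; lia.
  lia.
pose a l : R := 'C(2 * k3 + 3 + (k3 - l), k3 - l)%:R.
have aS l : (l < 3)%N -> (4 * l%:R + 1) * a l = - ((9 - 4 * l%:R) * a l.+1).
  move=> hl; have := mul_bin_diag (2 * k3 + 3 + (k3 - l)) (k3 - l.+1).
  rewrite (_ : (2 * k3 + 3 + (k3 - l)).-1 = 2 * k3 + 3 + (k3 - l.+1))%N; last by lia.
  rewrite (_ : (k3 - l.+1).+1 = k3 - l)%N; last by lia.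
  move/(congr1 (fun n : nat => 4 * n%:R : R)); rewrite [LHS]/= [RHS]/= 2!natrM.
  rewrite -/(a l) -/(a l.+1) 2!natrD natrM natrB; last by lia.
  move=> e; transitivity (- (4 * k3%:R - 4 * l%:R) * a l); first by rewrite k3R; ring.
  transitivity (- (4 * ((k3%:R - l%:R) * a l))); first by ring.
  rewrite -e; transitivity (- ((3 * (4 * k3%:R) + 12 - 4 * l%:R) * a l.+1)); first by ring.
  by rewrite k3R; ring.
have a0 : 'C(2 * k3 + 3 + k3, k3)%:R = a 0%N :> R by rewrite /a subn0.
have a1 : 'C(2 * k3 + 3 + (k3 - 3 + 2), k3 - 3 + 2)%:R = a 1%N :> R.
  by rewrite /a (_ : k3 - 3 + 2 = k3 - 1)%N //; lia.
have a2 : 'C(2 * k3 + 3 + (k3 - 3 + 1), k3 - 3 + 1)%:R = a 2%N :> R.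
  by rewrite /a (_ : k3 - 3 + 1 = k3 - 2)%N //; lia.
have a3 : 'C(2 * k3 + 3 + (k3 - 3 + 0), k3 - 3 + 0)%:R = a 3%N :> R.
  by rewrite addn0.
have a0' : 'C(2 * k3 + 3 + (k3 - 3 + 3), k3 - 3 + 3)%:R = a 0%N :> R.
  by rewrite /a (_ : k3 - 3 + 3 = k3 - 0)%N //; lia.
rewrite a0 a1 a2 a3 a0'.
have e0 : 9 * a 1%N = - a 0%N.
  by have := aS 0%N isT; rewrite mulr0 add0r mul1r subr0 => ->; ring.
have e1 : 5 * a 2%N = - (5 * a 1%N).
  have e := aS 1%N isT; transitivity ((9 - 4 * 1%:R) * a 2%N); first by ring.
  by rewrite -[LHS]opprK -e; ring.
have e2 : a 3%N = - (9 * a 2%N).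
  have e := aS 2%N isT; transitivity ((9 - 4 * 2%:R) * a 3%N); first by ring.
  by rewrite -[LHS]opprK -e; ring.
have f1 : 45 * a 1%N = - (5 * a 0%N).
  by transitivity (5 * (9 * a 1%N)); [ring | rewrite e0; ring].
have f2 : 45 * a 2%N = 5 * a 0%N.
  transitivity (9 * (5 * a 2%N)); first by ring.
  rewrite e1; transitivity (- (45 * a 1%N)); [by ring | by rewrite f1; ring].
have f3 : 45 * a 3%N = - (45 * a 0%N).
  rewrite e2; transitivity (- (9 * (45 * a 2%N))); [by ring | by rewrite f2; ring].
set h := h7.
transitivity ((45 * a 3%N) * h`_(k0 + p * 3 - 0) + (45 * a 2%N) * h`_(k0 + p * 2 - 0)
  + (45 * a 1%N) * h`_(k0 + p * 1 - 0) + 45 * a 0%N * h`_(k0 + p * 0 - 0)); first by ring.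
by rewrite f1 f2 f3; ring.
Qed.

(** Returns from exponent 7/2 to 1/2. Each unit step has ratio [(4i+1)/(4i+2)] because [4k = -1],
    and [45/120] is [(1 5 9)/(2 6 10)], the same for all [r]. *)
Lemma bin_quarter_shift r : (2 < r)%N ->
  (45 * 'C(3 * quarter k0 r, quarter k0 r)%:R : R)
  = 120 * 'C(2 * quarter k0 r + 3 + quarter k0 r, quarter k0 r)%:R.
Proof.
move=> hr; have kR := quarter_R p_k0 hr; move: kR; set k := quarter k0 r => kR.
have e i : ((2 * k + i.+1) * 'C(2 * k + i.+1 + k, k) = (3 * k + i.+1) * 'C(2 * k + i + k, k))%N.
  have := mul_bin_down (2 * k + i.+1 + k) k.
  rewrite (_ : (2 * k + i.+1 + k).-1 = 2 * k + i + k)%N; last by lia.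
  rewrite (_ : 2 * k + i.+1 + k - k = 2 * k + i.+1)%N; last by lia.
  by move=> <-; congr (_ * _)%N; lia.
have eR i : (4 * i%:R + 2) * 'C(2 * k + i.+1 + k, k)%:R
    = (4 * i%:R + 1) * 'C(2 * k + i + k, k)%:R :> R.
  have := congr1 (fun n : nat => n%:R : R) (e i).
  rewrite [LHS]/= [RHS]/= 2!natrM 2!natrD 2!natrM -[i.+1%:R]natr1 => h.
  transitivity ((2 * (4 * k%:R) + 4 * (i%:R + 1)) * 'C(2 * k + i.+1 + k, k)%:R : R).
    by rewrite kR; ring.
  transitivity (4 * ((2 * k%:R + (i%:R + 1)) * 'C(2 * k + i.+1 + k, k)%:R) : R); first by ring.
  rewrite h; transitivity ((3 * (4 * k%:R) + 4 * (i%:R + 1)) * 'C(2 * k + i + k, k)%:R : R).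
    by ring.
  by rewrite kR; ring.
rewrite (_ : 3 * k = 2 * k + 0 + k)%N; last by lia.
have := eR 0%N; have := eR 1%N; have := eR 2%N.
set b0 := 'C(2 * k + 0 + k, k)%:R; set b1 := 'C(2 * k + 1 + k, k)%:R.
set b2 := 'C(2 * k + 2 + k, k)%:R; set b3 := 'C(2 * k + 3 + k, k)%:R => e3 e2 e1.
transitivity (9 * 5 * ((4 * 0%:R + 1) * b0)); first by ring.
rewrite -e1; transitivity (9 * 2 * ((4 * 1%:R + 1) * b1)); first by ring.
rewrite -e2; transitivity (2 * 6 * ((4 * 2%:R + 1) * b2)); first by ring.
by rewrite -e3; ring.
Qed.

End QuarterOperator.

(** * Quartic Jacobi sums *)

Lemma exprD_p_linear x (y : R) : P * y ^+ 2 = 0 -> y ^+ 3 = 0 ->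
  (x + y) ^+ p = x ^+ p + P * (x ^+ p.-1 * y).
Proof.
move=> y2 y3.
have sumE n (F : nat -> R) : (1 < n)%N ->
    \sum_(i < n.+1) F i = F 0%N + F 1%N + \sum_(i < n.-1) F i.+2.
  by case: n => [|[|n]] // _; rewrite 2!big_ord_recl /= addrA.
rewrite exprDn (sumE _ (fun i => (x ^+ (p - i) * y ^+ i) *+ 'C(p, i))) ?prime_gt1 //.
rewrite subn0 subn1 bin0 bin1 expr0 mulr1 expr1 mulr1n -addrA -(mulr_natl _ p).
congr (_ + _).
rewrite big1 ?addr0 // => i _; have [lt_ip | le_pi] := ltnP i.+2 p.
  have /dvdnP[d ->] : (p %| 'C(p, i.+2))%N by apply: prime_dvd_bin.
  rewrite -mulr_natl natrM.
  transitivity (d%:R * x ^+ (p - i.+2) * y ^+ i * (P * y ^+ 2)); last by rewrite y2 mulr0.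
  by rewrite -addn2 exprD; ring.
have -> : (nat_of_ord i).+2 = (3 + (p - 3))%N by have := ltn_ord i; lia.
by rewrite exprD y3 mul0r mulr0 mul0rn.
Qed.

(** Each [p]-th power gains a factor [P] in the perturbation, and two of them reach [P^3]. *)
Lemma exprD_P_sqr x c : (x + P * c) ^+ (p ^ 2) = x ^+ (p ^ 2).
Proof.
rewrite !expnS expn0 muln1 !exprM exprD_p_linear; first last.
- by rewrite exprMn P3mul.
- by transitivity (P ^+ 3 * c ^+ 2); [ring | exact: P3mul].
have -> : P * (x ^+ p.-1 * (P * c)) = P ^+ 2 * (x ^+ p.-1 * c) by ring.
rewrite exprD_p_linear; first last.
- by transitivity (P ^+ 3 * (P ^+ 3 * (x ^+ p.-1 * c) ^+ 3)); [ring | exact: P3mul].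
- by transitivity (P ^+ 3 * (P ^+ 2 * (x ^+ p.-1 * c) ^+ 2)); [ring | exact: P3mul].
set X := x ^+ p; transitivity (X ^+ p + P ^+ 3 * (X ^+ p.-1 * (x ^+ p.-1 * c))); first by ring.
by rewrite P3mul addr0.
Qed.

Lemma natr_eqmod a b : a = b %[mod p] -> exists c, a%:R = b%:R + P * c.
Proof.
move=> eab; exists ((a %/ p)%:R - (b %/ p)%:R).
have e n : n%:R = (n %/ p)%:R * P + (n %% p)%:R by rewrite -natrM -natrD -divn_eq.
by rewrite [a%:R]e [b%:R]e eab; ring.
Qed.

(** The Teichmueller representative modulo [p^3]; the exponent [p^2] makes it independent of the
    lift and multiplicative. *)
Definition teich (u : 'F_p) : R := (u : nat)%:R ^+ (p ^ 2).

Lemma teich_nat n : teich n%:R = n%:R ^+ (p ^ 2).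
Proof.
have [c e] : exists c, ((n%:R : 'F_p) : nat)%:R = n%:R + P * c.
  by apply: natr_eqmod; rewrite val_Fp_nat // modn_mod.
by rewrite /teich e exprD_P_sqr.
Qed.

Lemma teichM (u v : 'F_p) : teich (u * v) = teich u * teich v.
Proof. by rewrite -[u]natr_Zp -[v]natr_Zp -natrM !teich_nat natrM exprMn. Qed.

Lemma teich0 : teich 0 = 0.
Proof. by rewrite (teich_nat 0) expr0n expn_eq0 /= eqn0Ngt prime_gt0. Qed.

Lemma teich1 : teich 1 = 1.
Proof. by rewrite (teich_nat 1) expr1n. Qed.

Lemma teichX (u : 'F_p) n : teich u ^+ n = teich (u ^+ n).
Proof. by elim: n => [|n IHn]; rewrite ?teich1 // !exprS teichM IHn. Qed.

Lemma teichN1 : teich (-1) = -1.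
Proof.
have -> : -1 = p.-1%:R :> 'F_p.
  have : (p.-1.+1%:R : 'F_p) = 0.
    by rewrite prednK ?prime_gt0 //; apply: pcharf0 (pchar_Fp p_pr).
  by rewrite -natr1 => e; rewrite -[RHS](addrK 1) e add0r.
rewrite teich_nat (_ : p.-1%:R = -1 + P * 1).
  by rewrite exprD_P_sqr -signr_odd oddX p_odd orbT.
by rewrite mulr1 [in RHS]P_gt0 -natr1; ring.
Qed.

Lemma teichE (u : 'F_p) : exists c, teich u = (u : nat)%:R + P * c.
Proof.
rewrite -[X in teich X](natr_Zp u) teich_nat -natrX; apply: natr_eqmod.
by rewrite -mulnn expnM (fermat_little _ p_pr) fermat_little.
Qed.

Lemma unit_teich (u : 'F_p) : u != 0 -> teich u \is a GRing.unit.
Proof.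
move=> u0; rewrite unitrX //; apply: unitN; apply: contra u0 => dvd.
by rewrite -[u]natr_Zp -(dvdn_pcharf (pchar_Fp p_pr)).
Qed.

Lemma subr1_teich (u : 'F_p) : exists c, 1 - teich u = (nat_of_ord (1 - u : 'F_p)%R)%:R + P * c.
Proof.
have [c ->] := teichE u.
pose w : 'F_p := 1 - u.
have [d ed] : exists d, (1%:R : R) = (w + u)%N%:R + P * d.
  apply: natr_eqmod; rewrite -!val_Fp_nat // natrD !natr_Zp subrK.
  by rewrite val_Fp_nat // modn_mod.
have {}ed : 1 = (w + u)%N%:R + P * d := ed.
exists (d - c); apply/eqP; rewrite subr_eq; apply/eqP.
by rewrite [LHS]ed natrD -/w; ring.
Qed.

Lemma teich_sub (u : 'F_p) : (1 - teich u) ^+ (p ^ 2) = teich (1 - u).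
Proof. by have [c ->] := subr1_teich u; rewrite exprD_P_sqr. Qed.

Lemma unit_sub_teich (u : 'F_p) : u != 1 -> 1 - teich u \is a GRing.unit.
Proof.
move=> u1; have : teich (1 - u) \is a GRing.unit by rewrite unit_teich // subr_eq0 eq_sym.
by rewrite -teich_sub unitrX_pos // expn_gt0 prime_gt0.
Qed.

Lemma Fp_exp_card (u : 'F_p) : u ^+ p = u.
Proof.
rewrite -[X in X ^+ _](natr_Zp u) -natrX -[RHS](natr_Zp u); apply: val_inj => /=.
by rewrite !val_Fp_nat // fermat_little.
Qed.

Lemma Fp_exp_pred (u : 'F_p) : u != 0 -> u ^+ p.-1 = 1.
Proof. by move=> u0; apply: (mulfI u0); rewrite -exprS -P_gt0 Fp_exp_card mulr1. Qed.

Lemma Fp_prim_root : exists2 g : 'F_p, g != 0 & p.-1.-primitive_root g.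
Proof.
have hp : (0 < p.-1)%N by lia.
have := @has_prim_root 'F_p p.-1 [seq u <- enum 'F_p | u != 0] hp.
case/(_ _ _ _)/hasP.
- by apply/allP => u; rewrite mem_filter => /andP[u0 _]; rewrite unity_rootE Fp_exp_pred.
- by rewrite filter_uniq ?enum_uniq.
- rewrite -(leq_add2l 1) add1n -P_gt0 -[leqLHS](card_Fp p_pr) cardE.
  rewrite -(count_predC (fun u => u == 0) (enum 'F_p)) size_filter leq_add2r.
  by rewrite count_uniq_mem ?enum_uniq // leq_b1.
by move=> g; rewrite mem_filter => /andP[g0 _] gP; exists g.
Qed.

(** Orthogonality needs care over a ring with zero divisors: the factor [1 - teich (g^n)] to be
    cancelled is a unit because [g^n] is not 1 already in ['F_p]. *)
Lemma sum_teichX n : \sum_(u : 'F_p | u != 0) teich u ^+ n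
  = if (p.-1 %| n)%N then P - 1 else 0.
Proof.
case: ifP => [/dvdnP[d ->] | ndvd].
  transitivity (\sum_(u : 'F_p | u != 0) (1 : R)).
    apply: eq_bigr => u u0.
    by rewrite teichX mulnC exprM Fp_exp_pred // expr1n teich1.
  rewrite sumr_const (_ : #|_| = p.-1); last by rewrite cardC1 card_Fp.
  by rewrite [in RHS]P_gt0 -natr1 addrK.
have [g g0 gP] := Fp_prim_root.
have gn : g ^+ n != 1 by rewrite -(prim_order_dvd gP) ndvd.
apply: (mulrI (unit_sub_teich gn)); rewrite mulr0 mulrBl mul1r.
rewrite [X in X - _](reindex_inj (mulfI g0)) /= mulr_sumr.
rewrite (eq_bigl (fun u => u != 0)); last by move=> u; rewrite mulf_eq0 negb_or g0.
rewrite -sumrB big1 // => u _; by rewrite (teichM g u) exprMn (teichX g) subrr.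
Qed.

Definition jacobi_sum a b := \sum_(u : 'F_p | u != 0) teich u ^+ a * teich (1 - u) ^+ b.

Lemma teich_exp_pred (u : 'F_p) : u != 0 -> teich u ^+ p.-1 = 1.
Proof. by move=> u0; rewrite teichX Fp_exp_pred // teich1. Qed.

Lemma sum_ord_mul d K (F : nat -> R) :
  \sum_(n < d * K) F n = \sum_(i < K) \sum_(r < d) F (d * i + r)%N.
Proof.
elim: K => [|K IHK]; first by rewrite muln0 !big_ord0.
by rewrite mulnSr big_split_ord big_ord_recr /= IHK.
Qed.

Lemma sum_teich_horner k0 K (q : {poly R}) :
  p = (4 * k0).+1 -> (size q <= 4 * k0 * K)%N ->
  \sum_(u : 'F_p | u != 0) teich u ^+ (3 * k0) * q.[teich u]
  = (P - 1) * \sum_(i < K) q`_(k0 + 4 * k0 * i).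
Proof.
move=> hp hq; have hp' : p.-1 = (4 * k0)%N by rewrite hp.
have k0_gt0 : (0 < k0)%N by lia.
transitivity (\sum_(u : 'F_p | u != 0)
   \sum_(n < 4 * k0 * K) q`_n * teich u ^+ (3 * k0 + n)).
  apply: eq_bigr => u _; rewrite (horner_coef_wide _ hq) mulr_sumr.
  by apply: eq_bigr => n _; rewrite exprD; ring.
rewrite exchange_big /= mulr_sumr.
transitivity (\sum_(n < 4 * k0 * K) q`_n * (if (4 * k0 %| 3 * k0 + n)%N then P - 1 else 0)).
  by apply: eq_bigr => n _; rewrite -mulr_sumr sum_teichX hp'.
rewrite (sum_ord_mul _ _ (fun n => q`_n * (if (4 * k0 %| 3 * k0 + n)%N then P - 1 else 0))).
apply: eq_bigr => i _; have lt_k0 : (k0 < 4 * k0)%N by lia.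
rewrite (bigD1 (Ordinal lt_k0)) //= big1 ?addr0 => [|r]; last first.
  rewrite -val_eqE /= => rk0; rewrite ifF ?mulr0 //; apply: contraNF rk0.
  rewrite addnCA (dvdn_addr _ (dvdn_mulr i (dvdnn (4 * k0)))) => /dvdnP[d ed]; have hr := ltn_ord r.
  have [d0 | d1] : (d = 0 \/ d = 1 \/ 1 < d)%N by lia.
    by move: ed; rewrite d0; lia.
  case: d1 => [d1 | d2]; first by move: ed; rewrite d1; lia.
  by have : (2 * (4 * k0) <= d * (4 * k0))%N; [rewrite leq_mul2r d2 orbT | lia].
rewrite ifT 1?mulrC ?[(k0 + _)%N]addnC //.
by rewrite addnCA (dvdn_addr _ (dvdn_mulr i (dvdnn (4 * k0)))) (_ : 3 * k0 + k0 = 4 * k0)%N //; lia.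
Qed.

(** Representatives are fixed by the [p]-th power, so [(1 - X^p)^G] cancels against [(1 - X)^G]
    there. What remains of the denominator is [(1 - X)^(2 k0 p^3)], whose value is the quadratic
    character of [1 - u], its own inverse. At [u = 1] both sides vanish because [N > 2p]. *)
Lemma frob_poly_teich G N k0 (u : 'F_p) :
  p = (4 * k0).+1 -> (2 * p < N)%N -> (p * G = N + G + 2 * k0 * p ^ 3)%N -> u != 0 ->
  (frob_poly G N).[teich u] = teich (1 - u) ^+ (2 * k0).
Proof.
move=> hp hN hG u0; have hp' : p.-1 = (2 * (2 * k0))%N by rewrite hp; lia.
have [-> | u1] := eqVneq u 1.
  rewrite teich1 frob_poly1 // subrr teich0 expr0n.
  by rewrite (_ : (2 * k0 == 0)%N = false) //; lia.
have hN' : (2 * p <= N <= p * G)%N by lia.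
have := congr1 (fun q : {poly R} => q.[teich u]) (frob_polyE hN').
rewrite /= hornerM !horner_exp !hornerE (teichX u p) Fp_exp_card.
rewrite (_ : p * G - N = G + 2 * k0 * p ^ 3)%N; last by lia.
rewrite exprD -mulrA => e; have := e; rewrite -[LHS]mulr1.
have uG : (1 - teich u) ^+ G \is a GRing.unit by rewrite unitrX ?unit_sub_teich.
move=> /(mulrI uG).
rewrite (_ : 2 * k0 * p ^ 3 = p ^ 2 * (p * (2 * k0)))%N; last by rewrite !expnS; ring.
rewrite exprM teich_sub exprM (teichX (1 - u) p) Fp_exp_card => e1.
have v0 : 1 - u != 0 by rewrite subr_eq0 eq_sym.
have sq : teich (1 - u) ^+ (2 * k0) * teich (1 - u) ^+ (2 * k0) = 1.
  by rewrite -exprD addnn -mul2n -hp' teich_exp_pred.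
by rewrite -[LHS]mul1r -sq -mulrA -e1 mulr1.
Qed.

(** * The quartic Jacobi sum: binomial ratio, norm and real part *)

Section JacobiSum.

Variable k0 : nat.
Hypotheses (p_k0 : p = (4 * k0).+1) (k0_gt2 : (2 < k0)%N).

Local Notation J := (jacobi_sum (3 * k0) (2 * k0)).
Local Notation J' := (jacobi_sum k0 (2 * k0)).

Lemma jacobi_sum_frob G N : (2 * p < N)%N -> (p * G = N + G + 2 * k0 * p ^ 3)%N ->
  J = \sum_(u : 'F_p | u != 0) teich u ^+ (3 * k0) * (frob_poly G N).[teich u].
Proof. by move=> hN hG; apply: eq_bigr => u u0; rewrite (frob_poly_teich p_k0 hN hG u0). Qed.

Lemma bin_jacobi :
  'C(3 * quarter k0 4, quarter k0 4)%:R = - ('C(3 * quarter k0 3, quarter k0 3)%:R * J).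
Proof.
have q3 := quarterE 3 p_k0; have q4 := quarterE 4 p_k0.
have qk : (quarter k0 4 = p * quarter k0 3 + k0)%N by [].
have tr := quarter_trace p_k0 k0_gt2.
have eig := quarter_eigen p_k0 k0_gt2.
have sh3 := bin_quarter_shift p_k0 k0_gt2 (isT : 2 < 3)%N.
have sh4 := bin_quarter_shift p_k0 k0_gt2 (isT : 2 < 4)%N.
move: q3 q4 qk tr eig sh3 sh4; set k3 := quarter k0 3; set k4 := quarter k0 4.
move=> q3 q4 qk tr eig sh3 sh4.
(* The shape that [frob_poly_teich] asks for, from [4 k3 + 1 = p^3]; [j = 0] and [j = 1] are the
   exponents 5/2 and 7/2. *)
have hG j : (p * (2 * k3 + 3 + j) = (10 + 4 * j) * k0 + (2 * k3 + 3 + j) + 2 * k0 * p ^ 3)%N.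
  rewrite -q3; have : (p * (2 * k3 + 3 + j) = 2 * (p * k3) + p * 3 + p * j)%N by ring.
  have : (p * k3 = 4 * (k0 * k3) + k3)%N by rewrite {1}p_k0; ring.
  have : (p * j = 4 * (k0 * j) + j)%N by rewrite {1}p_k0; ring.
  have : ((10 + 4 * j) * k0 = 10 * k0 + 4 * (k0 * j))%N by ring.
  have : (2 * k0 * (4 * k3).+1 = 8 * (k0 * k3) + 2 * k0)%N by ring.
  lia.
have hG5 : (p * (2 * k3 + 3) = 10 * k0 + (2 * k3 + 3) + 2 * k0 * p ^ 3)%N.
  by have := hG 0%N; rewrite !addn0.
have hG7 : (p * (2 * k3 + 4) = 14 * k0 + (2 * k3 + 4) + 2 * k0 * p ^ 3)%N.
  by have := hG 1%N; rewrite -addnA.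
have J5 := @jacobi_sum_frob (2 * k3 + 3) (10 * k0) ltac:(lia) hG5.
have J7 : J = \sum_(u : 'F_p | u != 0) teich u ^+ (3 * k0)
   * (frob_poly (2 * k3 + 4) (14 * k0)).[teich u].
  by apply: jacobi_sum_frob => //; lia.
rewrite (@sum_teich_horner k0 3) // in J5; last first.
  by apply: (leq_trans (size_frob_poly _ _)); lia.
rewrite (@sum_teich_horner k0 4) // in J7; last first.
  by apply: (leq_trans (size_frob_poly _ _)); lia.
move: tr eig J5 J7; set h := frob_poly (2 * k3 + 4) _; set h' := frob_poly _ _.
(* The diagonal entries of the operator sit at the exponents [k0 + (p-1) i], exactly those that the
   character sum selects. *)
have hi i : (k0 + p * i - i = k0 + 4 * k0 * i)%N by rewrite {1}p_k0 mulSn; lia.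
rewrite !big_ord_recr !big_ord0 /= !add0r -!hi.
set T := h`_(k0 + p * 0 - 0) + _ + _ + _.
set T' := h'`_(k0 + p * 0 - 0) + _ + _.
set L := 45 * h`_(k0 + p * 0 - 0) - _ + _ - _ => tr eig J5 J7.
have uP : P - 1 \is a GRing.unit.
  have := unit_lt (_ : 0 < p.-1 < p)%N; rewrite [in P - 1]P_gt0 -natr1 addrK.
  by apply; lia.
have eT : T' = T by apply: (mulrI uP); rewrite -J5 J7.
have eL : L = - (45 * J) by rewrite -tr eT J7; ring.
have u45 : (45 : R) \is a GRing.unit.
  have -> : 45 = 3 * 3 * 5 :> R by ring.
  by rewrite !unitrM unit3; apply: unit_lt; lia.
apply: (mulrI u45); apply: (mulrI u45); rewrite sh4.
transitivity (120 * (45 * 'C(2 * k4 + 3 + k4, k4)%:R) : R); first by ring.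
rewrite eig eL; transitivity (- ((120 * 'C(2 * k3 + 3 + k3, k3)%:R) * 45 * J)); first by ring.
by rewrite -sh3; ring.
Qed.

Lemma s_half_jacobi : s (- 2^-1) = J ^+ 2.
Proof.
have hk : (4 * k0 < p)%N by lia.
have u : 'C(3 * quarter k0 3, quarter k0 3)%:R ^+ 2 \is a @GRing.unit R.
  by rewrite unitrX ?unit_bin_quarter.
apply: (mulrI u); rewrite -(s_half_quarter p_k0 (isT : 2 < 3)%N) bin_jacobi.
by rewrite sqrrN exprMn.
Qed.

Lemma unit_jacobi : J \is a GRing.unit.
Proof.
have hk : (4 * k0 < p)%N by lia.
have := unit_bin_quarter 4 hk; rewrite bin_jacobi unitrN unitrM.
by case/andP.
Qed.

Local Notation quad u := (teich u ^+ (2 * k0)).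

Lemma predE : p.-1 = (4 * k0)%N. Proof. by rewrite p_k0. Qed.

Lemma quad_sqr (u : 'F_p) : u != 0 -> quad u ^+ 2 = 1.
Proof.
by move=> u0; rewrite -exprM (_ : 2 * k0 * 2 = p.-1)%N ?teich_exp_pred // predE; lia.
Qed.

Lemma quadM (u v : 'F_p) : quad (u * v) = quad u * quad v.
Proof. by rewrite (teichM u) exprMn. Qed.

Lemma sum_quad : \sum_(u : 'F_p | u != 0) quad u = 0.
Proof.
rewrite sum_teichX predE (_ : (4 * k0 %| 2 * k0)%N = false) //.
by apply/negbTE; rewrite gtnNdvd //; lia.
Qed.

(** Adding [v = 0] contributes 1, and [v = 1] contributes 0. For [u] different from 1, the Moebius
    substitution maps the remaining [v] to all [w] other than [u], and the complete sum of the
    character is 0. *)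
Lemma sum_quad_product (u : 'F_p) : u != 0 ->
  \sum_(v : 'F_p | v != 0) quad ((1 - v) * (1 - u * v))
  = (if u == 1 then P - 1 else - quad u) - 1.
Proof.
move=> u0.
have q0 : quad (0 : 'F_p) = 0.
  by rewrite teich0 expr0n (_ : (2 * k0 == 0)%N = false) //; lia.
have q1 : quad (1 : 'F_p) = 1 by rewrite teich1 expr1n.
apply: (addIr 1); rewrite subrK.
have -> : \sum_(v : 'F_p | v != 0) quad ((1 - v) * (1 - u * v)) + 1
    = \sum_(v : 'F_p) quad ((1 - v) * (1 - u * v)).
  rewrite [RHS](bigD1 0) //= addrC; congr (_ + _).
  by rewrite !mulr0 !subr0 mulr1.
rewrite (bigD1 1) //= subrr mul0r q0 add0r.
case: eqP => [-> | /eqP u1].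
  transitivity (\sum_(v : 'F_p | v != 1) (1 : R)).
    apply: eq_bigr => v v1; rewrite mul1r quadM -expr2 quad_sqr //.
    by rewrite subr_eq0 eq_sym.
  rewrite sumr_const (_ : #|_| = p.-1); last by rewrite cardC1 card_Fp.
  by rewrite [in RHS]P_gt0 -natr1 addrK.
have u1' : u - 1 != 0 by rewrite subr_eq0.
transitivity (\sum_(w : 'F_p | w != u) quad w).
  rewrite (reindex_onto (fun w => (w - 1) / (w - u)) (fun v => (1 - u * v) / (1 - v))) /=.
    apply: eq_big => [w | w /andP[f1 /eqP gf]].
      have [-> | wu] := eqVneq w u.
        by rewrite subrr invr0 !mulr0 subr0 divr1 [1 == u]eq_sym (negbTE u1) andbF.
      rewrite !moebius_sub // mulfK ?eqxx ?andbT; last first.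
        by rewrite mulf_neq0 ?invr_neq0 ?subr_eq0 // eq_sym.
      rewrite -subr_eq0 -opprB oppr_eq0 moebius_sub // mulf_neq0 ?invr_neq0 ?subr_eq0 //.
      by rewrite eq_sym.
    have wu : w != u.
      apply/eqP => e; move: gf; rewrite e subrr invr0 !mulr0 subr0 divr1 => e1.
      by rewrite -e1 eqxx in u1.
    rewrite !moebius_sub // mulrCA quadM quadM -expr2 quad_sqr ?mulr1 //.
    by rewrite mulf_neq0 ?invr_neq0 ?subr_eq0 // eq_sym.
  by move=> v v1; rewrite moebiusK.
have : \sum_(w : 'F_p) quad w = 0 by rewrite (bigD1 0) //= q0 add0r sum_quad.
by rewrite (bigD1 u) //= addrC => /eqP; rewrite addr_eq0 => /eqP.
Qed.

Lemma sum_chi j : (j == 1 \/ j == 3)%N -> \sum_(u : 'F_p | u != 0) teich u ^+ (j * k0) = 0.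
Proof.
move=> hj; rewrite sum_teichX predE (_ : (4 * k0 %| j * k0)%N = false) //.
by apply/negbTE; rewrite gtnNdvd //; case: hj => /eqP ->; lia.
Qed.

(** Writing the second variable as [u v] cancels the quartic characters of [v], and the inner sum
    over [v] is quadratic. Only [u = 1] yields [P]; the other contributions are complete sums of
    nontrivial quartic characters. *)
Lemma jacobi_norm : J * J' = P.
Proof.
rewrite /jacobi_sum mulr_suml.
transitivity (\sum_(v : 'F_p | v != 0) \sum_(u : 'F_p | u != 0)
    teich u ^+ k0 * quad ((1 - v) * (1 - u * v))).
  apply: eq_bigr => v v0; rewrite mulr_sumr (reindex_inj (mulIf v0)) /=.
  apply: eq_big => [u | u u0]; first by rewrite mulf_eq0 negb_or v0 andbT.
  rewrite (teichM u v) exprMn quadM.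
  transitivity ((teich v ^+ (3 * k0) * teich v ^+ k0)
    * (teich u ^+ k0 * (quad (1 - v) * quad (1 - u * v)))); first by ring.
  by rewrite -exprD (_ : 3 * k0 + k0 = p.-1)%N ?teich_exp_pred ?mul1r // predE; lia.
rewrite exchange_big /=.
transitivity (\sum_(u : 'F_p | u != 0) ((if u == 1 then P else 0)
    - (teich u ^+ (3 * k0) + teich u ^+ (1 * k0)))).
  apply: eq_bigr => u u0; rewrite -mulr_sumr sum_quad_product //.
  case: eqP => [-> | _]; first by rewrite teich1 !expr1n; ring.
  by rewrite mul1n (_ : 3 * k0 = k0 + 2 * k0)%N ?exprD; [ring | lia].
rewrite sumrB big_split /= !sum_chi ?addr0 ?subr0 //; try by [left | right].
rewrite (bigD1 1) //= ?oner_neq0 // big1 ?addr0 // => u /andP[_ u1].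
by rewrite (negbTE u1).
Qed.

(** Integer lift of a sign in ['F_p], needed because [A] and [B] must be integers with bounds and
    parity, not only residues. *)
Definition sgF (u : 'F_p) : int := (u == 1)%:Z - (u == -1)%:Z.

Lemma Fp_neqN11 : (-1 : 'F_p) == 1 = false.
Proof.
apply/negbTE; rewrite eq_sym -subr_eq0 opprK -(natrD _ 1 1).
by rewrite -(dvdn_pcharf (pchar_Fp p_pr)) gtnNdvd //; lia.
Qed.

Lemma teich_sgF (u : 'F_p) : u ^+ 2 = 1 -> teich u = (sgF u)%:~R.
Proof.
move/eqP; rewrite sqrf_eq1 /sgF => /orP[] /eqP ->.
  by rewrite teich1 eqxx eq_sym Fp_neqN11.
by rewrite teichN1 eqxx Fp_neqN11.
Qed.

Lemma teich_sgF_quad (u : 'F_p) : quad u = (sgF (u ^+ (2 * k0)))%:~R.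
Proof.
have [-> | u0] := eqVneq u 0.
  rewrite teich0 !expr0n (_ : (2 * k0 == 0)%N = false) /=; last by lia.
  by rewrite /sgF ![0 == _]eq_sym oppr_eq0 oner_eq0.
rewrite teichX teich_sgF //.
by rewrite -exprM (_ : 2 * k0 * 2 = p.-1)%N ?Fp_exp_pred // predE; lia.
Qed.

Lemma norm_sgF (u v : 'F_p) : `|sgF u * sgF v| <= 1.
Proof. by rewrite /sgF; do 4![case: eqP => _]. Qed.

Lemma norm_sum_sgF (Q : pred 'F_p) (f g : 'F_p -> 'F_p) :
  `|\sum_(u | Q u) sgF (f u) * sgF (g u)| <= p%:Z.
Proof.
apply: (le_trans (ler_norm_sum _ _ _)).
apply: (@le_trans _ _ (\sum_(u : 'F_p) 1)); last by rewrite sumr_const card_Fp // natz.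
rewrite big_mkcond; apply: ler_sum => u _; case: ifP => // _; exact: norm_sgF.
Qed.

Lemma sgF_F2 (u : 'F_p) : u ^+ 2 = 1 -> (sgF u)%:~R = 1 :> 'F_2.
Proof.
move/eqP; rewrite sqrf_eq1 /sgF => /orP[] /eqP ->.
  by rewrite eqxx eq_sym Fp_neqN11.
by rewrite eqxx Fp_neqN11; apply/val_inj.
Qed.

Definition is_square (u : 'F_p) := u ^+ (2 * k0) == 1.

Lemma not_square (u : 'F_p) : u != 0 -> ~~ is_square u -> u ^+ (2 * k0) = -1.
Proof.
move=> u0; rewrite /is_square => n1; apply/eqP.
have : (u ^+ (2 * k0)) ^+ 2 == 1.
  by rewrite -exprM (_ : 2 * k0 * 2 = p.-1)%N ?Fp_exp_pred // predE; lia.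
by rewrite sqrf_eq1 (negbTE n1).
Qed.

Lemma Fp_nonsquare : exists2 g : 'F_p, g != 0 & g ^+ (2 * k0) = -1.
Proof.
have [g g0 gP] := Fp_prim_root; exists g => //; apply: not_square => //.
by rewrite /is_square -(prim_order_dvd gP) predE gtnNdvd //; lia.
Qed.

Lemma card_squares : (\sum_(u : 'F_p | (u != 0)%R && is_square u) 1 = 2 * k0)%N.
Proof.
have [g g0 gP] := Fp_nonsquare.
have tot : (\sum_(u : 'F_p | (u != 0)%R) 1 = 4 * k0)%N by rewrite sum1_card cardC1 card_Fp // predE.
rewrite (bigID is_square) /= in tot.
suff e : (\sum_(u : 'F_p | (u != 0)%R && is_square u) 1
    = \sum_(u : 'F_p | (u != 0)%R && ~~ is_square u) 1)%N.
  by move: tot; rewrite -e; set x := (\sum_(_ | _) _)%N; lia.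
rewrite (reindex_inj (mulfI g0)) /=; apply: eq_bigl => u.
rewrite mulf_eq0 (negbTE g0) /=; have [-> // | u0] := eqVneq u 0; rewrite /=.
rewrite {1}/is_square exprMn gP; have [sq | nsq] := boolP (is_square u).
  by rewrite (eqP sq) mulr1 Fp_neqN11.
by rewrite not_square // mulrNN mulr1 eqxx.
Qed.

(** The quartic character is a sign on squares and a sign times a fourth root of unity [i] on
    nonsquares, so [J = A - i B] and [J' = A + i B]. [A] is odd: it sums signs over the [2 k0 - 1]
    nonzero squares other than 1. *)
Lemma jacobi_sum_sqr : exists A B : int,
  [/\ J + J' = 2 * A%:~R, J * J' = A%:~R ^+ 2 + B%:~R ^+ 2, A%:~R = 1 :> 'F_2,
      `|A| <= p%:Z & `|B| <= p%:Z].
Proof.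
have [g g0 gP] := Fp_nonsquare; pose i := g ^+ k0.
have i0 : i != 0 by rewrite expf_neq0.
have i2 : i ^+ 2 = -1 by rewrite /i -exprM mulnC gP.
pose A := \sum_(u : 'F_p | (u != 0) && is_square u) sgF (u ^+ k0) * sgF ((1 - u) ^+ (2 * k0)).
pose B := \sum_(u : 'F_p | (u != 0) && ~~ is_square u)
  sgF (u ^+ k0 / i) * sgF ((1 - u) ^+ (2 * k0)).
have e3 (u : 'F_p) : teich u ^+ (3 * k0) = quad u * teich (u ^+ k0).
  by rewrite -teichX -exprD; congr (_ ^+ _); lia.
have sqE (u : 'F_p) : is_square u -> (u ^+ k0) ^+ 2 = 1.
  by rewrite -exprM mulnC => /eqP.
have nsqE (u : 'F_p) : u != 0 -> ~~ is_square u -> (u ^+ k0 / i) ^+ 2 = 1.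
  by move=> u0 nsq; rewrite expr_div_n -exprM mulnC not_square // i2 divrr // unitrN1.
have teich_i (u : 'F_p) : teich (u ^+ k0) = teich i * teich (u ^+ k0 / i).
  by rewrite -teichM mulrCA divff ?mulr1.
have JE : J = A%:~R - teich i * B%:~R.
  rewrite /jacobi_sum (bigID is_square) /= !rmorph_sum /= mulr_sumr -sumrN; congr (_ + _).
    apply: eq_bigr => u /andP[u0 sq]; rewrite e3 teichX (eqP sq) teich1 mul1r.
    by rewrite rmorphM /= -teich_sgF_quad -teich_sgF ?sqE.
  apply: eq_bigr => u /andP[u0 nsq]; rewrite e3 teichX not_square // teichN1 mulN1r.
  by rewrite rmorphM /= -teich_sgF_quad -teich_sgF ?nsqE // teich_i mulNr mulrA.
have J'E : J' = A%:~R + teich i * B%:~R.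
  rewrite /jacobi_sum (bigID is_square) /= !rmorph_sum /= mulr_sumr; congr (_ + _).
    apply: eq_bigr => u /andP[u0 sq].
    by rewrite rmorphM /= -teich_sgF_quad -teich_sgF ?sqE // teichX.
  apply: eq_bigr => u /andP[u0 nsq].
  by rewrite rmorphM /= -teich_sgF_quad -teich_sgF ?nsqE // mulrA -teich_i teichX.
exists A, B; split; rewrite ?norm_sum_sgF //.
- by rewrite JE J'E; ring.
- rewrite JE J'E; transitivity (A%:~R ^+ 2 - teich i ^+ 2 * B%:~R ^+ 2 : R); first by ring.
  by rewrite teichX i2 teichN1; ring.
have s1 : (1 != 0 :> 'F_p) && is_square 1 by rewrite oner_neq0 /is_square expr1n eqxx.
rewrite /A rmorph_sum (bigD1 1) //= subrr expr0n (_ : (2 * k0 == 0)%N = false); last by lia.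
rewrite rmorphM /= [X in _ * X](_ : _ = 0) ?mulr0 ?add0r; last first.
  by rewrite /sgF ![0 == _]eq_sym oppr_eq0 oner_eq0.
have := card_squares; rewrite (bigD1 1) //= => card.
transitivity (\sum_(u : 'F_p | ((u != 0) && is_square u) && (u != 1)) 1 : 'F_2).
  apply: eq_bigr => u /andP[/andP[u0 sq] u1]; rewrite rmorphM /= !sgF_F2 ?mulr1 ?sqE //.
  by rewrite -exprM (_ : 2 * k0 * 2 = p.-1)%N ?Fp_exp_pred ?predE ?subr_eq0 1?eq_sym //; lia.
transitivity ((\sum_(u : 'F_p | [&& (u != 0)%R && is_square u & (u != 1)%R]) 1)%N%:R : 'F_2).
  by rewrite natr_sum.
move: card; set x := (\sum_(_ | _) _)%N => card.
rewrite (_ : x = (k0.-1 * 2 + 1)%N); last by lia.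
by rewrite natrD natrM (_ : 2 = 0 :> 'F_2) ?mulr0 ?add0r //; apply/val_inj.
Qed.

End JacobiSum.

(** * The two residue classes *)

Hypothesis R_char : forall n : int, n%:~R = 0 :> R -> ((p ^ 3)%N %| n)%Z.

Local Notation red := (@reduces p R).

Let redN n : red n%:R n%:R. Proof. exact: reduces_nat. Qed.
Let redZ (n : int) : red n%:~R n%:~R. Proof. exact: reduces_int. Qed.
Let redD r x r' x' : red r x -> red r' x' -> red (r + r') (x + x').
Proof. exact: reducesD. Qed.
Let redB r x r' x' : red r x -> red r' x' -> red (r - r') (x - x').
Proof. exact: reducesB. Qed.
Let redM r x r' x' : red r x -> red r' x' -> red (r * r') (x * x').
Proof. exact: reducesM. Qed.
Let redX r x n : red r x -> red (r ^+ n) (x ^+ n).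
Proof. exact: reducesX. Qed.
Let red_div r x r' x' : red r x -> red r' x' -> x' \is a GRing.unit -> red (r / r') (x / x').
Proof. exact: reduces_div. Qed.

Lemma unit64 k : (64 : R) ^+ k \is a GRing.unit.
Proof. by rewrite unitrX // (_ : 64 = 4 ^+ 3) ?unitrX ?unit4 //; ring. Qed.

Lemma reduces_half_sum : red (\sum_(k < p) binom_cube k) (s (- 2^-1)).
Proof.
apply: reduces_sum => // k _; rewrite clausen_term_half ?unit4 ?unit_fact //.
by apply: red_div; rewrite ?unit64 //; apply: redX; apply: redN.
Qed.

Lemma reduces_half_sum1 :
  red (- \sum_(k < p) binom_cube k * ((2 * k%:R + 1) / (2 * k%:R - 1))) (s 2^-1).
Proof.
suff H n : (n < p)%N -> red (- \sum_(k < n.+1) binom_cube k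
    * ((2 * k%:R + 1) / (2 * k%:R - 1))) (@clausen_sum R n.+1 2^-1).
  by have := H p.-1; rewrite -P_gt0; apply.
move=> lt_np; rewrite /clausen_sum !big_ord_recl opprD.
apply: redD.
  rewrite shifted_prod0 /clausen_weight /binom_cube bin0 fact0 !expr0 !expr1n !mulr0 !divr1.
  rewrite add0r sub0r !mulr1 mul1r invrN1 opprK.
  by rewrite divr1; apply: (redN 1).
rewrite -sumrN; apply: reduces_sum => // i _; have hi := ltn_ord i.
rewrite [nat_of_ord (lift _ _)]/= [bump 0 i]add1n.
rewrite clausen_term_half1 ?unit4 ?unit_fact //; last by lia.
rewrite binom_cube_catalan; apply: reducesN => //.
apply: red_div; rewrite ?unitrM ?unit64 ?unit_lt //; last by lia.
  apply: redM; last by apply: redD; [apply: redM; apply: redN | apply: redN].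
  apply: redM; last exact: redN.
  by apply: redM; [exact: redN | apply: redX; exact: redN].
by apply: redM; [apply: redX; exact: redN | exact: redN].
Qed.

(** A single term may have [p^2] in its denominator, at [k = (p+1)/2]. Integrality is obtained from
    the telescoped form, whose pieces all reduce. *)
Lemma reduces_lhs :
  red (\sum_(0 <= k < p) ('C(2 * k, k)%:R ^+ 3 / (64 ^+ k * (2 * k%:R - 1) ^+ 2)))
    ((s (- 2^-1) + 3 * s 2^-1) / 2).
Proof.
rewrite big_mkord -[X in red X _](mulKf (_ : 2 != 0)) // [X in red X _]mulrC.
apply: red_div; [|exact: redN|exact: unit2].
rewrite sum_binom_cube -[X in red _ X]subr0; apply: redB.
  by apply: redD; [exact: reduces_half_sum | apply: redM; [exact: redN | exact: reduces_half_sum1]].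
have u : 2 * P - 1 \is a GRing.unit.
  rewrite [X in X \is a _](_ : _ = -1 + P * 2); last by ring.
  by rewrite unitDP ?unitrN1.
have -> : 0 = 16 * P ^+ 3 * ('C(2 * p, p)%:R ^+ 3 / 64 ^+ p) / (2 * P - 1) ^+ 2 :> R.
  by rewrite P3; ring.
apply: red_div; rewrite ?unitrX //.
  apply: redM; first by apply: redM; [exact: redN | apply: redX; exact: redN].
  by apply: red_div; rewrite ?unit64 //; apply: redX; exact: redN.
by apply: redX; apply: redB; [apply: redM; exact: redN | exact: (redN 1)].
Qed.

Lemma main_1mod4 k0 (x y : int) :
  p = (4 * k0).+1 -> (2 < k0)%N -> p%:Z = x ^+ 2 + 4 * y ^+ 2 ->
  eqmodq p 3
    (\sum_(0 <= k < p) ('C(2 * k, k)%:R ^+ 3 / (64 ^+ k * (2 * k%:R - 1) ^+ 2)))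
    (2 * x%:~R ^+ 2 - p%:R - p%:R ^+ 2 / (2 * x%:~R ^+ 2)).
Proof.
move=> hp hk0 exy; apply: (reduces_eqmodq p_pr P3 unitN R_char reduces_lhs).
have [A [B [eJ eN oddA leA leB]]] := jacobi_sum_sqr hp hk0.
have sJ := s_half_jacobi hp hk0; have uJ := unit_jacobi hp hk0.
have nJ := jacobi_norm hp hk0; have sp := s_half_prod.
set J := jacobi_sum (3 * k0) _ in eJ eN sJ uJ nJ; set J' := jacobi_sum k0 _ in eJ eN nJ.
(* The ring yields this only modulo [p^3]; since [|A|] and [|B|] are at most [p] and [p > 3], the
   difference is less than [p^3] in absolute value. *)
have eAB : A ^+ 2 + B ^+ 2 = p%:Z.
  have : ((p ^ 3)%N %| A ^+ 2 + B ^+ 2 - p%:Z)%Z.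
    apply: R_char; rewrite rmorphB rmorphD !rmorphXn /= -eN nJ; exact: subrr.
  case/dvdzP => c ec; have c0 : c = 0.
    have p0 : 0 < (p ^ 3)%N%:Z by rewrite ltz_nat expn_gt0 prime_gt0.
    have sqr_le (C : int) : `|C| <= p%:Z -> 0 <= C ^+ 2 <= p%:Z ^+ 2.
      by move=> leC; rewrite sqr_ge0 -(real_normK (num_real C)) lerXn2r ?nnegrE.
    have /andP[A0 A2] := sqr_le _ leA; have /andP[B0 B2] := sqr_le _ leB.
    have p3 : (p ^ 3)%N%:Z = p%:Z * p%:Z ^+ 2 by rewrite -exprS -!natz natrX.
    have pp : 3 * p%:Z ^+ 2 <= p%:Z * p%:Z ^+ 2 by rewrite ler_wpM2r ?sqr_ge0 // lez_nat ltnW.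
    have p2 : p%:Z <= p%:Z ^+ 2 by rewrite expr2 ler_peMl // lez_nat prime_gt0.
    have lt1 : c < 1 by rewrite -(ltr_pM2r p0) mul1r -ec p3; lia.
    have gt1 : -1 < c by rewrite -(ltr_pM2r p0) mulN1r -ec p3; lia.
    lia.
  by move: ec; rewrite c0 mul0r => /eqP; rewrite subr_eq0 => /eqP.
have ex : A ^+ 2 = x ^+ 2.
  apply: (@sum_two_squares_uniq p A B x (2 * y)) => //.
    by rewrite exy exprMn.
  by rewrite rmorphM /= (_ : 2%:~R = 0 :> 'F_2) ?mul0r //; apply/val_inj.
pose X : R := x%:~R ^+ 2.
have eX : X = A%:~R ^+ 2 by rewrite /X -!rmorphXn ex.
pose w := J^-1; have Jw : J * w = 1 by rewrite divrr.
have J'w : J' = P * w by rewrite -nJ -[LHS]mul1r -Jw; ring.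
(* This is [(2A)^2 = (J + J')^2] with [J' = P / J]. It also gives [P^2 / (2X) = 2 P^2 / J^2], so
   every term of the claim is expressed in [J]. *)
have e4X : 4 * X = J ^+ 2 + P * (2 + P * w ^+ 2).
  transitivity ((2 * A%:~R) ^+ 2 : R); first by rewrite eX; ring.
  rewrite -eJ; transitivity (J ^+ 2 + 2 * (J * J') + J' ^+ 2); first by ring.
  by rewrite nJ J'w; ring.
have u4X : 4 * X \is a GRing.unit by rewrite e4X unitDP // unitrX.
have uX : X \is a GRing.unit by move: u4X; rewrite unitrM => /andP[].
have u2X : 2 * X \is a GRing.unit by rewrite unitrM unit2.
have PX : P ^+ 2 / (2 * X) = 2 * P ^+ 2 * w ^+ 2.
  apply: (mulIr u2X); rewrite divrK //.
  transitivity (P ^+ 2 * w ^+ 2 * (4 * X)); last by ring.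
  rewrite e4X; transitivity (P ^+ 2 * (J * w) ^+ 2 + P ^+ 3 * (w ^+ 2 * (2 + P * w ^+ 2))).
    by rewrite Jw P3mul; ring.
  by ring.
have s1 : s 2^-1 = - P ^+ 2 * w ^+ 2.
  rewrite -sp sJ; transitivity (s 2^-1 * (J * w) ^+ 2); first by rewrite Jw; ring.
  by ring.
have -> : (s (- 2^-1) + 3 * s 2^-1) / 2 = 2 * X - P - P ^+ 2 / (2 * X).
  rewrite PX s1 sJ; apply: (mulIr unit2); rewrite divrK ?unit2 //.
  transitivity (4 * X - 2 * P - 4 * P ^+ 2 * w ^+ 2); last by ring.
  by rewrite e4X; ring.
have rx : red (x%:~R ^+ 2) X by apply: redX; apply: redZ.
apply: redB; first by apply: redB; [apply: redM; [exact: redN | exact: rx] | exact: redN].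
apply: red_div; [apply: redX; exact: redN | apply: redM; [exact: redN | exact: rx] | exact: u2X].
Qed.

Lemma main_3mod4 : odd m -> let b : rat := 'C(m, m./2)%:R in
  eqmodq p 3
    (\sum_(0 <= k < p) ('C(2 * k, k)%:R ^+ 3 / (64 ^+ k * (2 * k%:R - 1) ^+ 2)))
    (3 * (p%:R + 1) ^+ 2 / 2 ^+ p * b ^+ 2
      + 3 / 4 * p%:R ^+ 2 * b ^+ 2 * (euler (p - 3))%:~R
      - p%:R ^+ 2 / 2 * b ^- 2).
Proof.
move=> odd_m b; apply: (reduces_eqmodq p_pr P3 unitN R_char reduces_lhs).
have s1 := s_half_3mod4 odd_m; have sp := s_half_prod.
pose E : R := (euler (p - 3))%:~R; rewrite -/E in s1.
pose c : R := 'C(m, m./2)%:R; rewrite -/c in s1.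
have uc : c \is a GRing.unit.
  have : (m`!%:R : R) \is a GRing.unit by apply: unit_fact; have := p_eq; lia.
  rewrite -(@bin_fact m m./2); last by lia.
  by rewrite natrM unitrM => /andP[].
have [d ed] := expr2_P1.
have u2p : (2 ^+ p.-1 : R) \is a GRing.unit by rewrite unitrX ?unit2.
have uS : s 2^-1 \is a GRing.unit.
  have : s 2^-1 * 2 ^+ p.-1 \is a GRing.unit.
    rewrite s1 unitrM unitrX // (_ : _ + _ = 1 + P * (2 + P + P * E / 2)); last by ring.
    by rewrite unitDP ?unitr1.
  by rewrite unitrM => /andP[].
(* Modulo [p] both [2^(p-1)] and the correction in [s_half_3mod4] are 1. This is all the precision
   needed to divide [- P^2] by [s(1/2)]. *)
have Ps : P ^+ 2 * s 2^-1 = P ^+ 2 * c ^+ 2.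
  transitivity (P ^+ 2 * (s 2^-1 * 2 ^+ p.-1)).
    rewrite ed; transitivity (P ^+ 2 * s 2^-1 + P ^+ 3 * (s 2^-1 * d)); last by ring.
    by rewrite P3mul addr0.
  rewrite s1; transitivity (P ^+ 2 * c ^+ 2 + P ^+ 3 * (c ^+ 2 * (2 + P + P * E / 2))).
    by ring.
  by rewrite P3mul addr0.
have s0 : s (- 2^-1) = - (P ^+ 2 / c ^+ 2).
  have uc2 : c ^+ 2 \is a GRing.unit by rewrite unitrX.
  apply: (mulIr uS); rewrite sp; apply: (mulIr uc2).
  transitivity (- ((P ^+ 2 * s 2^-1) * (c ^+ 2 / c ^+ 2))); last by ring.
  by rewrite divrr // Ps; ring.
have e2p : 2 ^+ p = 2 * 2 ^+ p.-1 :> R by rewrite -exprS -P_gt0.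
have u2pp : (2 ^+ p : R) \is a GRing.unit by rewrite unitrX ?unit2.
have -> : (s (- 2^-1) + 3 * s 2^-1) / 2
    = 3 * (P + 1) ^+ 2 / 2 ^+ p * c ^+ 2 + 3 / 4 * P ^+ 2 * c ^+ 2 * E - P ^+ 2 / 2 * c ^- 2.
  have -> : (2 ^+ p)^-1 = (2 ^+ p.-1)^-1 / 2 :> R by rewrite e2p invrM ?unit2 // mulrC.
  have -> : 4^-1 = 2^-1 / 2 :> R by rewrite -invrM ?unit2 // -natrM.
  have -> : s 2^-1 = c ^+ 2 * ((1 + P) ^+ 2 + P ^+ 2 * E / 2) / 2 ^+ p.-1.
    by rewrite -s1 mulrK.
  have Pq : P ^+ 2 / 2 ^+ p.-1 = P ^+ 2.
    apply: (mulIr u2p); rewrite divrK // ed.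
    by rewrite -[LHS]addr0 -(P3mul d); ring.
  rewrite s0; set q := (2 ^+ p.-1)^-1 in Pq *.
  transitivity (3 * (P + 1) ^+ 2 * (q / 2) * c ^+ 2 + 3 * (2^-1 / 2) * (P ^+ 2 * q) * c ^+ 2 * E
    - P ^+ 2 / 2 * c ^- 2); first by ring.
  by rewrite Pq; ring.
have rb : red b c by exact: redN.
have rb2 : red (b ^+ 2) (c ^+ 2) by apply: redX.
have rp : red p%:R P by exact: redN.
have r2 : red 2 2 := redN 2; have r3 : red 3 3 := redN 3; have r4 : red 4 4 := redN 4.
have r1 : red 1 1 := redN 1.
apply: redB.
  apply: redD.
    apply: redM => //; apply: red_div => //; last by apply: redX.
    by apply: redM => //; apply: redX; apply: redD.
  apply: redM; last exact: redZ.
  apply: redM => //; apply: redM; last exact: redX.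
  by apply: red_div => //; exact: unit4.
apply: redM; first by apply: red_div => //; [exact: redX | exact: unit2].
by apply: reducesV => //; rewrite unitrX.
Qed.

End ModCube.

(** * The integers modulo [p^3] as the abstract ring *)

Section ZmodCube.

Variable p : nat.
Hypothesis p_pr : prime p.

Local Notation R := 'Z_(p ^ 3).

Lemma Zp3_gt1 : (1 < p ^ 3)%N.
Proof. by rewrite -{1}(exp1n 3) ltn_exp2r ?prime_gt1. Qed.

Lemma Zp3_cube : (p%:R : R) ^+ 3 = 0.
Proof. by rewrite -natrX pchar_Zp ?Zp3_gt1. Qed.

Lemma Zp3_unit n : ~~ (p %| n)%N -> (n%:R : R) \is a GRing.unit.
Proof. by move=> pn; rewrite unitZpE ?Zp3_gt1 // coprimeXl // prime_coprime. Qed.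

Lemma Zp3_char (n : int) : n%:~R = 0 :> R -> ((p ^ 3)%N %| n)%Z.
Proof.
have nat_char k : (k%:R : R) = 0 -> (p ^ 3 %| k)%N.
  by move/(congr1 (fun x : R => x : nat)); rewrite val_Zp_nat ?Zp3_gt1 // => /eqP.
case: n => n; first exact: nat_char.
rewrite NegzE rmorphN => /eqP; rewrite oppr_eq0 => /eqP h.
by rewrite dvdzE abszN; exact: nat_char.
Qed.

End ZmodCube.

(** * The primes 3 and 5 *)

Lemma sum3 (V : nmodType) (F : nat -> V) a0 a1 a2 :
  F 0 = a0 -> F 1 = a1 -> F 2 = a2 -> \sum_(0 <= k < 3) F k = a0 + a1 + a2.
Proof. by move=> <- <- <-; rewrite big_mkord !big_ord_recr big_ord0 /= add0r. Qed.

Lemma sum5 (V : nmodType) (F : nat -> V) a0 a1 a2 a3 a4 :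
  F 0 = a0 -> F 1 = a1 -> F 2 = a2 -> F 3 = a3 -> F 4 = a4 ->
  \sum_(0 <= k < 5) F k = a0 + a1 + a2 + a3 + a4.
Proof. by move=> <- <- <- <- <-; rewrite big_mkord !big_ord_recr big_ord0 /= add0r. Qed.

Lemma central_bins : ('C(2 * 0, 0) = 1) * ('C(2 * 1, 1) = 2) * ('C(2 * 2, 2) = 6)
  * ('C(2 * 3, 3) = 20) * ('C(2 * 4, 4) = 70).
Proof. by []. Qed.

(* Here p = 3, where Wolstenholme's congruence fails, and p = 5, where the constant 45 of
   [quarter_eigen] is not invertible. *)
Section SmallPrimes.

Variables (p : nat) (R : comUnitRingType).
Hypothesis p_pr : prime p.
Hypothesis P3 : (p%:R : R) ^+ 3 = 0.
Hypothesis unitN : forall n, ~~ (p %| n)%N -> (n%:R : R) \is a GRing.unit.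
Hypothesis R_char : forall n : int, n%:~R = 0 :> R -> ((p ^ 3)%N %| n)%Z.

Local Notation lhs p :=
  (\sum_(0 <= k < p) 'C(2 * k, k)%:R ^+ 3 / (64 ^+ k * (2 * k%:R - 1) ^+ 2)).
Lemma sum_term_3 : lhs 3 = 1 + 8^-1 + 3 * 8^-1 ^+ 3 :> rat.
Proof. by apply: sum3; rewrite central_bins; field. Qed.

Lemma sum_term_5 : lhs 5 =
  1 + 8^-1 + 3 * 8^-1 ^+ 3 + 5 * 8^-1 ^+ 4 + 7 * 5 ^+ 3 * 8^-1 ^+ 7 :> rat.
Proof. by apply: sum5; rewrite central_bins; field. Qed.

Local Notation t := (8^-1 : R).

Local Notation red := (@reduces p R).

Let redN n : red n%:R n%:R. Proof. exact: reduces_nat. Qed.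
Let redD r x r' x' : red r x -> red r' x' -> red (r + r') (x + x').
Proof. exact: reducesD. Qed.
Let redM r x r' x' : red r x -> red r' x' -> red (r * r') (x * x').
Proof. exact: reducesM. Qed.
Let redX r x n : red r x -> red (r ^+ n) (x ^+ n).
Proof. exact: reducesX. Qed.

Let unit8 : odd p -> (8 : R) \is a GRing.unit.
Proof.
move=> p_odd; apply: (unitN (n := 8)); rewrite (_ : 8 = 2 ^ 3)%N // Euclid_dvdX //.
by rewrite dvdn_prime2 // andbT; apply: contraTneq p_odd => ->.
Qed.

Let red8V : odd p -> red 8^-1 t.
Proof. by move=> p_odd; apply: reducesV (redN 8) _ => //; exact: unit8. Qed.

Lemma eqmodq_5 (x y : int) : p = 5 -> 5%:Z = x ^+ 2 + 4 * y ^+ 2 ->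
  eqmodq p 3 (lhs 5) (2 * x%:~R ^+ 2 - 5%:R - 5%:R ^+ 2 / (2 * x%:~R ^+ 2)).
Proof.
move=> p5 exy; have x1 : x ^+ 2 = 1.
  have y1 : y ^+ 2 <= 1 by have := sqr_ge0 x; lia.
  have [y0 | y0] := eqVneq y 0.
    have : (`|x| * `|x|)%N = 5%N by have := abszM x x; rewrite -expr2; lia.
    by case: (`|x|%N) => [|[|[|n]]] //; rewrite !mulSn; lia.
  have : 0 < y ^+ 2 by rewrite exprn_even_gt0.
  by lia.
have -> : x%:~R ^+ 2 = 1 :> rat by rewrite -rmorphXn x1.
have [r8 u8 P0] : [/\ red 8^-1 t, (8 : R) \is a GRing.unit & (5 : R) ^+ 3 = 0].
  by split; [apply: red8V | apply: unit8 | rewrite -P3]; rewrite p5.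
rewrite sum_term_5.
rewrite [X in eqmodq _ _ _ X](_ : _ = - (124 * 8^-1)); last by field.
(* All values are written in powers of [1/8], so the congruence is a polynomial identity in [t]
   using only [8 t = 1] and [5^3 = 0]. *)
apply: (reduces_eqmodq p_pr P3 unitN R_char
  (x := 1 + t + 3 * t ^+ 3 + 5 * t ^+ 4 + 7 * 5 ^+ 3 * t ^+ 7)).
  have r3 : red (3 * 8^-1 ^+ 3) (3 * t ^+ 3) by apply: redM (redN 3) (redX 3 r8).
  have r4 : red (5 * 8^-1 ^+ 4) (5 * t ^+ 4) by apply: redM (redN 5) (redX 4 r8).
  have r7 : red (7 * 5 ^+ 3) (7 * 5 ^+ 3) by apply: redM (redN 7) (redX 3 (redN 5)).
  exact: redD (redD (redD (redD (redN 1) r8) r3) r4) (redM r7 (redX 7 r8)).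
have t8 : 8 * t = 1 by rewrite divrr.
rewrite (_ : 1 + _ + _ + _ + _ = - (124 * t)); first by apply: reducesN => //; exact: redM.
transitivity ((8 * t) ^+ 4 + t + 3 * t ^+ 3 * (8 * t) + 5 * t ^+ 4 + 7 * 5 ^+ 3 * t ^+ 7).
  by rewrite t8; ring.
transitivity (5 ^+ 3 * (t + 33 * t ^+ 4 + 7 * t ^+ 7) - 124 * t); first by ring.
by rewrite P0; ring.
Qed.

Lemma eqmodq_3 : p = 3 -> let b : rat := 'C((3 - 1) %/ 2, (3 - 3) %/ 4)%:R in
  eqmodq p 3 (lhs 3)
    (3 * (3%:R + 1) ^+ 2 / 2 ^+ 3 * b ^+ 2
     + 3 / 4 * 3%:R ^+ 2 * b ^+ 2 * (euler (3 - 3))%:~R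
     - 3%:R ^+ 2 / 2 * b ^- 2).
Proof.
move=> p3; rewrite (_ : (3 - 1) %/ 2 = 1)%N // (_ : (3 - 3) %/ 4 = 0)%N // bin0 euler0 /=.
have [r8 u8 P0] : [/\ red 8^-1 t, (8 : R) \is a GRing.unit & (3 : R) ^+ 3 = 0].
  by split; [apply: red8V | apply: unit8 | rewrite -P3]; rewrite p3.
rewrite sum_term_3.
rewrite [X in eqmodq _ _ _ X](_ : _ = 66 * 8^-1); last by field.
apply: (reduces_eqmodq p_pr P3 unitN R_char (x := 1 + t + 3 * t ^+ 3)).
  exact: redD (redD (redN 1) r8) (redM (redN 3) (redX 3 r8)).
have t8 : 8 * t = 1 by rewrite divrr.
rewrite (_ : 1 + _ + _ = 66 * t); first exact: redM.
transitivity ((8 * t) ^+ 3 + t + 3 * t ^+ 3); first by rewrite t8; ring.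
transitivity (t + 65 * t * (8 * t) ^+ 2 - 3 ^+ 3 * (135 * t ^+ 3)); first by ring.
by rewrite t8 P0; ring.
Qed.

End SmallPrimes.

Theorem theorem5p2 (p : nat) (p_prime : prime p) (p_odd : odd p) :
  (forall x y : int,
     (p %% 4)%N = 1%N ->
     p%:Z = x ^+ 2 + 4 * y ^+ 2 ->
     eqmodq p 3
       (\sum_(0 <= k < p)
          'C(2 * k, k)%:R ^+ 3 / (64 ^+ k * (2 * k%:R - 1) ^+ 2))
       (2 * x%:~R ^+ 2 - p%:R - p%:R ^+ 2 / (2 * x%:~R ^+ 2)))
  /\
  ((p %% 4)%N = 3%N ->
   let b : rat := 'C((p - 1) %/ 2, (p - 3) %/ 4)%:R in
   eqmodq p 3
     (\sum_(0 <= k < p)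
        'C(2 * k, k)%:R ^+ 3 / (64 ^+ k * (2 * k%:R - 1) ^+ 2))
     (3 * (p%:R + 1) ^+ 2 / 2 ^+ p * b ^+ 2
      + 3 / 4 * p%:R ^+ 2 * b ^+ 2 * (euler (p - 3))%:~R
      - p%:R ^+ 2 / 2 * b ^- 2)).
Proof.
have P3 := Zp3_cube p_prime; have unitN := @Zp3_unit p p_prime.
have charR := @Zp3_char p p_prime.
split=> [x y p1 exy | p3].
  have [p5 | p5] := eqVneq p 5.
    by subst p; exact: (eqmodq_5 p_prime P3 unitN charR erefl exy).
  have hp : p = (4 * (p %/ 4)).+1 by lia.
  have k0 : (2 < p %/ 4)%N.
    (* Below 13 the residues 1 modulo 4 are 1, 5 and 9. With 5 treated apart, no prime is left
       there. *)
    rewrite ltnNge; apply/negP => le2; have : (p == 1) || (p == 9) by lia.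
    by case/orP => /eqP p_eq; rewrite p_eq in p_prime.
  by apply: (main_1mod4 p_prime _ P3 unitN charR hp k0 exy); lia.
have [p_3 | p_3] := eqVneq p 3.
  by subst p; exact: (eqmodq_3 p_prime P3 unitN charR erefl).
have -> : ((p - 1) %/ 2 = p./2)%N by lia.
have -> : ((p - 3) %/ 4 = p./2./2)%N by lia.
by apply: (main_3mod4 p_prime _ P3 unitN charR); lia.
Qed.
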